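(* Let $(M^n,g_{ij}(t))$, $t\in(0,T]$, be a complete smooth Ricci flow, $\frac{\partial}{\partial t}g_{ij}=-2R_{ij}$, with uniformly bounded curvature (there is a constant $C$ with $|\mathrm{Rm}|\le C$ on $M\times(0,T]$). For $N\in\mathbb{N}$ let $(\mathbb{H}^N,g_{\alpha\beta})$ be the $N$-dimensional hyperbolic space of constant sectional curvature $-\frac{1}{2N}$. On $\tilde M=M\times\mathbb{H}^N\times(0,T]$ define $\tilde g=\tilde g^{(N)}$ by $$\tilde g_{ij}=g_{ij}(t),\quad \tilde g_{\alpha\beta}=t\,g_{\alpha\beta},\quad \tilde g_{00}=\mathrm{R}-\frac{N}{2t},\quad \tilde g_{i\alpha}=\tilde g_{0i}=\tilde g_{0\alpha}=0,$$ where $i,j$ are indices on $M$, $\alpha,\beta$ are indices on $\mathbb{H}^N$, $0$ is the index of the coordinate $t$, and $\mathrm{R}$ is the scalar curvature of $g_{ij}(t)$. Then, with ''$=O(1/N)$'' understood as in the context: (1) $(\tilde M,\tilde g)$ is Ricci flat up to errors of order $\frac1N$: every component of the Ricci tensor of $\tilde g$ satisfies $\tilde R_{ab}=O(1/N)$. (2) Hamilton's Harnack expression $Z=R_{ijkl}U^{ij}U^{kl}+2P_{ijk}U^{ij}X^k+M_{ij}X^iX^j$ appears as the full curvature operator of $\tilde g$ up to errors of order $\frac1N$, i.e. its coefficients are the components of the curvature tensor of $\tilde g$ in the sense that $$\tilde R_{ijkl}=R_{ijkl}+O(1/N),\qquad \tilde R_{ij0k}=P_{ijk}+O(1/N),\qquad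 \tilde R_{i0j0}=M_{ij}+O(1/N),$$ and all components $\tilde R_{abcd}$ with at least one index from the $\mathbb{H}^N$ factor are $O(1/N)$.
   Context: Curvature conventions: for a (pseudo-)Riemannian metric with Levi-Civita connection $\nabla$, $\mathrm{Rm}(X,Y)Z=\nabla_Y\nabla_XZ-\nabla_X\nabla_YZ+\nabla_{[X,Y]}Z$, $\mathrm{Rm}(X,Y,Z,W)=\langle \mathrm{Rm}(X,Y)Z,W\rangle$, $R_{ijkl}=\mathrm{Rm}(\partial_i,\partial_j,\partial_k,\partial_l)$ (so $R_{ijij}>0$ on the round sphere), $R_{ij}=g^{kl}R_{ikjl}$, $\mathrm{R}=g^{ij}R_{ij}$. Tildes denote the corresponding quantities for $\tilde g$; untilded quantities refer to $g_{ij}(t)$ on $M$. Einstein summation is used. Define on $M$ at time $t$, with $\nabla,\Delta$ the Levi-Civita connection and Laplacian $\Delta=g^{ij}\nabla_i\nabla_j$ of $g(t)$, $$P_{ijk}=\nabla_iR_{jk}-\nabla_jR_{ik},\qquad M_{ij}=\Delta R_{ij}-\tfrac12\nabla_i\nabla_j\mathrm{R}+2R_{ikjl}R^{kl}-R_{ik}R_j{}^k+\tfrac{1}{2t}R_{ij}.$$ Meaning of ''up to errors of order $1/N$'': fix a point $(x,t)\in M\times(0,T]$ and local coordinates of $M$ near $x$, both independent of $N$. For all sufficiently large $N$, $\tilde g$ is nondegenerate (Lorentzian). At a point $(x,y,t)\in\tilde M$ take components with respect to the basis consisting of the coordinate vectors $\partial_i$ of $M$, a $g_{\alpha\beta}$-orthonormal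 basis of $T_y\mathbb{H}^N$, and $\partial_0=\partial_t$. A component is $O(1/N)$ if its absolute value is at most $C'/N$ for all sufficiently large $N$, where $C'$ may depend on the flow, $(x,t)$ and the coordinates on $M$, but not on $N$, $y$, the orthonormal basis, or the indices. *)

(* Defs.v *)
From HB Require Import structures.
From mathcomp Require Import all_boot all_order all_algebra.
From mathcomp Require Import all_classical all_reals all_analysis.

Set Implicit Arguments.
Unset Strict Implicit.
Unset Printing Implicit Defensive.

Import Order.TTheory GRing.Theory Num.Theory.
Import numFieldNormedType.Exports.

Local Open Scope classical_set_scope.
Local Open Scope ring_scope.

(* Partial derivatives are relative to a domain D: difference quotients only
   use points of D.  At interior points these are the usual derivatives; on
   D = U x ]0, T] the time derivative at T is one-sided. *)
Section Calculus.
Context {R : realType} {m : nat}.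
Implicit Types (D : set 'rV[R]_m) (f : 'rV[R]_m -> R) (a : 'I_m).

Definition basis_vec a : 'rV[R]_m := delta_mx 0 a.

Definition diff_quot a f (p : 'rV[R]_m) (h : R) : R :=
  h^-1 * (f (h *: basis_vec a + p) - f p).

Definition admissible D a (p : 'rV[R]_m) : set_system R :=
  within [set h : R | D (h *: basis_vec a + p)] 0^'.

Definition has_partial D a f (p : 'rV[R]_m) : Prop :=
  cvg (diff_quot a f p @ admissible D a p).

Definition partial D a f (p : 'rV[R]_m) : R :=
  lim (diff_quot a f p @ admissible D a p).

Definition iter_partial D (s : seq 'I_m) f : 'rV[R]_m -> R :=
  foldr (partial D) f s.

Definition smooth_on D f : Prop :=
  forall s : seq 'I_m,
    {within D, continuous (iter_partial D s f)} /\
    forall a p, D p -> has_partial D a (iter_partial D s f) p.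

End Calculus.

Section LocalGeometry.
Context {R : realType} {m : nat}.
Variables (D : set 'rV[R]_m) (g : 'rV[R]_m -> 'M[R]_m).
Implicit Types (X Y Z : 'rV[R]_m -> 'rV[R]_m) (p u v w z : 'rV[R]_m).
Implicit Types (i j k l : 'I_m).

Definition ginv p : 'M[R]_m := invmx (g p).

(* christoffel k i j is Gamma^k_{ij} of the Levi-Civita connection *)
Definition christoffel k i j p : R :=
  2^-1 * \sum_l ginv p k l *
    (partial D i (fun q => g q j l) p + partial D j (fun q => g q i l) p
     - partial D l (fun q => g q i j) p).

Definition nabla X Y p : 'rV[R]_m :=
  \row_k (\sum_i X p 0 i * partial D i (fun q => Y q 0 k) p
          + \sum_i \sum_j christoffel k i j p * X p 0 i * Y p 0 j).

Definition lie_bracket X Y p : 'rV[R]_m :=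
  \row_k \sum_i (X p 0 i * partial D i (fun q => Y q 0 k) p
                 - Y p 0 i * partial D i (fun q => X q 0 k) p).

(* Sign convention: R_{ijij} > 0 on the round sphere. *)
Definition Rm X Y Z p : 'rV[R]_m :=
  nabla Y (nabla X Z) p - nabla X (nabla Y Z) p + nabla (lie_bracket X Y) Z p.

(* Rm(u,v,w,z) for tangent vectors at p, extended by constant coefficients
   in the coordinates; by tensoriality the extension is immaterial. *)
Definition Riem p u v w z : R :=
  (Rm (fun=> u) (fun=> v) (fun=> w) p *m g p *m z^T) 0 0.

Definition Riem_comp i j k l p : R :=
  Riem p (basis_vec i) (basis_vec j) (basis_vec k) (basis_vec l).

Definition Ric p u v : R :=
  \sum_k \sum_l ginv p k l * Riem p u (basis_vec k) v (basis_vec l).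

Definition Ric_comp i j p : R := Ric p (basis_vec i) (basis_vec j).

Definition scal p : R := \sum_i \sum_j ginv p i j * Ric_comp i j p.

Definition Rm_norm p : R :=
  Num.sqrt (\sum_i \sum_j \sum_k \sum_l \sum_a \sum_b \sum_c \sum_d
    ginv p i a * ginv p j b * ginv p k c * ginv p l d
    * Riem_comp i j k l p * Riem_comp a b c d p).

(* A covariant r-tensor is given by its components T s p, for multi-indices
   s of length r.  covD T (k :: s) is nabla_k T_s: the derivative index comes
   first, so that nabla_k nabla_l T_s is covD (covD T) [:: k, l & s]. *)
Definition covD (T : seq 'I_m -> 'rV[R]_m -> R) (s : seq 'I_m) p : R :=
  if s is k :: s' then
    partial D k (T s') p
    - \sum_(r < size s') \sum_l
        christoffel l k (nth k s' r) p * T (set_nth k s' r l) p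
  else 0.

Definition scal_tensor (s : seq 'I_m) p : R :=
  if s is [::] then scal p else 0.

Definition Ric_tensor (s : seq 'I_m) p : R :=
  if s is [:: i; j] then Ric_comp i j p else 0.

Definition harnackP i j k p : R :=
  covD Ric_tensor [:: i; j; k] p - covD Ric_tensor [:: j; i; k] p.

Definition lapRic i j p : R :=
  \sum_k \sum_l ginv p k l * covD (covD Ric_tensor) [:: k; l; i; j] p.

Definition Ric_up k l p : R :=
  \sum_a \sum_b ginv p k a * ginv p l b * Ric_comp a b p.

Definition harnackM (t : R) i j p : R :=
  lapRic i j p
  - 2^-1 * covD (covD scal_tensor) [:: i; j] p
  + 2 * (\sum_k \sum_l Riem_comp i k j l p * Ric_up k l p)
  - \sum_k \sum_l ginv p k l * Ric_comp i k p * Ric_comp j l p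
  + (2 * t)^-1 * Ric_comp i j p.

End LocalGeometry.

Section BilinearForms.
Context {R : realType} {m : nat}.
Implicit Types G : 'M[R]_m.

Definition pos_def G : Prop :=
  forall v : 'rV[R]_m, v != 0 -> 0 < (v *m G *m v^T) 0 0.

(* nondegenerate, symmetric, of index 1 *)
Definition lorentzian G : Prop :=
  [/\ G \in unitmx, G^T = G &
      exists v : 'rV[R]_m, (v *m G *m v^T) 0 0 < 0 /\
        forall w : 'rV[R]_m,
          w != 0 -> (v *m G *m w^T) 0 0 = 0 -> 0 < (w *m G *m w^T) 0 0].

End BilinearForms.

Record chart (R : realType) (n : nat) (M : topologicalType) := Chart {
  chart_dom : set M;
  chart_map : M -> 'rV[R]_n;
  chart_inv : 'rV[R]_n -> M   (* relevant only on the image of chart_dom *)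
}.

Section Manifold.
Context {R : realType} {n : nat} {M : topologicalType}.
Implicit Types (c : chart R n M) (A : set (chart R n M)).

Definition chart_img c : set 'rV[R]_n := chart_map c @` chart_dom c.

Definition is_chart c : Prop :=
  [/\ open (chart_dom c), open (chart_img c),
      (forall x, chart_dom c x -> chart_inv c (chart_map c x) = x),
      {within chart_dom c, continuous (chart_map c)} &
      {within chart_img c, continuous (chart_inv c)}].

Definition overlap c c' : set 'rV[R]_n :=
  chart_map c @` (chart_dom c `&` chart_dom c').

Definition transition c c' (q : 'rV[R]_n) : 'rV[R]_n :=
  chart_map c' (chart_inv c q).

Definition compatible c c' : Prop :=
  (forall k, smooth_on (overlap c c') (fun q => transition c c' q 0 k)) /\
  (forall k, smooth_on (overlap c' c) (fun q => transition c' c q 0 k)).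

(* A is a maximal smooth atlas *)
Definition smooth_manifold A : Prop :=
  [/\ hausdorff_space M /\ @second_countable M,
      (forall c, A c -> is_chart c),
      (forall x, exists c, A c /\ chart_dom c x),
      (forall c c', A c -> A c' -> compatible c c') &
      (forall c, is_chart c -> (forall c', A c' -> compatible c c') -> A c)].

Definition jacobian c c' (q : 'rV[R]_n) : 'M[R]_n :=
  \matrix_(i, k) partial (overlap c c') i (fun r => transition c c' r 0 k) q.

(* A metric depending on time is given by its components g c t in each chart
   c of the atlas; spacetime points of a chart are (x, t) in R^(n + 1). *)
Definition spacetime_dom (T : R) c : set 'rV[R]_(n + 1) :=
  [set p | chart_img c (lsubmx p) /\ 0 < rsubmx p 0 0 <= T].

Definition on_spacetime (F : R -> 'rV[R]_n -> R) (p : 'rV[R]_(n + 1)) : R :=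
  F (rsubmx p 0 0) (lsubmx p).

Definition smooth_metric_family A (T : R)
    (g : chart R n M -> R -> 'rV[R]_n -> 'M[R]_n) : Prop :=
  [/\ (forall c t q, A c -> 0 < t <= T -> chart_img c q ->
         (g c t q)^T = g c t q /\ pos_def (g c t q)),
      (forall c i j, A c ->
         smooth_on (spacetime_dom T c) (on_spacetime (fun t q => g c t q i j))) &
      (forall c c' t x, A c -> A c' -> 0 < t <= T ->
         chart_dom c x -> chart_dom c' x ->
         g c t (chart_map c x) =
           jacobian c c' (chart_map c x) *m g c' t (chart_map c' x)
           *m (jacobian c c' (chart_map c x))^T)].

Definition ricci_flow A (T : R)
    (g : chart R n M -> R -> 'rV[R]_n -> 'M[R]_n) : Prop :=
  forall c t q i j, A c -> 0 < t <= T -> chart_img c q ->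
    has_partial (spacetime_dom T c) (rshift n ord0)
      (on_spacetime (fun t q => g c t q i j)) (row_mx q (const_mx t)) /\
    partial (spacetime_dom T c) (rshift n ord0)
      (on_spacetime (fun t q => g c t q i j)) (row_mx q (const_mx t))
    = - 2 * Ric_comp (chart_img c) (g c t) i j q.

Definition chart_coord c (gamma : R -> M) (k : 'I_n) (s : R) : R :=
  chart_map c (gamma s) 0 k.

Definition geodesic A (h : chart R n M -> 'rV[R]_n -> 'M[R]_n)
    (gamma : R -> M) : Prop :=
  continuous gamma /\
  forall c s k, A c -> chart_dom c (gamma s) ->
    let u := chart_coord c gamma in
    [/\ derivable (u k) s 1, derivable (derive1 (u k)) s 1 &
        derive1 (derive1 (u k)) s
        + \sum_i \sum_j christoffel (chart_img c) (h c) k i j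
                          (chart_map c (gamma s))
                        * derive1 (u i) s * derive1 (u j) s = 0].

(* every geodesic is defined on the whole real line *)
Definition complete_metric A (h : chart R n M -> 'rV[R]_n -> 'M[R]_n) : Prop :=
  forall x c (v : 'rV[R]_n), A c -> chart_dom c x ->
    exists gamma : R -> M,
      [/\ geodesic A h gamma, gamma 0 = x &
          forall k, derive1 (chart_coord c gamma k) 0 = v 0 k].

Definition bounded_curvature A (T : R)
    (g : chart R n M -> R -> 'rV[R]_n -> 'M[R]_n) : Prop :=
  exists C : R, forall c t q, A c -> 0 < t <= T -> chart_img c q ->
    Rm_norm (chart_img c) (g c t) q <= C.

End Manifold.

(* Hyperbolic space of curvature -1/(2N) is the Poincare ball with 2N times
   the metric 4 |dy|^2 / (1 - |y|^2)^2 of curvature -1. *)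
Section Hyperbolic.
Context {R : realType}.

Definition sqnorm (N : nat) (y : 'rV[R]_N) : R := \sum_a y 0 a ^+ 2.

Definition hyp_ball (N : nat) : set 'rV[R]_N := [set y | sqnorm y < 1].

Definition hyp_metric (N : nat) (y : 'rV[R]_N) : 'M[R]_N :=
  ((2 * N%:R) * (4 / (1 - sqnorm y) ^+ 2))%:M.

(* the rows of e are an orthonormal basis of the tangent space at y *)
Definition hyp_orthonormal (N : nat) (y : 'rV[R]_N) (e : 'M[R]_N) : Prop :=
  e *m hyp_metric y *m e^T = 1%:M.

End Hyperbolic.

(* M x H^N x ]0, T] in the coordinates (x, y, t), with x from a chart c *)
Section Tilde.
Context {R : realType} {n : nat} {M : topologicalType}.
Variables (T : R) (g : chart R n M -> R -> 'rV[R]_n -> 'M[R]_n).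
Variables (c : chart R n M) (N : nat).

Definition tpoint (x : 'rV[R]_n) (y : 'rV[R]_N) (t : R) : 'rV[R]_(n + N + 1) :=
  row_mx (row_mx x y) (const_mx t).

Definition tspace (p : 'rV[R]_(n + N + 1)) : 'rV[R]_n := lsubmx (lsubmx p).
Definition thyp (p : 'rV[R]_(n + N + 1)) : 'rV[R]_N := rsubmx (lsubmx p).
Definition ttime (p : 'rV[R]_(n + N + 1)) : R := rsubmx p 0 0.

Definition tilde_dom : set 'rV[R]_(n + N + 1) :=
  [set p | [/\ chart_img c (tspace p), hyp_ball (thyp p) & 0 < ttime p <= T]].

Definition tilde_g (p : 'rV[R]_(n + N + 1)) : 'M[R]_(n + N + 1) :=
  block_mx
    (block_mx (g c (ttime p) (tspace p)) 0
              0                   (ttime p *: hyp_metric (thyp p))) 0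
    0 (scal (chart_img c) (g c (ttime p)) (tspace p) - N%:R / (2 * ttime p))%:M.

Definition idxM (i : 'I_n) : 'I_(n + N + 1) := lshift 1 (lshift N i).
Definition idxH (a : 'I_N) : 'I_(n + N + 1) := lshift 1 (rshift n a).
Definition idx0 : 'I_(n + N + 1) := rshift (n + N) ord0.

Definition isH (a : 'I_(n + N + 1)) : Prop := exists b : 'I_N, a = idxH b.

(* coordinate vectors of M, the rows of e in the H^N directions, and d/dt *)
Definition tilde_frame (e : 'M[R]_N) (a : 'I_(n + N + 1)) :
    'rV[R]_(n + N + 1) :=
  row a (block_mx (block_mx 1%:M 0 0 e) 0 0 1%:M).

Definition tilde_Riem (e : 'M[R]_N) (p : 'rV[R]_(n + N + 1))
    (a b d f : 'I_(n + N + 1)) : R :=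
  Riem tilde_dom tilde_g p (tilde_frame e a) (tilde_frame e b)
    (tilde_frame e d) (tilde_frame e f).

Definition tilde_Ric (e : 'M[R]_N) (p : 'rV[R]_(n + N + 1))
    (a b : 'I_(n + N + 1)) : R :=
  Ric tilde_dom tilde_g p (tilde_frame e a) (tilde_frame e b).

End Tilde.

Arguments idxM {n} N i.
Arguments idxH n {N} a.
Arguments idx0 n N : clear implicits.

(* Main.v *)
Require Import Defs.
From HB Require Import structures.
From mathcomp Require Import all_boot all_order all_algebra.
From mathcomp Require Import all_classical all_reals all_analysis.
From mathcomp Require Import ring lra.
Import Order.TTheory GRing.Theory Num.Theory.
Import numFieldNormedType.Exports.
Local Open Scope classical_set_scope.
Local Open Scope ring_scope.

Set Implicit Arguments.
Unset Strict Implicit.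
Unset Printing Implicit Defensive.

(** Put [phi = s - N / (2 t)], the component of the metric in the direction of
    time, where [s] is the scalar curvature of the flow. No limit in [N] has to be
    taken inside the geometry: the curvature of the product metric has a closed
    form, in which every component is its limiting value plus [1 / phi] times an
    expression in the flow at time [t] alone (or something divided by [N]
    besides), and [|1 / phi| <= 4 t / N] once [N >= 4 t] and [N >= 4 t |s|]
    ([inv_time_coef_bound]). One constant, [flow_bound_ex], bounds all these
    expressions.

    The closed form comes from the expression of the curvature by second
    derivatives of the metric and products of lowered Christoffel symbols
    ([L_entry]). With respect to the time coordinate, the slices of constant time
    have second fundamental form [- Ric], so the components with four indices on
    M, or with three and one time index, are the Gauss and Codazzi equations: the
    curvature of M corrected by [(1 / phi) (R_jk R_il - R_ik R_jl)], and the
    tensor P corrected by a term in [1 / phi] ([Lt_MMMM], [Lt_MM0M]). In the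
    components [i 0 j 0] the second derivative of the metric in time produces [dt
    R_ij] ([Lt_M0M0]); the evolution equation of the Ricci tensor ([dt_Ric]) turns
    it into the Laplacian and the quadratic terms of M, and the remaining term [-
    R_ij (dt phi) / (2 phi)] is [R_ij / (2 t)] up to a multiple of [1 / phi],
    because [dt phi = dt s + N / (2 t^2)]. The hyperbolic fibres are umbilic, so a
    component with a fibre index is built from the fibre metric [h] and a
    symmetric form on M and time that is a multiple of [1 / phi] ([Lt_fibre]); the
    curvature of the fibre and the square of its second fundamental form, both of
    order [1 / N], combine to a smaller order ([kappa_eq]).

    The Ricci tensor traces over [N] fibre directions, each of which contributes a
    term of size [1 / N], so this part does not vanish in the limit. It is
    cancelled by the trace over M of the Gauss, Codazzi and Harnack terms, where
    the contracted Bianchi identity ([contracted_bianchi]) and the evolution of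
    the scalar curvature ([traced_evolution]) enter; the numerical identity behind
    all these cancellations is [1 + N / (2 t phi) = s / phi] ([F_trace]).

    To separate this algebra from the analysis, the functions that are smooth on a
    domain form a commutative ring on which the partial derivatives act as
    commuting derivations; commutation is Schwarz's theorem, which holds up to the
    boundary [t = T] ([schwarz]). Riemannian geometry is then developed over an
    arbitrary commutative ring with commuting derivations, and used for M, where
    one more derivation plays the role of time, and for the product. The lemmas
    [rep_*] identify the resulting elements with the geometric quantities of a
    metric in coordinates. *)

(** * Partial derivatives relative to a domain *)

Section RelativeCalculus.
Context {R : realType} {m : nat}.
Implicit Types (D V : set 'rV[R]_m) (f g : 'rV[R]_m -> R) (a b : 'I_m).
Implicit Types (p q : 'rV[R]_m).

(** The domains in use have the form U x ]0, T]: around each of their points they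
    contain every nearby point that is not larger in any coordinate. This is what
    makes one-sided derivatives unique and leaves room for difference quotients of
    second order. *)
Definition lower_open D := forall p, D p ->
  \forall r \near p, (forall a, (r : 'rV[R]_m) 0 a <= p 0 a) -> D r.

Definition is_partial D a f p (l : R) := diff_quot a f p @ admissible D a p --> l.

Lemma translate_cvg a p : (fun h : R => h *: basis_vec a + p) @ (0 : R) --> p.
Proof.
have h : (fun h : R => h *: basis_vec a + p) @ (0 : R) --> (0 : R) *: basis_vec a + p.
  by apply: cvgD; [apply: cvgZr_tmp; exact: cvg_id | exact: cvg_cst].
by rewrite scale0r add0r in h.
Qed.

Lemma basis_vecE a b : (basis_vec a : 'rV[R]_m) 0 b = (a == b)%:R.
Proof. by rewrite mxE eqxx eq_sym. Qed.

Lemma sum_basis (a : 'I_m) (f : 'I_m -> R) :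
  \sum_b (basis_vec a : 'rV[R]_m) 0 b * f b = f a.
Proof.
rewrite (bigD1 a) //= basis_vecE eqxx mul1r big1 ?addr0 // => b /negPf ba.
by rewrite basis_vecE eq_sym ba mul0r.
Qed.

Lemma admissible_filter D a p : Filter (admissible D a p).
Proof. exact: within_filter. Qed.

(** Uniqueness of the limits that define partial derivatives: negative increments
    stay in the domain. *)
Lemma admissible_proper D a p : lower_open D -> D p -> ProperFilter (admissible D a p).
Proof.
move=> lD Dp; split; last exact: admissible_filter.
rewrite /admissible /within /=.
have H : \forall h \near (0 : R)^', h <= 0 -> D (h *: basis_vec a + p).
  apply: nbhs_dnbhs.
  have H : \forall h \near (0 : R), (forall b, (h *: basis_vec a + p : 'rV[R]_m) 0 b <= p 0 b) ->
      D (h *: basis_vec a + p) := @translate_cvg a p _ (lD _ Dp).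
  near=> h => h0; have Hh : forall b, (h *: basis_vec a + p : 'rV[R]_m) 0 b <= p 0 b.
    by move=> b; rewrite !mxE eqxx /= gerDr mulr_le0_ge0.
  by move: Hh; near: h.
move=> H0.
have : nbhs (0 : R) (fun h : R => h != 0 -> (h <= 0 -> D (h *: basis_vec a + p)) /\
    (D (h *: basis_vec a + p) -> False)) .
  by apply: filterI H H0.
move=> Hn; have [e /= e0 he] := iffLR (nbhs_ballP _ _) Hn.
(* the increment - e / 2 is small, nonzero and negative *)
have e2 : 0 < e / 2 by rewrite divr_gt0.
have be : ball (0 : R) e (- (e / 2)).
  rewrite /ball /= opprK add0r ger0_norm ?(ltW e2) //.
  by rewrite ltr_pdivrMr // ltr_pMr // ltr1n.
have ne : - (e / 2) != 0 by rewrite oppr_eq0 gt_eqF.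
have hle : - (e / 2) <= 0 by rewrite oppr_le0 ltW.
have [h1 h2] := he _ be ne.
exact: h2 (h1 hle).
Unshelve. all: by end_near.
Qed.

Lemma is_partialE D a f p l : lower_open D -> D p -> is_partial D a f p l ->
  has_partial D a f p /\ partial D a f p = l.
Proof.
move=> lD Dp fl; have P := admissible_proper a lD Dp.
split; first by apply/cvg_ex; exists l.
exact: cvg_lim.
Qed.

Lemma has_partialP D a f p : has_partial D a f p -> is_partial D a f p (partial D a f p).
Proof. by []. Qed.

Lemma near_admissible D a p : \forall h \near admissible D a p,
  h != 0 /\ D (h *: basis_vec a + p).
Proof.
rewrite /admissible near_withinE near_withinE.
by apply: filterE => h /= h0 Dh; split.
Qed.

Lemma is_partial_ext D a f g p l : D p -> (forall q, D q -> f q = g q) ->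
  is_partial D a f p l -> is_partial D a g p l.
Proof.
move=> Dp fg; apply: cvg_trans; apply: near_eq_cvg.
have F := admissible_filter D a p.
apply: filterS (near_admissible D a p) => h [_ Dh].
by rewrite ?fctE /diff_quot fg // fg.
Qed.

Lemma partial_ext D a f g p : D p -> (forall q, D q -> f q = g q) ->
  partial D a f p = partial D a g p.
Proof.
move=> Dp fg; rewrite /partial; congr (lim _).
have F := admissible_filter D a p.
by apply/seteqP; split; apply: near_eq_cvg;
  apply: filterS (near_admissible D a p) => h [_ Dh];
  rewrite ?fctE /diff_quot fg // fg.
Qed.

Lemma has_partial_ext D a f g p : D p -> (forall q, D q -> f q = g q) ->
  has_partial D a f p -> has_partial D a g p.
Proof.
by move=> Dp fg /has_partialP h; apply/cvg_ex; eexists; apply: is_partial_ext h.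
Qed.

Lemma is_partial_cst D a (k : R) p : is_partial D a (fun=> k) p 0.
Proof.
have F := admissible_filter D a p.
have C : (fun=> 0 : R) @ admissible D a p --> (0 : R) by exact: cvg_cst.
apply: cvg_trans C.
by apply: near_eq_cvg; apply: filterE => h; rewrite ?fctE /diff_quot subrr mulr0.
Qed.

Lemma is_partialD D a f g p k l : is_partial D a f p k -> is_partial D a g p l ->
  is_partial D a (fun q => f q + g q) p (k + l).
Proof.
have F := admissible_filter D a p.
move=> fk gl; rewrite /is_partial; apply: cvg_trans (cvgD fk gl).
by apply: near_eq_cvg; apply: filterE => h /=; rewrite ?fctE /diff_quot /=; ring.
Qed.

Lemma is_partial_cont D a f p k : is_partial D a f p k ->
  f (h *: basis_vec a + p) @[h --> admissible D a p] --> f p.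
Proof.
have F := admissible_filter D a p.
move=> fk; rewrite -[X in _ --> X]addr0 -[X in _ --> _ + X](mul0r k).
have h0 : h @[h --> admissible D a p] --> (0 : R).
  by apply: cvg_within_filter; apply: cvg_within.
apply: cvg_trans (cvgD (cvg_cst (f p)) (cvgM h0 fk)).
apply: near_eq_cvg; apply: filterS (near_admissible D a p) => h [hn _] /=.
by rewrite ?fctE /diff_quot /= mulrA divff // mul1r; ring.
Qed.

Lemma is_partialM D a f g p k l : is_partial D a f p k -> is_partial D a g p l ->
  is_partial D a (fun q => f q * g q) p (k * g p + f p * l).
Proof.
have F := admissible_filter D a p.
move=> fk gl; rewrite /is_partial.
have gc := is_partial_cont gl.
apply: cvg_trans (cvgD (cvgM fk gc) (cvgM (cvg_cst (f p)) gl)).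
by apply: near_eq_cvg; apply: filterE => h /=; rewrite ?fctE /diff_quot /=; ring.
Qed.

Lemma is_partialV D a f p k : lower_open D -> D p -> (forall q, D q -> f q != 0) ->
  is_partial D a f p k ->
  is_partial D a (fun q => (f q)^-1) p (- k * (f p)^-1 * (f p)^-1).
Proof.
have F := admissible_filter D a p.
move=> lD Dp fn0 fk; rewrite /is_partial.
have fc : (fun h => (f (h *: basis_vec a + p))^-1) @ admissible D a p --> (f p)^-1.
  by apply: cvgV; [exact: fn0|exact: is_partial_cont fk].
apply: cvg_trans (cvgM (cvgM (cvgN fk) fc) (cvg_cst (f p)^-1)).
apply: near_eq_cvg; apply: filterS (near_admissible D a p) => h [hn Dh] /=.
rewrite ?fctE /diff_quot /=; have := fn0 _ Dp; have := fn0 _ Dh.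
set x := f _; set y := f _ => x0 y0; field.
by rewrite x0 y0 hn.
Qed.

Lemma is_partial_coord D a b p : is_partial D a (fun q => q 0 b) p (a == b)%:R.
Proof.
have F := admissible_filter D a p.
have C : (fun=> (a == b)%:R : R) @ admissible D a p --> ((a == b)%:R : R) by exact: cvg_cst.
apply: cvg_trans C.
apply: near_eq_cvg; apply: filterS (near_admissible D a p) => h [hn _].
by rewrite /diff_quot !mxE eqxx /= [b == a]eq_sym; field.
Qed.

Lemma within_contP D f : {within D, continuous f} <->
  (forall p, D p -> f q @[q --> within D (nbhs p)] --> f p).
Proof. exact: subspace_continuousP. Qed.

Lemma within_cont_ext D f g : (forall q, D q -> f q = g q) ->
  {within D, continuous f} -> {within D, continuous g}.
Proof.
move=> fg /within_contP fc; apply/within_contP => p Dp.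
rewrite -fg //; apply: cvg_trans (fc p Dp); apply: near_eq_cvg.
by rewrite near_withinE; apply: filterE => q; exact: fg.
Qed.

(** Smoothness is defined by iterated partial derivatives taken from the outside;
    [Ck] peels them off from the inside, which is the form that suits the rules of
    differentiation. *)
Fixpoint Ck D (k : nat) f : Prop :=
  {within D, continuous f} /\
  if k is k'.+1 then forall a,
    (forall p, D p -> has_partial D a f p) /\ Ck D k' (partial D a f)
  else True.

Lemma iter_partial_rcons D s a f :
  iter_partial D (rcons s a) f = iter_partial D s (partial D a f).
Proof. by rewrite /iter_partial foldr_rcons. Qed.

Lemma smooth_partial D a f : smooth_on D f -> smooth_on D (partial D a f).
Proof. by move=> sf s; rewrite -iter_partial_rcons. Qed.

Lemma smooth_Ck D f : smooth_on D f <-> forall k, Ck D k f.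
Proof.
split.
  move=> sf k; elim: k f sf => [|k IH] f sf /=.
    by split=> //; have [] := sf [::].
  split; first by have [] := sf [::].
  move=> a; split; first by move=> p Dp; have [_ h] := sf [::]; exact: h.
  by apply: IH; exact: smooth_partial.
move=> cf s; elim/last_ind: s f cf => [|s a IH] f cf.
  split; first by have [] := cf 0%N.
  by move=> a p Dp; have [_ /(_ a)[h _]] := cf 1%N; exact: h.
rewrite iter_partial_rcons; apply: IH => k.
by have [_ /(_ a)[]] := cf k.+1.
Qed.

Lemma Ck_cont D k f : Ck D k f -> {within D, continuous f}.
Proof. by case: k => [|k] []. Qed.

Lemma CkS D k f : Ck D k.+1 f -> Ck D k f.
Proof.
elim: k f => [|k IH] f [cf df]; first by split.
by split=> // a; have [h1 h2] := df a; split=> //; exact: IH.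
Qed.

Lemma Ck_ext D k f g : (forall q, D q -> f q = g q) -> Ck D k f -> Ck D k g.
Proof.
elim: k f g => [|k IH] f g fg [cf df]; split;
  [exact: within_cont_ext cf| by []|exact: within_cont_ext cf|].
move=> a; have [h1 h2] := df a; split.
  by move=> p Dp; apply: has_partial_ext (h1 p Dp).
by apply: IH h2 => q Dq; apply: partial_ext.
Qed.

(** A candidate [df] for the derivatives suffices; it only has to agree with
    [partial] on [D]. *)
Lemma Ck_step D k f (df : 'I_m -> 'rV[R]_m -> R) : lower_open D ->
  {within D, continuous f} ->
  (forall a p, D p -> is_partial D a f p (df a p)) ->
  (forall a, Ck D k (df a)) -> Ck D k.+1 f.
Proof.
move=> lD cf dfP dfk; split=> // a; split.
  by move=> p Dp; have [] := is_partialE lD Dp (dfP a p Dp).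
apply: Ck_ext (dfk a) => q Dq.
by have [_ ->] := is_partialE lD Dq (dfP a q Dq).
Qed.

Lemma Ck_is_partial D k f a p : Ck D k.+1 f -> D p -> is_partial D a f p (partial D a f p).
Proof. by move=> [_ /(_ a)[h _]] Dp; apply/has_partialP/h. Qed.

Lemma Ck_partial D k f a : Ck D k.+1 f -> Ck D k (partial D a f).
Proof. by move=> [_ /(_ a)[_ h]]. Qed.

Section Closure.
Variables (D : set 'rV[R]_m) (lD : lower_open D).

Lemma cont_cst (k : R) : {within D, continuous (fun=> k : R)}.
Proof. by apply/within_contP => p Dp; exact: cvg_cst. Qed.

Lemma Ck_cst k (x : R) : Ck D k (fun=> x).
Proof.
elim: k x => [|k IH] x; first by split=> //; exact: cont_cst.
by apply: (@Ck_step _ _ _ (fun _ _ => 0)) => // [|a p Dp]; [exact: cont_cst|exact: is_partial_cst].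
Qed.

Lemma CkD k f g : Ck D k f -> Ck D k g -> Ck D k (fun q => f q + g q).
Proof.
elim: k f g => [|k IH] f g cf cg.
all: have Hc : {within D, continuous (fun q => f q + g q)} by
  apply/within_contP => p Dp; apply: cvgD;
   [move/Ck_cont/within_contP: cf; exact|move/Ck_cont/within_contP: cg; exact].
  by split.
apply: (@Ck_step _ _ _ (fun a q => partial D a f q + partial D a g q)) => //.
  by move=> a p Dp; apply: is_partialD; [exact: Ck_is_partial cf Dp | exact: Ck_is_partial cg Dp].
by move=> a; apply: IH; exact: Ck_partial.
Qed.

Lemma CkM k f g : Ck D k f -> Ck D k g -> Ck D k (fun q => f q * g q).
Proof.
elim: k f g => [|k IH] f g cf cg.
all: have Hc : {within D, continuous (fun q => f q * g q)} by
  apply/within_contP => p Dp; apply: cvgM;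
   [move/Ck_cont/within_contP: cf; exact|move/Ck_cont/within_contP: cg; exact].
  by split.
apply: (@Ck_step _ _ _ (fun a q => partial D a f q * g q + f q * partial D a g q)) => //.
  by move=> a p Dp; apply: is_partialM; [exact: Ck_is_partial cf Dp | exact: Ck_is_partial cg Dp].
move=> a; have Sf := CkS cf; have Sg := CkS cg.
by apply: CkD; apply: IH => //; exact: Ck_partial.
Qed.

Lemma CkV k f : (forall q, D q -> f q != 0) -> Ck D k f -> Ck D k (fun q => (f q)^-1).
Proof.
move=> fn0; elim: k => [|k IH] cf.
all: have Hc : {within D, continuous (fun q => (f q)^-1)} by
  apply/within_contP => p Dp; apply: cvgV; [exact: fn0|
   move/Ck_cont/within_contP: cf; exact].
  by split.
apply: (@Ck_step _ _ _ (fun a q => -1 * partial D a f q * (f q)^-1 * (f q)^-1)) => //.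
  by move=> a p Dp; rewrite mulN1r; apply: is_partialV => //; exact: Ck_is_partial cf Dp.
have Vk := IH (CkS cf).
move=> a; do ![apply: CkM => //]; [exact: Ck_cst | exact: Ck_partial].
Qed.

Lemma Ck_coord k a : Ck D k (fun q => q 0 a).
Proof.
have Hc : {within D, continuous (fun q : 'rV[R]_m => q 0 a)}.
  apply/within_contP => p Dp; apply: cvg_within_filter.
  exact: coord_continuous.
case: k => [|k]; first by split.
apply: (@Ck_step _ _ _ (fun b q => (b == a)%:R)) => //.
  by move=> b p Dp; exact: is_partial_coord.
by move=> b; exact: Ck_cst.
Qed.

Lemma smooth_cst (x : R) : smooth_on D (fun=> x).
Proof. by apply/smooth_Ck => k; exact: Ck_cst. Qed.

Lemma smoothD f g : smooth_on D f -> smooth_on D g -> smooth_on D (fun q => f q + g q).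
Proof. by move=> /smooth_Ck cf /smooth_Ck cg; apply/smooth_Ck => k; exact: CkD. Qed.

Lemma smoothM f g : smooth_on D f -> smooth_on D g -> smooth_on D (fun q => f q * g q).
Proof. by move=> /smooth_Ck cf /smooth_Ck cg; apply/smooth_Ck => k; exact: CkM. Qed.

Lemma smoothV f : (forall q, D q -> f q != 0) -> smooth_on D f -> smooth_on D (fun q => (f q)^-1).
Proof. by move=> fn /smooth_Ck cf; apply/smooth_Ck => k; exact: CkV. Qed.

Lemma smooth_coord a : smooth_on D (fun q => q 0 a).
Proof. by apply/smooth_Ck => k; exact: Ck_coord. Qed.

Lemma smooth_ext f g : (forall q, D q -> f q = g q) -> smooth_on D f -> smooth_on D g.
Proof. by move=> fg /smooth_Ck cf; apply/smooth_Ck => k; exact: Ck_ext (cf k). Qed.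

Lemma smooth_has_partial f a p : smooth_on D f -> D p -> has_partial D a f p.
Proof. by move=> /(_ [::])[_]; apply. Qed.

Lemma smooth_continuous f : smooth_on D f -> {within D, continuous f}.
Proof. by move=> /(_ [::])[]. Qed.

End Closure.
End RelativeCalculus.

(** * Symmetry of second derivatives *)

Section Schwarz.
Context {R : realType} {m : nat}.
Implicit Types (D V : set 'rV[R]_m) (f g : 'rV[R]_m -> R) (a b : 'I_m).
Implicit Types (p q : 'rV[R]_m).

Lemma line_derive D f a p r :
  (\forall h \near (0 : R), D (h *: basis_vec a + (r *: basis_vec a + p))) ->
  has_partial D a f (r *: basis_vec a + p) ->
  is_derive r 1 (fun s => f (s *: basis_vec a + p)) (partial D a f (r *: basis_vec a + p)).
Proof.
move=> nD /has_partialP fl.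
have H : (fun h : R => h^-1 *: (f ((h *: (1 : R) + r) *: basis_vec a + p)
     - f (r *: basis_vec a + p))) @ (0 : R)^' --> partial D a f (r *: basis_vec a + p).
  have nD' : \forall h \near (0 : R)^', D (h *: basis_vec a + (r *: basis_vec a + p)).
    exact: nbhs_dnbhs nD.
  have C : diff_quot a f (r *: basis_vec a + p) @ (0 : R)^' -->
      partial D a f (r *: basis_vec a + p).
    move=> S HS.
    have HS' : \forall h \near (0 : R)^', D (h *: basis_vec a + (r *: basis_vec a + p)) ->
       S (diff_quot a f (r *: basis_vec a + p) h) := fl _ HS.
    by apply: filterS2 HS' nD' => h; apply.
  apply: cvg_trans C; apply: near_eq_cvg; apply: filterE => h.
  by rewrite /diff_quot scalerDl addrA -[h *: 1]/(h * 1) mulr1.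
apply: DeriveDef.
  by apply/cvg_ex; eexists; exact: H.
by rewrite /derive; apply: cvg_lim.
Qed.

Lemma line_cont D f a p (x y : R) : {within D, continuous f} ->
  (forall r, r \in `[x, y] -> D (r *: basis_vec a + p)) ->
  {within `[x, y], continuous (fun s => f (s *: basis_vec a + p))}.
Proof.
move=> /within_contP fc HD; apply/subspace_continuousP => r /= rI.
have Dr := HD _ rI.
apply: cvg_trans (fc _ Dr).
move=> S; rewrite /within /= => HS.
have tr : (fun s : R => s *: basis_vec a + p) @ r --> r *: basis_vec a + p.
  by apply: cvgD; [apply: cvgZr_tmp; exact: cvg_id | exact: cvg_cst].
have : \forall s \near r, D (s *: basis_vec a + p) -> S (f (s *: basis_vec a + p)).
  exact: tr _ HS.
by apply: filterS => s /= H sI; apply: H; exact: HD.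
Qed.

Lemma near_translate (l x u : R) : l < x -> x < u -> \forall h \near (0 : R), l < h + x < u.
Proof.
move=> lx xu; have tr : (fun h : R => h + x) @ (0 : R) --> x.
  by rewrite -[X in _ --> X]add0r; apply: cvgD; [exact: cvg_id|exact: cvg_cst].
have h1 : \forall h \near (0 : R), l < h + x := tr _ (lt_nbhsr lx).
have h2 : \forall h \near (0 : R), h + x < u := tr _ (lt_nbhsl xu).
by apply: filterS2 h1 h2 => h -> ->.
Qed.

(** The second difference of [f] over a rectangle with upper corner [p] is a mixed
    derivative at some point of the rectangle: the mean value theorem is applied
    in direction [a] to the difference of [f] along [b], then in direction [b]. *)
Lemma rect_mvt D f a b p (s u : R) : 0 < s -> 0 < u -> Ck D 2 f ->
  (forall x y : R, - s <= x <= 0 -> - u <= y <= 0 -> D (x *: basis_vec a + (y *: basis_vec b +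
    p))) ->
  exists x y : R, [/\ - s <= x <= 0, - u <= y <= 0 &
    f p - f (- s *: basis_vec a + p) - f (- u *: basis_vec b + p)
      + f (- s *: basis_vec a + (- u *: basis_vec b + p))
    = s * u * partial D b (partial D a f) (x *: basis_vec a + (y *: basis_vec b + p))].
Proof.
move=> s0 u0 cf HD.
have swap x y : x *: basis_vec a + (y *: basis_vec b + p)
    = y *: basis_vec b + (x *: basis_vec a + p) by rewrite addrCA.
have u00 : - u <= (0 : R) <= 0 by rewrite lexx oppr_le0 ltW.
have uu0 : - u <= - u <= (0 : R) by rewrite lexx oppr_le0 ltW.
have E0 x : x *: basis_vec a + p = x *: basis_vec a + (0 *: basis_vec b + p).
  by rewrite scale0r add0r.
have nearD x y : x \in `]- s, 0[ -> - u <= y <= 0 ->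
    \forall h \near (0 : R), D (h *: basis_vec a + (x *: basis_vec a + (y *: basis_vec b + p))).
  rewrite in_itv /= => /andP[x1 x2] yI.
  apply: filterS (near_translate x1 x2) => h /andP[h1 h2].
  by rewrite addrA -scalerDl; apply: HD => //; rewrite !ltW.
have nearD' x y : - s <= x <= 0 -> y \in `]- u, 0[ ->
    \forall h \near (0 : R), D (h *: basis_vec b + (y *: basis_vec b + (x *: basis_vec a + p))).
  rewrite in_itv /= => xI /andP[x1 x2].
  apply: filterS (near_translate x1 x2) => h /andP[h1 h2].
  by rewrite addrA -scalerDl -swap; apply: HD => //; rewrite !ltW.
have cf0 := Ck_cont cf.
have cf1 := Ck_partial a cf.
pose F x := f (x *: basis_vec a + p) - f (x *: basis_vec a + (- u *: basis_vec b + p)).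
pose dF x := partial D a f (x *: basis_vec a + p)
   - partial D a f (x *: basis_vec a + (- u *: basis_vec b + p)).
(* F is the difference of f along b, as a function of the position along a *)
have [|||x xI Fx] := @MVT R F dF (- s) 0.
- by rewrite oppr_lt0.
- move=> x xI; have xI' : - s <= x <= 0.
    by move: xI; rewrite in_itv /= => /andP[/ltW -> /ltW ->].
  apply: is_deriveB.
    apply: line_derive; first by have := nearD x 0 xI u00; rewrite scale0r add0r.
    by case: cf => _ /(_ a)[h _]; apply: h; rewrite E0; exact: HD.
  apply: line_derive; first exact: nearD.
  by case: cf => _ /(_ a)[h _]; apply: h; exact: HD.
- apply/subspace_continuousP => x xI; apply: cvgB.
    have L : {within `[- s, 0], continuous (fun x => f (x *: basis_vec a + p))}.
      by apply: line_cont cf0 _ => r; rewrite in_itv /= E0 => rI; exact: HD.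
    by move/subspace_continuousP: L; exact.
  have L : {within `[- s, 0], continuous (fun x => f (x *: basis_vec a + (- u *: basis_vec b +
    p)))}.
    by apply: line_cont cf0 _ => r; rewrite in_itv /= => rI; exact: HD.
  by move/subspace_continuousP: L; exact.
have xI' : - s <= x <= 0.
  by move: xI; rewrite in_itv /= => /andP[/ltW -> /ltW ->].
have [|||y yI Gy] := @MVT R (fun y => partial D a f (y *: basis_vec b + (x *: basis_vec a + p)))
   (fun y => partial D b (partial D a f) (y *: basis_vec b + (x *: basis_vec a + p))) (- u) 0.
- by rewrite oppr_lt0.
- move=> y yI; have yI' : - u <= y <= 0.
    by move: yI; rewrite in_itv /= => /andP[/ltW -> /ltW ->].
  apply: line_derive; first exact: nearD'.
  by case: cf1 => _ /(_ b)[h _]; apply: h; rewrite -swap; exact: HD.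
- apply: line_cont; first exact: Ck_cont cf1.
  by move=> y; rewrite in_itv /= => yI; rewrite -swap; exact: HD.
have yI' : - u <= y <= 0.
  by move: yI; rewrite in_itv /= => /andP[/ltW -> /ltW ->].
exists x, y; split=> //.
move: Fx Gy; rewrite /F /dF !scale0r !add0r !opprK -!swap => Fx Gy.
have -> : f p - f (- s *: basis_vec a + p) - f (- u *: basis_vec b + p) +
  f (- s *: basis_vec a + (- u *: basis_vec b + p))
  = f p - f (- u *: basis_vec b + p) - (f (- s *: basis_vec a + p) -
      f (- s *: basis_vec a + (- u *: basis_vec b + p))) by ring.
by rewrite Fx Gy; ring.
Qed.

(** Both mixed derivatives are values of the same second difference over small
    squares below [p], so they agree at [p] by continuity; no point above [p] is
    used, hence the identity also holds on the final time slice. *)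
Lemma schwarz D f a b p : lower_open D -> D p -> Ck D 2 f ->
  partial D a (partial D b f) p = partial D b (partial D a f) p.
Proof.
move=> lD Dp cf.
have ca := Ck_cont (Ck_partial b (Ck_partial a cf)).
have cb := Ck_cont (Ck_partial a (Ck_partial b cf)).
set F := partial D b _ in ca *; set G := partial D a _ in cb *.
apply/eqP; rewrite -subr_eq0 -normr_le0; apply/ler_addgt0Pl => e e0.
rewrite addr0.
have e2 : 0 < e / 2 by rewrite divr_gt0.
move/within_contP: ca => /(_ p Dp) /cvgrPdist_lt/(_ _ e2); rewrite near_withinE => nF.
move/within_contP: cb => /(_ p Dp) /cvgrPdist_lt/(_ _ e2); rewrite near_withinE => nG.
have nn := filterI (lD p Dp) (filterI nF nG).
have /nbhs_ballP[d /= d0 hd] : nbhs p (fun r : 'rV[R]_m =>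
    ((forall a0, r 0 a0 <= p 0 a0) -> D r) /\
    ((D r -> `|F p - F r| < e / 2) /\ (D r -> `|G p - G r| < e / 2))) by exact: nn.
(* with side s = d / (2 K), the square below p lies in the ball of radius d *)
pose K : R := `|basis_vec a : 'rV[R]_m| + `|basis_vec b : 'rV[R]_m| + 1.
have K0 : 0 < K by rewrite ltr_wpDl // addr_ge0.
pose s := d / (2 * K).
have s0 : 0 < s by rewrite divr_gt0 // mulr_gt0.
have inball x y : - s <= x <= 0 -> - s <= y <= 0 ->
    ball p d (x *: basis_vec a + (y *: basis_vec b + p)).
  move=> xI yI; rewrite -ball_normE /= addrA opprD addrCA subrr addr0 normrN.
  have nx : `|x| <= s by rewrite ler_norml; case/andP: xI => -> /= h; rewrite (le_trans h) // ltW.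
  have ny : `|y| <= s by rewrite ler_norml; case/andP: yI => -> /= h; rewrite (le_trans h) // ltW.
  apply: le_lt_trans (ler_normD _ _) _; rewrite !normrZ.
  have H1 : `|x| * `|basis_vec a : 'rV[R]_m| <= s * `|basis_vec a : 'rV[R]_m|.
    by apply: ler_wpM2r.
  have H2 : `|y| * `|basis_vec b : 'rV[R]_m| <= s * `|basis_vec b : 'rV[R]_m|.
    by apply: ler_wpM2r.
  apply: le_lt_trans (lerD H1 H2) _; rewrite -mulrDr.
  have H3 : s * K = d / 2 by rewrite /s; field; rewrite gt_eqF.
  have H4 : s * (`|basis_vec a : 'rV[R]_m| + `|basis_vec b : 'rV[R]_m|) < s * K.
    by rewrite ltr_pM2l // ltrDl.
  by apply: (lt_trans H4); rewrite H3 ltr_pdivrMr // ltr_pMr // ltr1n.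
have rectD x y : - s <= x <= 0 -> - s <= y <= 0 -> D (x *: basis_vec a + (y *: basis_vec b + p)).
  move=> xI yI; have [h _] := hd _ (inball x y xI yI); apply: h => i.
  have /andP[_ x0] := xI; have /andP[_ y0] := yI.
  rewrite !mxE eqxx /= addrA gerDr.
  by rewrite -[leRHS]addr0 lerD // mulr_le0_ge0.
have rectD' y x : - s <= y <= 0 -> - s <= x <= 0 -> D (y *: basis_vec b + (x *: basis_vec a + p)).
  by move=> yI xI; rewrite addrCA; exact: rectD.
have [x [y [xI yI E1]]] := rect_mvt s0 s0 cf rectD.
have [y' [x' [yI' xI' E2]]] := rect_mvt s0 s0 cf rectD'.
have EQ : F (x *: basis_vec a + (y *: basis_vec b + p)) =
    G (y' *: basis_vec b + (x' *: basis_vec a + p)).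
  have ss : s * s != 0 by rewrite mulf_neq0 // gt_eqF.
  have E3 : - s *: basis_vec b + (- s *: basis_vec a + p) =
    - s *: basis_vec a + (- s *: basis_vec b + p) by exact: addrCA.
  rewrite E3 in E2.
  have cancel (k u A B C v w : R) : u - A - B + C = k * v -> u - B - A + C = k * w ->
      k != 0 -> v = w.
    by move=> h1 h2 k0; apply: (mulfI k0); rewrite -h1 -h2 [X in X + _ = _]addrAC.
  exact: (cancel _ _ _ _ _ _ _ E1 E2 ss).
have [_ [HF _]] := hd _ (inball x y xI yI).
have [_ [_ HG]] := hd _ (inball x' y' xI' yI').
have {}HF := HF (rectD _ _ xI yI).
have {}HG := HG (rectD _ _ xI' yI').
rewrite EQ in HF; rewrite addrCA in HG.
rewrite (_ : G p - F p = (G p - G (y' *: basis_vec b + (x' *: basis_vec a + p)))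
   - (F p - G (y' *: basis_vec b + (x' *: basis_vec a + p)))); last by ring.
apply: le_trans (ler_normB _ _) _.
have ee : e / 2 + e / 2 = e by rewrite -splitr.
by rewrite -[X in _ <= X]ee; exact: lerD (ltW HG) (ltW HF).
Qed.

End Schwarz.

(** * The ring of smooth functions on a domain *)

(** Nonemptiness makes the ring of smooth functions nontrivial. *)
Record domain (R : realType) (m : nat) := Domain {
  dset : set 'rV[R]_m;
  domain_lower_open : lower_open dset;
  domain_nonempty : exists p, dset p
}.

Section SmoothRing.
Context {R : realType} {m : nat}.
Variable D0 : domain R m.
Local Notation D := (dset D0).
Implicit Types (f : 'rV[R]_m -> R) (a b : 'I_m) (p : 'rV[R]_m).

(** Vanishing off the domain makes equality of smooth functions the same as
    equality on the domain, so the ring operations can be read off pointwise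
    there. *)
Definition smooth_pred f : bool := `[< smooth_on D f /\ forall p, ~ D p -> f p = 0 >].

Record smooth_fun := SmoothFun { sval_of :> 'rV[R]_m -> R; _ : smooth_pred sval_of }.

HB.instance Definition _ := [isSub for sval_of].
HB.instance Definition _ := [Choice of smooth_fun by <:].

Implicit Types (u v w : smooth_fun).

Definition cut f p : R := if `[< D p >] then f p else 0.

Lemma cut_in f p : D p -> cut f p = f p.
Proof. by move=> Dp; rewrite /cut asboolT. Qed.

Lemma cut_out f p : ~ D p -> cut f p = 0.
Proof. by move=> Dp; rewrite /cut asboolF. Qed.

Lemma cut_pred f : smooth_on D f -> smooth_pred (cut f).
Proof.
move=> sf; apply/asboolP; split; last by move=> p; exact: cut_out.
by apply: smooth_ext sf => // q Dq; rewrite cut_in.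
Qed.

Definition mkS f (sf : smooth_on D f) : smooth_fun := SmoothFun (cut_pred sf).

Lemma mkSE f (sf : smooth_on D f) p : D p -> mkS sf p = f p.
Proof. exact: cut_in. Qed.

Lemma S_smooth u : smooth_on D u.
Proof. by case: u => f /= /asboolP[]. Qed.

Lemma S_out u p : ~ D p -> u p = 0.
Proof. by case: u => f /= /asboolP[_]; apply. Qed.

Lemma S_eq u v : (forall p, D p -> u p = v p) -> u = v.
Proof.
move=> uv; apply: val_inj; apply/funext => p /=.
by have [Dp|nDp] := pselect (D p); [exact: uv | rewrite !S_out].
Qed.

Let lD := @domain_lower_open _ _ D0.

Definition Szero := mkS (@smooth_cst _ _ D lD 0).
Definition Sone := mkS (@smooth_cst _ _ D lD 1).
Definition Sadd u v := mkS (smoothD lD (S_smooth u) (S_smooth v)).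
Definition Smul u v := mkS (smoothM lD (S_smooth u) (S_smooth v)).
Definition Sopp u := mkS (smoothM lD (smooth_cst lD (-1)) (S_smooth u)).

Lemma SaddE u v p : Sadd u v p = u p + v p.
Proof.
by have [Dp|nDp] := pselect (D p); [exact: mkSE | rewrite !S_out // addr0].
Qed.

Lemma SmulE u v p : Smul u v p = u p * v p.
Proof.
by have [Dp|nDp] := pselect (D p); [exact: mkSE | rewrite !S_out // mulr0].
Qed.

Fact SaddA : associative Sadd.
Proof. by move=> u v w; apply: S_eq => p Dp; rewrite !SaddE addrA. Qed.
Fact SaddC : commutative Sadd.
Proof. by move=> u v; apply: S_eq => p Dp; rewrite !SaddE addrC. Qed.
Fact Sadd0 : left_id Szero Sadd.
Proof. by move=> u; apply: S_eq => p Dp; rewrite SaddE mkSE // add0r. Qed.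
Fact SaddN : left_inverse Szero Sopp Sadd.
Proof. by move=> u; apply: S_eq => p Dp; rewrite SaddE !mkSE // mulN1r addNr. Qed.

HB.instance Definition _ := GRing.isZmodule.Build smooth_fun SaddA SaddC Sadd0 SaddN.

Fact SmulA : associative Smul.
Proof. by move=> u v w; apply: S_eq => p Dp; rewrite !SmulE mulrA. Qed.
Fact SmulC : commutative Smul.
Proof. by move=> u v; apply: S_eq => p Dp; rewrite !SmulE mulrC. Qed.
Fact Smul1 : left_id Sone Smul.
Proof. by move=> u; apply: S_eq => p Dp; rewrite SmulE mkSE // mul1r. Qed.
Fact SmulD : left_distributive Smul (+%R : smooth_fun -> _).
Proof. by move=> u v w; apply: S_eq => p Dp; rewrite SmulE !SaddE !SmulE mulrDl. Qed.
Fact Sone_neq0 : Sone != 0 :> smooth_fun.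
Proof.
have [p Dp] := domain_nonempty D0.
apply/eqP => /(congr1 (fun u : smooth_fun => u p)).
by rewrite !mkSE // => /eqP; rewrite oner_eq0.
Qed.

HB.instance Definition _ :=
  GRing.Zmodule_isComNzRing.Build smooth_fun SmulA SmulC Smul1 SmulD Sone_neq0.

Lemma SD u v p : (u + v) p = u p + v p. Proof. exact: SaddE. Qed.
Lemma SM u v p : (u * v) p = u p * v p. Proof. exact: SmulE. Qed.
Lemma S0 p : (0 : smooth_fun) p = 0.
Proof. by have [Dp|nDp] := pselect (D p); [exact: mkSE | rewrite S_out]. Qed.
Lemma SN u p : (- u) p = - u p.
Proof. by apply/eqP; rewrite -addr_eq0 -SD addNr S0. Qed.
Lemma S1 p : D p -> (1 : smooth_fun) p = 1.
Proof. exact: mkSE. Qed.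
Lemma S_sum (I : Type) (r : seq I) (P : pred I) (F : I -> smooth_fun) p :
  (\sum_(i <- r | P i) F i) p = \sum_(i <- r | P i) F i p.
Proof.
elim: r => [|i r IH]; first by rewrite !big_nil S0.
by rewrite !big_cons; case: (P i) => //; rewrite SD IH.
Qed.

Definition Scst (x : R) : smooth_fun := mkS (@smooth_cst _ _ D lD x).
Lemma ScstE x p : D p -> Scst x p = x. Proof. exact: mkSE. Qed.

Definition Spart a u : smooth_fun := mkS (smooth_partial a (S_smooth u)).

Lemma SpartE a u p : D p -> Spart a u p = partial D a u p.
Proof. exact: mkSE. Qed.

Lemma S_is_partial a u p : D p -> is_partial D a u p (Spart a u p).
Proof.
move=> Dp; rewrite SpartE //; apply/has_partialP.
exact: smooth_has_partial (S_smooth u) Dp.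
Qed.

Lemma Spart_unique a u p l : D p -> is_partial D a u p l -> Spart a u p = l.
Proof. by move=> Dp ul; rewrite SpartE //; have [] := is_partialE lD Dp ul. Qed.

Lemma SpartD a u v : Spart a (u + v) = Spart a u + Spart a v.
Proof.
apply: S_eq => p Dp; apply: Spart_unique => //; rewrite SD.
apply: is_partial_ext; [exact: Dp| |exact: (is_partialD (@S_is_partial a u p Dp) (@S_is_partial a
  v p Dp))].
by move=> q Dq;rewrite SD.
Qed.

Lemma SpartM a u v : Spart a (u * v) = Spart a u * v + u * Spart a v.
Proof.
apply: S_eq => p Dp; apply: Spart_unique => //; rewrite SD !SM.
apply: is_partial_ext; [exact: Dp| |exact: (is_partialM (@S_is_partial a u p Dp) (@S_is_partial a
  v p Dp))].
by move=> q Dq;rewrite SM.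
Qed.

Lemma Spart_cst a x : Spart a (Scst x) = 0.
Proof.
apply: S_eq => p Dp; apply: Spart_unique => //; rewrite S0.
apply: is_partial_ext; [exact: Dp| |exact: (is_partial_cst D a x p)].
by move=> q Dq;  rewrite ScstE.
Qed.

Lemma Spart_comm a b u : Spart a (Spart b u) = Spart b (Spart a u).
Proof.
apply: S_eq => p Dp; rewrite (SpartE a _ Dp) (SpartE b _ Dp).
rewrite (partial_ext a Dp (g := partial D b u)); last by move=> q; exact: SpartE.
rewrite (partial_ext b Dp (g := partial D a u)); last by move=> q; exact: SpartE.
by apply: schwarz => //; move: (S_smooth u) => /smooth_Ck; apply.
Qed.

Definition Scoord b : smooth_fun := mkS (smooth_coord lD b).
Lemma ScoordE b p : D p -> Scoord b p = p 0 b. Proof. exact: mkSE. Qed.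
Lemma Spart_coord a b : Spart a (Scoord b) = Scst (a == b)%:R.
Proof.
apply: S_eq => p Dp; apply: Spart_unique => //; rewrite ScstE //.
have H : is_partial D a (fun q => q 0 b) p (a == b)%:R by exact: is_partial_coord.
apply: is_partial_ext; [exact: Dp| |exact: H].
by move=> q Dq; rewrite ScoordE.
Qed.

Lemma S_inv u : (forall p, D p -> u p != 0) -> {v : smooth_fun | u * v = 1}.
Proof.
move=> un; exists (mkS (smoothV lD un (S_smooth u))).
by apply: S_eq => p Dp; rewrite SM mkSE // S1 // divff // un.
Qed.

End SmoothRing.

(** * Derivations of a commutative ring *)

Section Derivation.
Variable F : comNzRingType.
Implicit Types (D : F -> F) (x y : F).

Definition derivation D :=
  {morph D : x y / x + y} /\ forall x y, D (x * y) = D x * y + x * D y.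

Section Laws.
Variables (D : F -> F) (hD : derivation D).
Lemma derD x y : D (x + y) = D x + D y. Proof. exact: hD.1. Qed.
Lemma derM x y : D (x * y) = D x * y + x * D y. Proof. exact: hD.2. Qed.
Lemma der0 : D 0 = 0.
Proof. by apply: (addrI (D 0)); rewrite -derD !addr0. Qed.
Lemma derN x : D (- x) = - D x.
Proof. by apply/eqP; rewrite -addr_eq0 -derD addNr der0. Qed.
Lemma derB x y : D (x - y) = D x - D y. Proof. by rewrite derD derN. Qed.
Lemma der1 : D 1 = 0.
Proof. by apply: (addrI (D 1)); rewrite addr0 -{3}[1]mul1r derM mulr1 mul1r. Qed.
Lemma der_sum (I : Type) (r : seq I) (P : pred I) (G : I -> F) :
  D (\sum_(i <- r | P i) G i) = \sum_(i <- r | P i) D (G i).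
Proof. exact: (big_morph D derD der0). Qed.
Lemma der_half h : h + h = 1 -> D h = 0.
Proof.
move=> hh; have e : D h + D h = 0 by rewrite -derD hh der1.
by rewrite -[D h]mul1r -hh mulrDl -mulrDr e mulr0.
Qed.
Lemma der_half_mul h x : h + h = 1 -> D (h * x) = h * D x.
Proof. by move=> hh; rewrite derM (der_half hh) mul0r add0r. Qed.

Lemma dermxD m n (A B : 'M[F]_(m, n)) : map_mx D (A + B) = map_mx D A + map_mx D B.
Proof. by apply/matrixP => i j; rewrite !mxE derD. Qed.
Lemma dermxN m n (A : 'M[F]_(m, n)) : map_mx D (- A) = - map_mx D A.
Proof. by apply/matrixP => i j; rewrite !mxE derN. Qed.
Lemma dermxM m n p (A : 'M[F]_(m, n)) (B : 'M[F]_(n, p)) :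
  map_mx D (A *m B) = map_mx D A *m B + A *m map_mx D B.
Proof.
apply/matrixP => i j; rewrite !mxE der_sum -big_split; apply: eq_bigr => k _ /=.
by rewrite derM !mxE.
Qed.
Lemma dermx_tr m n (A : 'M[F]_(m, n)) : map_mx D A^T = (map_mx D A)^T.
Proof. by rewrite map_trmx. Qed.
Lemma dermx1 n : map_mx D (1%:M : 'M[F]_n) = 0.
Proof. by apply/matrixP => i j; rewrite !mxE; case: (i == j); rewrite ?der1 ?der0. Qed.
Lemma der_tr n (A : 'M[F]_n) : D (\tr A) = \tr (map_mx D A).
Proof. by rewrite /mxtrace der_sum; apply: eq_bigr => i _; rewrite mxE. Qed.
End Laws.
End Derivation.

Lemma mxDE (F : nmodType) m n (A B : 'M[F]_(m, n)) i j : (A + B) i j = A i j + B i j.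
Proof. by rewrite mxE. Qed.
Lemma mxNE (F : zmodType) m n (A : 'M[F]_(m, n)) i j : (- A) i j = - A i j.
Proof. by rewrite mxE. Qed.

Lemma mx0E (F : nmodType) m n i j : (0 : 'M[F]_(m, n)) i j = 0.
Proof. by rewrite mxE. Qed.

Ltac mxab :=
  rewrite ?(mulmxDl, mulmxDr, mulmxBl, mulmxBr, mulNmx, mulmxN) ?mulmxA;
  apply/matrixP => ? ?; rewrite ?(mxDE, mxNE, mx0E); ring.

(** * Connection and curvature over a ring with derivations *)

Definition metric_trace (F : comNzRingType) (n : nat) (gi S : 'M[F]_n) : F :=
  \sum_k \sum_l gi k l * S k l.

(** Entry [(j, k)] is the Christoffel symbol of the first kind with [k] the
    lowered index. The definitions of this part are locked because unfolding them
    makes matrix identities intractable for unification. *)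
HB.lock Definition lowered_connection (F : comNzRingType) (n : nat) (d : 'I_n -> F -> F)
    (half : F) (g : 'M[F]_n) (i : 'I_n) : 'M[F]_n :=
  \matrix_(j, k) (half * (d i (g j k) + d j (g i k) - d k (g i j))).

HB.lock Definition connection (F : comNzRingType) (n : nat) (d : 'I_n -> F -> F)
    (half : F) (g gi : 'M[F]_n) (i : 'I_n) : 'M[F]_n :=
  lowered_connection d half g i *m gi.

(** The sign convention is the one for which the sphere has positive [R_ijij]: the
    entry [(k, l)] is the component along [l] of the curvature operator of [i],
    [j] applied to the [k]-th coordinate vector. *)
HB.lock Definition curvature_mx (F : comNzRingType) (n : nat) (d : 'I_n -> F -> F)
    (half : F) (g gi : 'M[F]_n) (i j : 'I_n) : 'M[F]_n :=
  let Gam := connection d half g gi in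
  map_mx (d j) (Gam i) - map_mx (d i) (Gam j) + Gam i *m Gam j - Gam j *m Gam i.

HB.lock Definition lowered_curvature (F : comNzRingType) (n : nat) (d : 'I_n -> F -> F)
    (half : F) (g gi : 'M[F]_n) (i j : 'I_n) : 'M[F]_n :=
  curvature_mx d half g gi i j *m g.

HB.lock Definition ricci_mx (F : comNzRingType) (n : nat) (d : 'I_n -> F -> F)
    (half : F) (g gi : 'M[F]_n) : 'M[F]_n :=
  \matrix_(i, j) \sum_k \sum_l gi k l * lowered_curvature d half g gi i k j l.

HB.lock Definition cov_tensor2 (F : comNzRingType) (n : nat) (d : 'I_n -> F -> F)
    (half : F) (g gi : 'M[F]_n) (k : 'I_n) (T : 'M[F]_n) : 'M[F]_n :=
  let Gam := connection d half g gi in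
  map_mx (d k) T - Gam k *m T - T *m (Gam k)^T.

(** Here [A] is a tensor with one lower index (its row) and one upper index (its
    column). *)
HB.lock Definition cov_endo (F : comNzRingType) (n : nat) (d : 'I_n -> F -> F)
    (half : F) (g gi : 'M[F]_n) (k : 'I_n) (A : 'M[F]_n) : 'M[F]_n :=
  let Gam := connection d half g gi in
  map_mx (d k) A - Gam k *m A + A *m Gam k.

(** The derivative acts on all four indices: on the matrix indices through
    [cov_tensor2], on [i] and [j] through the two sums. *)
HB.lock Definition cov_curvature (F : comNzRingType) (n : nat) (d : 'I_n -> F -> F)
    (half : F) (g gi : 'M[F]_n) (p i j : 'I_n) : 'M[F]_n :=
  let Gam := connection d half g gi in
  let L := lowered_curvature d half g gi in
  cov_tensor2 d half g gi p (L i j)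
  - \sum_a Gam p i a *: L a j - \sum_a Gam p j a *: L i a.

HB.lock Definition cov_cov_tensor2 (F : comNzRingType) (n : nat) (d : 'I_n -> F -> F)
    (half : F) (g gi : 'M[F]_n) (i j : 'I_n) (S : 'M[F]_n) : 'M[F]_n :=
  let cov2 := cov_tensor2 d half g gi in
  cov2 i (cov2 j S) - \sum_a connection d half g gi i j a *: cov2 a S.

HB.lock Definition hessian (F : comNzRingType) (n : nat) (d : 'I_n -> F -> F)
    (half : F) (g gi : 'M[F]_n) (f : F) (i j : 'I_n) : F :=
  d i (d j f) - \sum_a connection d half g gi i j a * d a f.

Section Curvature.
Variables (F : comNzRingType) (n : nat).
Variable d : 'I_n -> F -> F.
Hypothesis dd : forall i, derivation (d i).
Hypothesis dC : forall i j x, d i (d j x) = d j (d i x).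
Variables (half : F) (hh : half + half = 1).
Variables g gi : 'M[F]_n.
Hypotheses (gT : g^T = g) (giK : gi *m g = 1%:M).
Implicit Types (i j k l p q : 'I_n) (A B S T : 'M[F]_n).

Local Notation dm i := (map_mx (d i)).
Local Notation GL := (lowered_connection d half g).
Local Notation Gam := (connection d half g gi).
Local Notation C := (curvature_mx d half g gi).
Local Notation L := (lowered_curvature d half g gi).
Local Notation Ric := (ricci_mx d half g gi).
Local Notation cov2 := (cov_tensor2 d half g gi).
Local Notation E := (cov_endo d half g gi).
Local Notation cov4 := (cov_curvature d half g gi).
Local Notation cc := (cov_cov_tensor2 d half g gi).
Local Notation hess := (hessian d half g gi).
Local Notation ctr := (metric_trace gi).
Local Notation Scal := (ctr Ric).

Lemma gK : g *m gi = 1%:M. Proof. exact: mulmx1C. Qed.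
Lemma giT : gi^T = gi.
Proof.
have h : g *m gi^T = 1%:M by rewrite -{1}gT -trmx_mul giK trmx1.
by rewrite -[gi^T]mul1mx -giK -mulmxA h mulmx1.
Qed.
Lemma g_sym i j : g i j = g j i. Proof. by rewrite -{1}gT mxE. Qed.
Lemma gi_sym i j : gi i j = gi j i. Proof. by rewrite -{1}giT mxE. Qed.

Lemma GLE i j k : GL i j k = half * (d i (g j k) + d j (g i k) - d k (g i j)).
Proof. by rewrite unlock mxE. Qed.
Lemma GamE i : Gam i = GL i *m gi. Proof. by rewrite connection.unlock. Qed.
Lemma CE i j : C i j = dm j (Gam i) - dm i (Gam j) + Gam i *m Gam j - Gam j *m Gam i.
Proof. by rewrite curvature_mx.unlock. Qed.
Lemma LE i j : L i j = C i j *m g. Proof. by rewrite lowered_curvature.unlock. Qed.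
Lemma RicE i j : Ric i j = \sum_k \sum_l gi k l * L i k j l.
Proof. by rewrite ricci_mx.unlock mxE. Qed.
Lemma cov2_mxE k T : cov2 k T = dm k T - Gam k *m T - T *m (Gam k)^T.
Proof. by rewrite cov_tensor2.unlock. Qed.
Lemma EE k A : E k A = dm k A - Gam k *m A + A *m Gam k.
Proof. by rewrite cov_endo.unlock. Qed.
Lemma cov4_mxE p i j : cov4 p i j = cov2 p (L i j)
  - \sum_a Gam p i a *: L a j - \sum_a Gam p j a *: L i a.
Proof. by rewrite cov_curvature.unlock. Qed.
Lemma cc_mxE i j S : cc i j S = cov2 i (cov2 j S) - \sum_a Gam i j a *: cov2 a S.
Proof. by rewrite cov_cov_tensor2.unlock. Qed.
Lemma hessE f i j : hess f i j = d i (d j f) - \sum_a Gam i j a * d a f.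
Proof. by rewrite hessian.unlock. Qed.

Lemma half_dbl x : half * (x + x) = x.
Proof. by rewrite mulrDr -mulrDl hh mul1r. Qed.

Lemma GL_sym i j k : GL i j k = GL j i k.
Proof. by rewrite !GLE (g_sym i j) (addrC (d i _)). Qed.

Lemma Gam_sym i j k : Gam i j k = Gam j i k.
Proof. by rewrite !GamE !mxE; apply: eq_bigr => l _; rewrite GL_sym. Qed.

Lemma Gam_g i : Gam i *m g = GL i.
Proof. by rewrite GamE -mulmxA giK mulmx1. Qed.

(** Metric compatibility of the Levi-Civita connection, with lowered indices. *)
Lemma GL_sum i : GL i + (GL i)^T = dm i g.
Proof.
apply/matrixP => j k; rewrite !mxE !GLE (g_sym k j) -[RHS]half_dbl (g_sym i k) (g_sym i j); ring.
Qed.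

Lemma g_Gam i : g *m (Gam i)^T = (GL i)^T.
Proof. by rewrite -Gam_g [RHS]trmx_mul gT. Qed.

Lemma d_gi k : dm k gi = - ((Gam k)^T *m gi) - gi *m Gam k.
Proof.
have e : dm k gi *m g + gi *m dm k g = 0.
  by rewrite -(dermxM (dd k)) giK (dermx1 (dd k)).
have -> : dm k gi = - (gi *m dm k g *m gi).
  apply/eqP; rewrite -addr_eq0; apply/eqP.
  by rewrite -[dm k gi]mulmx1 -gK mulmxA -mulmxDl e mul0mx.
have -> : dm k g = Gam k *m g + g *m (Gam k)^T.
  by rewrite g_Gam Gam_g GL_sum.
rewrite mulmxDr mulmxDl (mulmxA gi g) giK mul1mx -!mulmxA gK mulmx1.
by rewrite opprD addrC.
Qed.

Lemma C_anti i j : C i j = - C j i.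
Proof. by rewrite !CE; mxab. Qed.

Lemma L_anti i j : L i j = - L j i.
Proof. by rewrite !LE C_anti mulNmx. Qed.

Lemma L_gi i j : L i j *m gi = C i j.
Proof. by rewrite LE -mulmxA gK mulmx1. Qed.

(** Lowering the index absorbs the derivatives of the inverse metric, which would
    otherwise appear in the derivatives of the connection. *)
Lemma L_lower i j : L i j = dm j (GL i) - dm i (GL j)
  - GL i *m gi *m (GL j)^T + GL j *m gi *m (GL i)^T.
Proof.
have e k l : dm k (GL l) = dm k (Gam l) *m g + Gam l *m (Gam k *m g + g *m (Gam k)^T).
  by rewrite -Gam_g (dermxM (dd k)) g_Gam Gam_g GL_sum.
have eT l : (GL l)^T = g *m (Gam l)^T by rewrite g_Gam.
rewrite LE CE !e !eT -!GamE; mxab.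
Qed.

(** The contraction of two Christoffel symbols of the first kind, which is the
    nonlinear part of the lowered curvature. *)
Definition chris_prod i k j l : F := \sum_a \sum_b GL i k a * gi a b * GL j l b.

Lemma chris_prod_swap i k j l : chris_prod i k j l = chris_prod j l i k.
Proof.
rewrite /chris_prod exchange_big /=; apply: eq_bigr => a _; apply: eq_bigr => b _.
by rewrite gi_sym; ring.
Qed.

Lemma chris_prod_sym1 i k j l : chris_prod i k j l = chris_prod k i j l.
Proof. by apply: eq_bigr => a _; apply: eq_bigr => b _; rewrite GL_sym. Qed.

Lemma chris_prod_sym2 i k j l : chris_prod i k j l = chris_prod i k l j.
Proof. by apply: eq_bigr => a _; apply: eq_bigr => b _; rewrite (GL_sym j l). Qed.

Lemma chris_prodE i k j l : (GL i *m gi *m (GL j)^T) k l = chris_prod i k j l.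
Proof.
rewrite mxE /chris_prod exchange_big /=; apply: eq_bigr => b _.
by rewrite !mxE mulr_suml.
Qed.

(** All symmetries of the curvature are visible in this formula, and the inverse
    metric enters only once, without derivatives. *)
Lemma L_entry i j k l : L i j k l =
  half * (d j (d k (g i l)) - d j (d l (g i k)) - d i (d k (g j l)) + d i (d l (g j k)))
  - chris_prod i k j l + chris_prod j k i l.
Proof.
rewrite L_lower !mxDE !mxNE !chris_prodE; congr (_ - _ + _).
rewrite !mxE !GLE !(der_half_mul (dd _) _ hh) !(derD (dd _)) !(derN (dd _)).
by rewrite (dC i j); ring.
Qed.

Lemma L_pair i j k l : L i j k l = L k l i j.
Proof.
rewrite !L_entry (chris_prod_sym1 k i) (chris_prod_sym2 i k l j) (chris_prod_sym1 l i)
  (chris_prod_swap i l) (chris_prod_sym1 k j).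
rewrite (dC l i) (dC l j) (dC k i) (dC k j) (g_sym k j) (g_sym k i) (g_sym l i) (g_sym l j); ring.
Qed.

Lemma L_antiE i j k l : L i j k l = - L j i k l.
Proof. by rewrite L_anti mxNE. Qed.

Lemma L_anti2 i j k l : L i j k l = - L i j l k.
Proof. by rewrite L_pair L_antiE L_pair. Qed.

Lemma L_flip i j k l : L i j k l = L j i l k.
Proof. by rewrite L_antiE L_anti2 opprK. Qed.

Lemma L_tr i j : (L i j)^T = - L i j.
Proof. by apply/matrixP => k l; rewrite !mxE -[RHS]mxNE mxNE -L_anti2. Qed.

Lemma RicC i j : Ric i j = \sum_k C i k j k.
Proof.
rewrite RicE; apply: eq_bigr => k _; rewrite -L_gi mxE; apply: eq_bigr => l _.
by rewrite gi_sym mulrC.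
Qed.

Lemma Ric_sym i j : Ric i j = Ric j i.
Proof.
rewrite !RicE exchange_big /=; apply: eq_bigr => k _; apply: eq_bigr => l _.
by rewrite gi_sym L_pair.
Qed.

Lemma Ric_tr : Ric^T = Ric.
Proof. by apply/matrixP => i j; rewrite mxE Ric_sym. Qed.

(** * Covariant derivatives and the Bianchi identities *)

Lemma cov2E k T i j : cov2 k T i j =
  d k (T i j) - \sum_a Gam k i a * T a j - \sum_a Gam k j a * T i a.
Proof.
rewrite cov2_mxE !mxDE !mxNE; congr (_ - _ - _); rewrite mxE //.
by apply: eq_bigr => a _; rewrite mxE mulrC.
Qed.

Lemma cov2N k S : cov2 k (- S) = - cov2 k S.
Proof. by rewrite !cov2_mxE (dermxN (dd k)); mxab. Qed.
Lemma cov2_tr k T : cov2 k T^T = (cov2 k T)^T.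
Proof.
apply/matrixP => i j; rewrite [RHS]mxE !cov2E !mxE addrAC; congr (_ - _ - _);
  by apply: eq_bigr => a _; rewrite mxE.
Qed.

Lemma ctrE S : ctr S = \tr (gi *m S^T).
Proof.
rewrite /metric_trace /mxtrace; apply: eq_bigr => k _; rewrite mxE.
by apply: eq_bigr => l _; rewrite mxE.
Qed.

Lemma ctrD S T : ctr (S + T) = ctr S + ctr T.
Proof. by rewrite !ctrE linearD mulmxDr mxtraceD. Qed.
Lemma ctrN S : ctr (- S) = - ctr S.
Proof. by rewrite !ctrE linearN mulmxN linearN. Qed.
Lemma ctrZ x S : ctr (x *: S) = x * ctr S.
Proof. by rewrite !ctrE linearZ /= -scalemxAr linearZ. Qed.
Lemma ctr_sum (I : finType) (S : I -> 'M[F]_n) : ctr (\sum_i S i) = \sum_i ctr (S i).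
Proof.
apply: (big_morph ctr ctrD).
by rewrite /metric_trace big1 // => k _; rewrite big1 // => l _; rewrite mxE mulr0.
Qed.

(** The metric is parallel, so traces commute with covariant derivatives. *)
Lemma ctr_cov p S : ctr (cov2 p S) = d p (ctr S).
Proof.
rewrite !ctrE (der_tr (dd p)) (dermxM (dd p)) -cov2_tr d_gi.
set U := S^T; have e : \tr (gi *m U *m (Gam p)^T) = \tr ((Gam p)^T *m gi *m U).
  by rewrite mxtrace_mulC mulmxA.
have trB A B : \tr (A - B) = \tr A - \tr B by rewrite raddfB.
have trN A : \tr (- A) = - \tr A by rewrite raddfN.
rewrite cov2_mxE !(mulmxBr, mulmxBl, mulNmx) !mulmxA !(mxtraceD, trB, trN) e; ring.
Qed.

Lemma cov2_mulg k A : cov2 k (A *m g) = E k A *m g.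
Proof.
have e : dm k g = Gam k *m g + g *m (Gam k)^T by rewrite g_Gam Gam_g GL_sum.
by rewrite cov2_mxE EE (dermxM (dd k)) e; mxab.
Qed.

Lemma E_mulgi k B : E k (B *m gi) = cov2 k B *m gi.
Proof.
have -> : cov2 k B = E k (B *m gi) *m g by rewrite -cov2_mulg -mulmxA giK mulmx1.
by rewrite -mulmxA gK mulmx1.
Qed.

Lemma dm_comm i j A : dm i (dm j A) = dm j (dm i A).
Proof. by apply/matrixP => k l; rewrite !mxE dC. Qed.

(** The Jacobi identity for the operators [d i - Gam i], whose commutators are the
    matrices [C i j]. *)
Lemma bianchi_C i j k : E k (C i j) + E i (C j k) + E j (C k i) = 0.
Proof.
rewrite !EE !CE !(dermxD (dd _)) !(dermxN (dd _)) !(dermxM (dd _)).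
by rewrite (dm_comm k j) (dm_comm k i) (dm_comm i j); mxab.
Qed.

Lemma bianchi_L i j k : cov2 k (L i j) + cov2 i (L j k) + cov2 j (L k i) = 0.
Proof. by rewrite !LE !cov2_mulg -!mulmxDl bianchi_C mul0mx. Qed.

Lemma cov4_anti p i j : cov4 p i j = - cov4 p j i.
Proof.
have e x y : \sum_a Gam p x a *: L a y = - \sum_a Gam p x a *: L y a.
  by rewrite -sumrN; apply: eq_bigr => a _; rewrite (L_anti a) scalerN.
rewrite !cov4_mxE (e i j) (e j i) (L_anti i j) cov2N; mxab.
Qed.

Lemma cov4E p i j k l : cov4 p i j k l = cov2 p (L i j) k l
  - \sum_a Gam p i a * L a j k l - \sum_a Gam p j a * L i a k l.
Proof.
rewrite cov4_mxE !mxDE !mxNE !summxE; congr (_ - _ - _);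
  by apply: eq_bigr => a _; rewrite mxE.
Qed.

Lemma cov4_anti2 p i j k l : cov4 p i j k l = - cov4 p i j l k.
Proof.
have e x y : cov2 p (L x y) k l = - cov2 p (L x y) l k.
  by rewrite -[in RHS](opprK (L x y)) -L_tr cov2N cov2_tr !mxE opprK.
rewrite !cov4E e.
have e2 (u v : 'I_n -> F) : (forall a, u a = - v a) -> \sum_a u a = - \sum_a v a.
  by move=> uv; rewrite -sumrN; apply: eq_bigr.
rewrite (e2 (fun a => Gam p j a * L i a k l) (fun a => Gam p j a * L i a l k)); last first.
  by move=> a; rewrite L_anti2 mulrN.
rewrite (e2 (fun a => Gam p i a * L a j k l) (fun a => Gam p i a * L a j l k)); last first.
  by move=> a; rewrite L_anti2 mulrN.
ring.
Qed.

Lemma cov4_flip p i j k l : cov4 p i j k l = cov4 p j i l k.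
Proof. by rewrite cov4_anti2 -mxNE -cov4_anti. Qed.

(** Passing from [bianchi_L] to full covariant derivatives adds Christoffel terms
    for [i] and [j]; they cancel in the cyclic sum as the connection is symmetric. *)
Lemma bianchi i j p : cov4 p i j + cov4 i j p + cov4 j p i = 0.
Proof.
have e x y z : \sum_a Gam x y a *: L a z = - \sum_a Gam y x a *: L z a.
  by rewrite -sumrN; apply: eq_bigr => a _; rewrite (L_anti a) scalerN Gam_sym.
have key (x y z a b c : 'M[F]_n) :
    x - (- a) - b + (y - (- c) - a) + (z - (- b) - c) = x + y + z by mxab.
by rewrite !cov4_mxE (e p i j) (e j p i) (e i j p) key bianchi_L.
Qed.

Lemma exchange4 (H : 'I_n -> 'I_n -> 'I_n -> 'I_n -> F) :
  \sum_p \sum_k \sum_j \sum_l H p k j l = \sum_j \sum_l \sum_p \sum_k H p k j l.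
Proof.
transitivity (\sum_p \sum_j \sum_k \sum_l H p k j l).
  by apply: eq_bigr => p _; rewrite exchange_big.
rewrite exchange_big; apply: eq_bigr => j _ /=.
transitivity (\sum_p \sum_l \sum_k H p k j l).
  by apply: eq_bigr => p _; rewrite exchange_big.
by rewrite exchange_big.
Qed.

Lemma exchange3 (H : 'I_n -> 'I_n -> 'I_n -> F) :
  \sum_k \sum_l \sum_q H k l q = \sum_q \sum_k \sum_l H k l q.
Proof.
transitivity (\sum_k \sum_q \sum_l H k l q); last by rewrite exchange_big.
by apply: eq_bigr => k _; rewrite exchange_big.
Qed.

Lemma ctr_cov4 p i k :
  ctr (\matrix_(j, l) cov4 p i j k l) = cov2 p Ric i k.
Proof.
pose S x y : 'M[F]_n := \matrix_(j, l) L x j y l.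
have RicS x y : Ric x y = ctr (S x y).
  by rewrite RicE; apply: eq_bigr => a _; apply: eq_bigr => b _; rewrite mxE.
have -> : \matrix_(j, l) cov4 p i j k l =
    cov2 p (S i k) - \sum_a Gam p i a *: S a k - \sum_a Gam p k a *: S i a.
  apply/matrixP => j l; rewrite !mxDE !mxNE !summxE [LHS]mxE cov4E !cov2E.
  under [in RHS]eq_bigr do rewrite mxE.
  have e : \sum_a Gam p l a * S i k j a = \sum_a Gam p l a * L i j k a.
    by apply: eq_bigr => a _; rewrite mxE.
  have e1 : \sum_a (Gam p i a *: S a k) j l = \sum_a Gam p i a * L a j k l.
    by apply: eq_bigr => a _; rewrite !mxE.
  have e2 : \sum_a (Gam p k a *: S i a) j l = \sum_a Gam p k a * L i j a l.
    by apply: eq_bigr => a _; rewrite !mxE.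
  by rewrite e e1 e2 mxE; ring.
rewrite !ctrD !ctrN !ctr_sum ctr_cov -RicS cov2E; congr (_ - _ - _);
  by apply: eq_bigr => a _; rewrite ctrZ -RicS.
Qed.

Definition divRic i := \sum_p \sum_k gi p k * cov2 p Ric i k.

(** Twice the trace of the second Bianchi identity: two of its three terms give
    the divergence of the Ricci tensor, the third the gradient of the scalar
    curvature. *)
Lemma contracted_bianchi i : divRic i = half * d i Scal.
Proof.
pose T (G : 'I_n -> 'I_n -> 'I_n -> 'I_n -> F) :=
  \sum_p \sum_k gi p k * ctr (\matrix_(j, l) G p k j l).
have TD G H : T (fun p k j l => G p k j l + H p k j l) = T G + T H.
  rewrite /T -big_split; apply: eq_bigr => p _; rewrite -big_split; apply: eq_bigr => k _ /=.
  by rewrite -mulrDr -ctrD; congr (_ * ctr _); apply/matrixP => ? ?; rewrite !mxE.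
have Text G H : (forall p k j l, G p k j l = H p k j l) -> T G = T H.
  move=> GH; apply: eq_bigr => p _; apply: eq_bigr => k _; congr (_ * ctr _).
  by apply/matrixP => ? ?; rewrite !mxE.
have T4 G : T G = \sum_p \sum_k \sum_j \sum_l gi p k * (gi j l * G p k j l).
  apply: eq_bigr => p _; apply: eq_bigr => k _; rewrite /metric_trace mulr_sumr.
  by apply: eq_bigr => j _; rewrite mulr_sumr; apply: eq_bigr => l _; rewrite mxE.
have T1 : T (fun p k j l => cov4 p i j k l) = divRic i.
  by apply: eq_bigr => p _; apply: eq_bigr => k _; rewrite ctr_cov4.
have T2 : T (fun p k j l => cov4 i j p k l) = - d i Scal.
  rewrite /T -ctr_cov /metric_trace -sumrN; apply: eq_bigr => p _; rewrite -sumrN.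
  apply: eq_bigr => k _; rewrite -mulrN; congr (_ * _).
  by rewrite -ctr_cov4 -ctrN; congr ctr; apply/matrixP => j l; rewrite !mxE cov4_anti mxNE.
have T3 : T (fun p k j l => cov4 j p i k l) = divRic i.
  rewrite -T1 !T4 exchange4; apply: eq_bigr => a _; apply: eq_bigr => b _.
  by apply: eq_bigr => p _; apply: eq_bigr => k _; rewrite cov4_flip mulrCA.
have : T (fun p k j l => cov4 p i j k l + cov4 i j p k l + cov4 j p i k l) = 0.
  rewrite -[RHS]/(0); transitivity (T (fun _ _ _ _ => 0)); last first.
    rewrite /T big1 // => p _; rewrite big1 // => k _.
    by rewrite /metric_trace big1 ?mulr0 // => a _; rewrite big1 // => b _; rewrite mxE mulr0.
  by apply: Text => p k j l; have := bianchi i j p => /matrixP/(_ k l); rewrite !mxE.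
rewrite (TD (fun p k j l => cov4 p i j k l + cov4 i j p k l)) TD T1 T2 T3 => e.
rewrite -[LHS]half_dbl; congr (_ * _); apply/eqP; rewrite -subr_eq0; apply/eqP.
by rewrite -[RHS]e; ring.
Qed.

(** The connection is symmetric, so the terms in which it acts on the derivative
    indices cancel; what is left is the curvature acting on each index of [S]. *)
Lemma ricci_identity i j S : cc i j S - cc j i S = C i j *m S + S *m (C i j)^T.
Proof.
have e : \sum_a Gam i j a *: cov2 a S = \sum_a Gam j i a *: cov2 a S.
  by apply: eq_bigr => a _; rewrite Gam_sym.
have trB A B : (A - B)^T = A^T - B^T by rewrite raddfB.
have trD A B : (A + B)^T = A^T + B^T by rewrite raddfD.
rewrite !cc_mxE e CE !(trB, trD) !trmx_mul !cov2_mxE !(dermxD (dd _)) !(dermxN (dd _)) !(dermxM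
  (dd _)).
by rewrite !(dermx_tr _ (Gam _)) (dm_comm i j); mxab.
Qed.

Lemma ctr_cc i j S : ctr (cc i j S) = hess (ctr S) i j.
Proof.
rewrite cc_mxE hessE ctrD ctrN ctr_sum !ctr_cov; congr (_ - _); apply: eq_bigr => a _.
by rewrite ctrZ ctr_cov.
Qed.

Lemma hess_sym f i j : hess f i j = hess f j i.
Proof. by rewrite !hessE dC; congr (_ - _); apply: eq_bigr => a _; rewrite Gam_sym. Qed.

Lemma cc_sym i j k l S : S^T = S -> cc i j S k l = cc i j S l k.
Proof.
move=> sS; have e T : T^T = T -> T k l = T l k by move=> TT; rewrite -{1}TT mxE.
apply: e; rewrite cc_mxE raddfB raddf_sum /= -cov2_tr -cov2_tr sS; congr (_ - _).
by apply: eq_bigr => a _; rewrite linearZ /= -cov2_tr sS.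
Qed.

Lemma ccE i k j l S : cc i k S j l =
  d i (cov2 k S j l) - \sum_a Gam i j a * cov2 k S a l - \sum_a Gam i l a * cov2 k S j a
  - \sum_a Gam i k a * cov2 a S j l.
Proof.
have -> : \sum_a Gam i k a * cov2 a S j l = (\sum_a Gam i k a *: cov2 a S) j l.
  by rewrite summxE; apply: eq_bigr => a _; rewrite mxE.
by rewrite cc_mxE mxDE mxNE (cov2E i (cov2 k S)).
Qed.

(** The contracted Bianchi identity, differentiated. *)
Lemma ctr_div i j : \sum_k \sum_l gi k l * cc i k Ric j l = half * hess Scal i j.
Proof.
pose S x : 'M[F]_n := \matrix_(k, l) cov2 k Ric x l.
have dS x : ctr (S x) = half * d x Scal.
  rewrite -contracted_bianchi; apply: eq_bigr => a _; apply: eq_bigr => b _.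
  by rewrite mxE.
have -> : \sum_k \sum_l gi k l * cc i k Ric j l =
   ctr (cov2 i (S j) - \sum_a Gam i j a *: S a).
  apply: eq_bigr => k _; apply: eq_bigr => l _; congr (_ * _).
  rewrite ccE mxDE mxNE summxE (cov2E i (S j)) [S j k l]mxE.
  have -> : \sum_a Gam i k a * S j a l = \sum_a Gam i k a * cov2 a Ric j l.
    by apply: eq_bigr => a _; rewrite mxE.
  have -> : \sum_a Gam i l a * S j k a = \sum_a Gam i l a * cov2 k Ric j a.
    by apply: eq_bigr => a _; rewrite mxE.
  have -> : \sum_a (Gam i j a *: S a) k l = \sum_a Gam i j a * cov2 k Ric a l.
    by apply: eq_bigr => a _; rewrite !mxE.
  ring.
rewrite ctrD ctrN ctr_sum ctr_cov dS (der_half_mul (dd _) _ hh) hessE mulrBr; congr (_ - _).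
by rewrite mulr_sumr; apply: eq_bigr => a _; rewrite ctrZ dS mulrCA.
Qed.

(** * Evolution of the curvature under the Ricci flow *)

Variable dt : F -> F.
Hypothesis ddt : derivation dt.
Hypothesis dtC : forall i x, dt (d i x) = d i (dt x).
Hypothesis flow : forall i j, dt (g i j) = - (Ric i j + Ric i j).

Local Notation dmt := (map_mx dt).
Local Notation V i := (cov2 i Ric).

Lemma dt_g : dmt g = - (Ric + Ric).
Proof. by apply/matrixP => i j; rewrite !mxE flow. Qed.

Lemma dt_gi : dmt gi = gi *m (Ric + Ric) *m gi.
Proof.
have e : dmt gi *m g + gi *m dmt g = 0.
  by rewrite -(dermxM ddt) giK (dermx1 ddt).
have -> : dmt gi = - (gi *m dmt g *m gi).
  apply/eqP; rewrite -addr_eq0; apply/eqP.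
  by rewrite -[dmt gi]mulmx1 -gK mulmxA -mulmxDl e mul0mx.
by rewrite dt_g mulmxN mulNmx opprK.
Qed.

(** The variation of the Levi-Civita connection is a tensor, given by covariant
    derivatives of the variation [- 2 Ric] of the metric ([dt_Gam]). *)
Definition dtGamL i : 'M[F]_n := \matrix_(j, l) - (V i j l + V j i l - V l i j).

Lemma dt_GL i j k :
  dt (GL i j k) = - (d i (Ric j k) + d j (Ric i k) - d k (Ric i j)).
Proof.
rewrite GLE (der_half_mul ddt _ hh) !(derD ddt) !(derN ddt) !dtC !flow.
rewrite !(derN (dd _)) !(derD (dd _)).
by rewrite -[RHS]half_dbl; congr (_ * _); ring.
Qed.

Lemma dt_Gam i : dmt (Gam i) = dtGamL i *m gi.
Proof.
suff e : dmt (Gam i) *m g = dtGamL i by rewrite -e -mulmxA gK mulmx1.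
have e : dmt (GL i) = dmt (Gam i) *m g - Gam i *m (Ric + Ric).
  by rewrite -Gam_g (dermxM ddt) dt_g mulmxN.
have -> : dmt (Gam i) *m g = dmt (GL i) + Gam i *m (Ric + Ric) by rewrite e subrK.
apply/matrixP => j k; rewrite mxDE !mxE dt_GL !cov2E.
have -> : \sum_j0 Gam i j j0 * (Ric + Ric) j0 k =
    \sum_a Gam i j a * Ric a k + \sum_a Gam i j a * Ric a k.
  by rewrite -big_split; apply: eq_bigr => a _; rewrite /= mxDE mulrDr.
have e1 x y z : \sum_a Gam x y a * Ric z a = \sum_a Gam x y a * Ric a z.
  by apply: eq_bigr => a _; rewrite (Ric_sym z).
have e2 x y z : \sum_a Gam x y a * Ric a z = \sum_a Gam y x a * Ric a z.
  by apply: eq_bigr => a _; rewrite Gam_sym.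
rewrite !e1 (e2 j i) (e2 k i) (e2 k j).
by move: (\sum_a _) (\sum_a _) (\sum_a _) => u v w; ring.
Qed.

(** The Christoffel terms in the variation of the curvature combine into covariant
    derivatives of the variation of the connection. *)
Lemma dt_C i j : dmt (C i j) = (cov2 j (dtGamL i) - cov2 i (dtGamL j)) *m gi.
Proof.
rewrite mulmxBl -!E_mulgi -!dt_Gam !EE CE !(dermxD ddt, dermxN ddt, dermxM ddt).
have comm k A : dmt (dm k A) = dm k (dmt A).
  by apply/matrixP => x y; rewrite !mxE dtC.
by rewrite !comm; mxab.
Qed.

Definition lap_Ric : 'M[F]_n := \matrix_(i, j) \sum_k \sum_l gi k l * cc k l Ric i j.
Definition Ric_upper := gi *m Ric *m gi.
Definition Rm_Ric : 'M[F]_n := \matrix_(i, j) \sum_k \sum_l L i k j l * Ric_upper k l.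
Definition Ric_square : 'M[F]_n := Ric *m gi *m Ric.

Lemma cov_dtGamL k i j l :
  cov2 k (dtGamL i) j l - \sum_a Gam k i a * dtGamL a j l =
  - (cc k i Ric j l + cc k j Ric i l - cc k l Ric i j).
Proof.
rewrite cov2E !ccE mxE !(derN (dd _)) !(derD (dd _)) !(derN (dd _)).
have e x (G : 'I_n -> F) (v : 'I_n -> F) : (forall a, G a = v a) ->
  \sum_a Gam k x a * G a = \sum_a Gam k x a * v a.
  by move=> Gv; apply: eq_bigr => a _; rewrite Gv.
have sp x (u v w : 'I_n -> F) : \sum_a Gam k x a * (- (u a + v a - w a)) =
   - (\sum_a Gam k x a * u a + \sum_a Gam k x a * v a - \sum_a Gam k x a * w a).
  rewrite -big_split /= -sumrB -sumrN; apply: eq_bigr => a _ /=; ring.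
rewrite (e j (fun a => dtGamL i a l) (fun a => - (V i a l + V a i l - V l i a))); last first.
  by move=> a; rewrite mxE.
rewrite (e l (fun a => dtGamL i j a) (fun a => - (V i j a + V j i a - V a i j))); last first.
  by move=> a; rewrite mxE.
rewrite (e i (fun a => dtGamL a j l) (fun a => - (V a j l + V j a l - V l a j))); last first.
  by move=> a; rewrite mxE.
rewrite !sp.
do 9![move: (\sum_a _) => ?]; ring.
Qed.

(** The trace of [dt_C], expanded by [cov_dtGamL]; the terms that come from the
    derivative index of the connection cancel. *)
Lemma dt_Ric_cc i j : dt (Ric i j) = \sum_k \sum_l gi k l *
   (cc i k Ric j l + cc i j Ric k l - cc i l Ric k j
    - (cc k i Ric j l + cc k j Ric i l - cc k l Ric i j)).
Proof.
rewrite RicC (der_sum ddt); apply: eq_bigr => k _.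
have -> : dt (C i k j k) = dmt (C i k) j k by rewrite mxE.
rewrite dt_C mxE; apply: eq_bigr => l _; rewrite (gi_sym l k) mulrC mxDE mxNE; congr (_ * _).
have := cov_dtGamL k i j l; have := cov_dtGamL i k j l.
have -> : \sum_a Gam k i a * dtGamL a j l = \sum_a Gam i k a * dtGamL a j l.
  by apply: eq_bigr => a _; rewrite Gam_sym.
move: (\sum_a _) => u /eqP; rewrite subr_eq => /eqP -> /eqP; rewrite subr_eq => /eqP ->.
ring.
Qed.

Lemma Ric_upper_sym k l : Ric_upper k l = Ric_upper l k.
Proof.
have e : Ric_upper^T = Ric_upper by rewrite /Ric_upper !trmx_mul giT Ric_tr mulmxA.
by rewrite -{1}e mxE.
Qed.

Lemma Rm_Ric_sym i j : Rm_Ric i j = Rm_Ric j i.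
Proof.
rewrite !mxE exchange_big /=; apply: eq_bigr => k _; apply: eq_bigr => l _.
by rewrite Ric_upper_sym L_pair.
Qed.

(** Interchanging the derivatives gives the derivative of a divergence, which the
    contracted Bianchi identity evaluates, and curvature terms, which the trace
    turns into the two quadratic expressions. *)
Lemma commutator_term i j : \sum_k \sum_l gi k l * cc k i Ric j l =
  half * hess Scal i j - Rm_Ric i j + Ric_square i j.
Proof.
have -> : \sum_k \sum_l gi k l * cc k i Ric j l =
    \sum_k \sum_l gi k l * cc i k Ric j l +
    (\sum_k \sum_l gi k l * (C k i *m Ric) j l + \sum_k \sum_l gi k l * (Ric *m (C k i)^T) j l).
  rewrite -!big_split; apply: eq_bigr => k _ /=; rewrite -!big_split; apply: eq_bigr => l _ /=.
  have := ricci_identity k i Ric => /matrixP/(_ j l); rewrite !mxDE mxNE => /eqP.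
  by rewrite subr_eq => /eqP ->; ring.
rewrite ctr_div -addrA; congr (_ + (_ + _)).
- transitivity (\sum_k (L k i *m (Ric_upper)) j k).
    apply: eq_bigr => k _; rewrite /Ric_upper -(mulmxA gi) mulmxA L_gi mulmxA mxE.
    by apply: eq_bigr => l _; rewrite (gi_sym k) mulrC.
  rewrite mxE -sumrN; apply: eq_bigr => k _; rewrite mxE -sumrN; apply: eq_bigr => l _.
  by rewrite (L_antiE k i) (Ric_upper_sym l k) mulNr.
- have K m : \sum_k \sum_l gi k l * C k i l m = (Ric *m gi) i m.
    transitivity (\sum_k \sum_l \sum_q gi k l * (L k i l q * gi q m)).
      apply: eq_bigr => k _; apply: eq_bigr => l _.
      by rewrite -L_gi mxE mulr_sumr.
    rewrite exchange3 mxE; apply: eq_bigr => q _; rewrite RicE mulr_suml.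
    apply: eq_bigr => k _; rewrite mulr_suml; apply: eq_bigr => l _.
    by rewrite L_flip mulrA.
  transitivity (\sum_k \sum_l \sum_m gi k l * C k i l m * Ric m j).
    apply: eq_bigr => k _; apply: eq_bigr => l _; rewrite mxE mulr_sumr.
    by apply: eq_bigr => m _; rewrite mxE (Ric_sym j); ring.
  rewrite exchange3 /Ric_square [RHS]mxE; apply: eq_bigr => m _.
  by rewrite -K mulr_suml; apply: eq_bigr => k _; rewrite mulr_suml.
Qed.

(** Of the six terms in [dt_Ric_cc] one is the Laplacian and two are evaluated by
    [commutator_term]; the Hessians of the scalar curvature that these two and the
    remaining three contain cancel. *)
Lemma dt_Ric i j : dt (Ric i j) =
  lap_Ric i j + (Rm_Ric i j + Rm_Ric i j) - (Ric_square i j + Ric_square i j).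
Proof.
have split6 (a b c x y z : 'I_n -> 'I_n -> F) :
  \sum_k \sum_l gi k l * (a k l + b k l - c k l - (x k l + y k l - z k l)) =
  \sum_k \sum_l gi k l * a k l + \sum_k \sum_l gi k l * b k l
  - \sum_k \sum_l gi k l * c k l - (\sum_k \sum_l gi k l * x k l
  + \sum_k \sum_l gi k l * y k l - \sum_k \sum_l gi k l * z k l).
  rewrite -!big_split /= -!sumrB; apply: eq_bigr => k _.
  rewrite -!big_split /= -!sumrB; apply: eq_bigr => l _ /=; ring.
rewrite dt_Ric_cc split6 (commutator_term i j) (commutator_term j i) ctr_div.
have -> : \sum_k \sum_l gi k l * cc i l Ric k j = half * hess Scal i j.
  rewrite -ctr_div exchange_big; apply: eq_bigr => k _; apply: eq_bigr => l _.
  by rewrite gi_sym (cc_sym _ _ _ _ Ric_tr).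
have -> : \sum_k \sum_l gi k l * cc i j Ric k l = hess Scal i j by rewrite -ctr_cc.
have -> : \sum_k \sum_l gi k l * cc k l Ric i j = lap_Ric i j by rewrite mxE.
have r2 : Ric_square j i = Ric_square i j.
  have e : Ric_square^T = Ric_square by rewrite /Ric_square !trmx_mul giT Ric_tr mulmxA.
  by rewrite -{1}e mxE.
rewrite (hess_sym Scal j i) (Rm_Ric_sym j i) r2.
rewrite -[in X in _ = X](half_dbl (Rm_Ric i j)); set h := half * _ .
have -> : hess Scal i j = half * hess Scal i j + half * hess Scal i j.
  by rewrite -mulrDr half_dbl.
rewrite /h half_dbl; ring.
Qed.

Lemma ctr_lap : ctr lap_Ric = ctr (\matrix_(k, l) hess Scal k l).
Proof.
rewrite /metric_trace.
transitivity (\sum_i \sum_j \sum_k \sum_l gi i j * (gi k l * cc k l Ric i j)).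
  apply: eq_bigr => i _; apply: eq_bigr => j _; rewrite mxE mulr_sumr.
  by apply: eq_bigr => k _; rewrite mulr_sumr.
rewrite exchange4; apply: eq_bigr => k _; apply: eq_bigr => l _.
rewrite [in RHS]mxE -ctr_cc mulr_sumr; apply: eq_bigr => i _; rewrite mulr_sumr.
by apply: eq_bigr => j _; rewrite mulrCA.
Qed.

Lemma ctr_Rm_Ric : ctr Rm_Ric = ctr Ric_square.
Proof.
transitivity (\sum_i \sum_j \sum_k \sum_l gi i j * (L i k j l * Ric_upper k l)).
  apply: eq_bigr => i _; apply: eq_bigr => j _; rewrite mxE mulr_sumr.
  by apply: eq_bigr => k _; rewrite mulr_sumr.
rewrite exchange4 ctrE.
transitivity (\tr (Ric *m Ric_upper)).
  rewrite /mxtrace; apply: eq_bigr => k _; rewrite mxE; apply: eq_bigr => l _.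
  rewrite RicE mulr_suml; apply: eq_bigr => i _; rewrite mulr_suml; apply: eq_bigr => j _.
  by rewrite mulrA L_flip Ric_upper_sym.
rewrite /Ric_square /Ric_upper !trmx_mul giT Ric_tr mxtrace_mulC !mulmxA.
by rewrite [RHS]mxtrace_mulC !mulmxA mxtrace_mulC !mulmxA.
Qed.

Lemma dt_Scal : dt Scal = ctr (\matrix_(k, l) dt (Ric k l)) + (ctr Ric_square + ctr Ric_square).
Proof.
have e : \matrix_(k, l) dt (Ric k l) = dmt Ric by apply/matrixP => k l; rewrite !mxE.
rewrite e !ctrE (der_tr ddt) (dermxM ddt) dt_gi !Ric_tr mxtraceD addrC; congr (_ + _).
  by rewrite -{1}Ric_tr (dermx_tr).
have r2 : Ric_square^T = Ric_square by rewrite /Ric_square !trmx_mul giT Ric_tr mulmxA.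
rewrite r2 /Ric_square mulmxDr !mulmxDl mxtraceD -!mulmxA; ring.
Qed.

(** The left-hand side is the trace of Hamilton's matrix M without its last term.
    The trace of the Hessian is the Laplacian, so half a Laplacian and the square
    of the Ricci tensor remain. *)
Lemma traced_evolution :
  ctr (\matrix_(k, l) (dt (Ric k l) - half * hess Scal k l + Ric_square k l)) = half * dt Scal.
Proof.
have e : \matrix_(k, l) (dt (Ric k l) - half * hess Scal k l + Ric_square k l) =
  (\matrix_(k, l) dt (Ric k l)) - half *: (\matrix_(k, l) hess Scal k l) + Ric_square.
  by apply/matrixP => k l; rewrite !mxDE !mxNE !mxE.
have e2 : \matrix_(k, l) dt (Ric k l) = lap_Ric + (Rm_Ric + Rm_Ric) - (Ric_square + Ric_square).
  by apply/matrixP => k l; rewrite !mxDE !mxNE mxE dt_Ric !mxDE.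
rewrite dt_Scal e !ctrD !ctrN ctrZ e2 !ctrD !ctrN !ctrD ctr_Rm_Ric ctr_lap.
set x := ctr _; set y := ctr Ric_square.
have -> : half * (x + (y + y) - (y + y) + (y + y)) = half * x + y.
  by rewrite -[X in _ = _ + X]half_dbl; ring.
have {1}<- : half * x + half * x = x by rewrite -mulrDr half_dbl.
ring.
Qed.
End Curvature.

(** * From metrics in coordinates to the ring of smooth functions *)

Section Transfer.
Context {R : realType} {m m' : nat}.
Variables (D0 : set 'rV[R]_m) (D : domain R m').
Variables (io : 'rV[R]_m -> 'rV[R]_m') (ka : 'I_m -> 'I_m').
Hypothesis io_basis : forall i (h : R) (q : 'rV[R]_m),
  io (h *: basis_vec i + q) = h *: basis_vec (ka i) + io q.
Hypothesis io_dom : forall i (q : 'rV[R]_m), dset D (io q) ->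
  \forall h \near (0 : R), D0 (h *: basis_vec i + q) <-> dset D (h *: basis_vec (ka i) + io q).
Local Notation S := (smooth_fun D).
Implicit Types (f : 'rV[R]_m -> R) (G H : S) (q : 'rV[R]_m).

(** [io] embeds the coordinates of a slice, [ka] names its coordinate directions
    in the ambient space, and [rep f G] says that [f] is the restriction of [G] to
    the slice. Taking [io] to be a time slice lets the geometry of M at a fixed
    time be computed by functions of space and time; taking the identity covers
    the product itself. *)
Definition rep f G := forall q, dset D (io q) -> f q = G (io q).

(** Derivatives along the slice see the same points as the ambient ones. *)
Lemma rep_admissible i q : dset D (io q) ->
  admissible D0 i q = admissible (dset D) (ka i) (io q).
Proof.
move=> Dq; have n0 := nbhs_dnbhs (io_dom i Dq).
apply/seteqP; split=> V; rewrite /admissible /within /= => HV;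
  by apply: filterS2 HV n0 => h h1 h2 h3; apply: h1; apply/h2.
Qed.

Lemma rep_is_partial i f G q : rep f G -> dset D (io q) ->
  is_partial D0 i f q (Spart (ka i) G (io q)).
Proof.
move=> fG Dq; rewrite /is_partial rep_admissible //.
apply: cvg_trans (@S_is_partial _ _ _ (ka i) G _ Dq).
have F := admissible_filter (dset D) (ka i) (io q).
apply: near_eq_cvg.
apply: filterS (near_admissible (dset D) (ka i) (io q)) => h [_ Dh].
by rewrite /diff_quot (fG q) // (fG (h *: basis_vec i + q)) io_basis.
Qed.

Lemma rep_partial i f G : rep f G -> rep (partial D0 i f) (Spart (ka i) G).
Proof.
move=> fG q Dq; have h := @rep_is_partial i f G q fG Dq.
have P : ProperFilter (admissible D0 i q).
  by rewrite rep_admissible //; apply: admissible_proper => //; exact: domain_lower_open.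
exact: cvg_lim h.
Qed.

Lemma rep_cst (x : R) : rep (fun=> x) (Scst D x).
Proof. by move=> q Dq; rewrite ScstE. Qed.
Lemma repD f1 f2 G1 G2 : rep f1 G1 -> rep f2 G2 -> rep (fun q => f1 q + f2 q) (G1 + G2).
Proof. by move=> h1 h2 q Dq; rewrite SD h1 // h2. Qed.
Lemma repM f1 f2 G1 G2 : rep f1 G1 -> rep f2 G2 -> rep (fun q => f1 q * f2 q) (G1 * G2).
Proof. by move=> h1 h2 q Dq; rewrite SM h1 // h2. Qed.
Lemma repN f1 G1 : rep f1 G1 -> rep (fun q => - f1 q) (- G1).
Proof. by move=> h1 q Dq; rewrite SN h1. Qed.
Lemma repB f1 f2 G1 G2 : rep f1 G1 -> rep f2 G2 -> rep (fun q => f1 q - f2 q) (G1 - G2).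
Proof. by move=> h1 h2; apply: repD => //; exact: repN. Qed.
Lemma rep_sum (I : finType) (f : I -> 'rV[R]_m -> R) (G : I -> S) :
  (forall i, rep (f i) (G i)) -> rep (fun q => \sum_i f i q) (\sum_i G i).
Proof.
by move=> fG q Dq; rewrite S_sum; apply: eq_bigr => i _; exact: fG.
Qed.
Lemma rep_ext f G H : rep f G -> G = H -> rep f H.
Proof. by move=> h <-. Qed.
Lemma rep_ext0 f1 f2 G : (forall q, f1 q = f2 q) -> rep f1 G -> rep f2 G.
Proof. by move=> e h q Dq; rewrite -e h. Qed.

Definition Shalf : S := Scst D 2^-1.
Lemma Shalf_dbl : Shalf + Shalf = 1.
Proof. by apply: S_eq => p Dp; rewrite SD ScstE // S1 //; field. Qed.

Lemma Spart_derivation a : derivation (@Spart R m' D a).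
Proof. by split=> [u v|u v]; [exact: SpartD | exact: SpartM]. Qed.

Variables (gm : 'rV[R]_m -> 'M[R]_m) (G Gi : 'M[S]_m).
Hypothesis gG : forall i j, rep (fun q => gm q i j) (G i j).
Hypotheses (GT : G^T = G) (GiK : Gi *m G = 1%:M).

Local Notation d := (fun i => @Spart R m' D (ka i)).
Local Notation Gam := (connection d Shalf G Gi).
Local Notation L := (lowered_curvature d Shalf G Gi).
Local Notation RicG := (ricci_mx d Shalf G Gi).
Local Notation cov2 := (cov_tensor2 d Shalf G Gi).
Local Notation cc := (cov_cov_tensor2 d Shalf G Gi).
Local Notation hess := (hessian d Shalf G Gi).
Local Notation ScalG := (metric_trace Gi RicG).

Let dd i : derivation (d i) := Spart_derivation (ka i).
Let dC i j x : d i (d j x) = d j (d i x) := Spart_comm (ka i) (ka j) x.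

(** At each point [Gi] provides a left inverse, so the matrix is invertible there
    and the left inverse is [invmx]. *)
Lemma rep_ginv i j : rep (fun q => ginv gm q i j) (Gi i j).
Proof.
move=> q Dq; pose N : 'M[R]_m := \matrix_(i, j) (Gi i j) (io q).
have e : N *m gm q = 1%:M.
  apply/matrixP => a b; rewrite !mxE.
  have := congr1 (fun M : 'M[S]_m => (M a b) (io q)) GiK.
  rewrite !mxE S_sum => e; rewrite (_ : (a == b)%:R = ((a == b)%:R : S) (io q)); last first.
    by case: (a == b); rewrite ?S1 ?S0.
  by rewrite -e; apply: eq_bigr => k _; rewrite SM !mxE -(gG k b Dq).
have gu : gm q \in unitmx by have := mulmx1_unit e; case.
rewrite /ginv -[invmx _]mul1mx -e -mulmxA mulmxV // mulmx1 mxE.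
by [].
Qed.

Let GiT i j : Gi i j = Gi j i := gi_sym GT GiK i j.

Lemma rep_christoffel k i j : rep (christoffel D0 gm k i j) (Gam i j k).
Proof.
have -> : Gam i j k = Shalf * \sum_l Gi k l *
   (d i (G j l) + d j (G i l) - d l (G i j)).
  rewrite GamE mxE mulr_sumr; apply: eq_bigr => l _; rewrite GLE GiT; ring.
apply: repM; first exact: rep_cst.
apply: rep_sum => l; apply: repM; first exact: rep_ginv.
by apply: repB; [apply: repD|]; apply: rep_partial.
Qed.

Lemma partial_cst0 i (x : R) q : dset D (io q) -> partial D0 i (fun=> x) q = 0.
Proof. by move=> Dq; rewrite (rep_partial i (@rep_cst x)) // Spart_cst S0. Qed.

Lemma rep_nabla (u : 'rV[R]_m) (Y : 'rV[R]_m -> 'rV[R]_m) (YG : 'I_m -> S) k :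
  (forall j, rep (fun q => Y q 0 j) (YG j)) ->
  rep (fun q => nabla D0 gm (fun=> u) Y q 0 k)
    (\sum_i Scst D (u 0 i) * d i (YG k)
     + \sum_i \sum_j Gam i j k * Scst D (u 0 i) * YG j).
Proof.
move=> hY; apply: (rep_ext0 (f1 := fun q => \sum_i u 0 i * partial D0 i (fun q => Y q 0 k) q
          + \sum_i \sum_j christoffel D0 gm k i j q * u 0 i * Y q 0 j)).
  by move=> q; rewrite mxE.
apply: repD; apply: rep_sum => i.
  by apply: repM; [exact: rep_cst | apply: rep_partial].
apply: rep_sum => j; apply: repM => //; apply: repM; [exact: rep_christoffel|exact: rep_cst].
Qed.

(** The vector fields are constant, so their Lie bracket vanishes and the
    coefficients pass through the derivatives. *)
Lemma rep_Rm (u v w : 'rV[R]_m) k :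
  rep (fun q => Rm D0 gm (fun=> u) (fun=> v) (fun=> w) q 0 k)
    (\sum_a \sum_i \sum_b Scst D (u 0 a) * Scst D (v 0 i) * Scst D (w 0 b) *
       curvature_mx d Shalf G Gi a i b k).
Proof.
(* the components of the covariant derivative of the constant field w *)
pose N (x : 'rV[R]_m) j := \sum_a \sum_b Gam a b j * Scst D (x 0 a) * Scst D (w 0 b).
have hN x j : rep (fun q => nabla D0 gm (fun=> x) (fun=> w) q 0 j) (N x j).
  have h := @rep_nabla x (fun=> w) (fun j => Scst D (w 0 j)) j (fun j => @rep_cst _).
  apply: rep_ext h _; rewrite big1 ?add0r // => i _.
  by rewrite Spart_cst mulr0.
have h1 := @rep_nabla v _ _ k (hN u).
have h2 := @rep_nabla u _ _ k (hN v).
have h3 q : dset D (io q) -> nabla D0 gm (lie_bracket D0 (fun=> u) (fun=> v)) (fun=> w) q 0 k = 0.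
  move=> Dq; have L0 i : lie_bracket D0 (fun=> u) (fun=> v) q 0 i = 0.
    by rewrite mxE big1 // => j _; rewrite !partial_cst0 // !mulr0 subr0.
  rewrite mxE big1 ?add0r => [|i _]; last by rewrite L0 mul0r.
  by rewrite big1 // => i _; rewrite big1 // => j _; rewrite L0 mulr0 mul0r.
move=> q Dq; have := repB h1 h2 Dq; have := h3 q Dq.
rewrite /Rm !mxE => -> ; rewrite addr0 => ->; congr (sval_of _ _).
have Nexp (x y : 'rV[R]_m) :
  \sum_i Scst D (x 0 i) * d i (N y k) + \sum_i \sum_j Gam i j k * Scst D (x 0 i) * N y j =
  \sum_a \sum_i \sum_b Scst D (y 0 a) * Scst D (x 0 i) * Scst D (w 0 b) *
    (d i (Gam a b k) + \sum_j Gam a b j * Gam i j k).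
  rewrite -big_split exchange_big; apply: eq_bigr => i _ /=.
  have -> : d i (N y k) = \sum_a \sum_b d i (Gam a b k) * Scst D (y 0 a) * Scst D (w 0 b).
    rewrite (der_sum (dd i)); apply: eq_bigr => a _; rewrite (der_sum (dd i)).
    apply: eq_bigr => b _; rewrite !(derM (dd i)) !Spart_cst; ring.
  have -> : \sum_j Gam i j k * Scst D (x 0 i) * N y j = \sum_a \sum_b
     \sum_j Gam i j k * Scst D (x 0 i) * (Gam a b j * Scst D (y 0 a) * Scst D (w 0 b)).
    rewrite [RHS]exchange3; apply: eq_bigr => j _; rewrite /N mulr_sumr.
    by apply: eq_bigr => a _; rewrite mulr_sumr.
  rewrite mulr_sumr -big_split; apply: eq_bigr => a _ /=.
  rewrite mulr_sumr -big_split; apply: eq_bigr => b _ /=.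
  rewrite mulrDr mulr_sumr; congr (_ + _); first by ring.
  by apply: eq_bigr => j _; ring.
rewrite (Nexp v u) (Nexp u v) [X in _ - X]exchange_big -sumrB; apply: eq_bigr => a _ /=.
rewrite -sumrB; apply: eq_bigr => i _; rewrite -sumrB; apply: eq_bigr => b _.
rewrite CE !mxDE !mxNE !mxE.
by ring.
Qed.

Lemma RiemE q (u v w z : 'rV[R]_m) : dset D (io q) ->
  Riem D0 gm q u v w z = \sum_a \sum_i \sum_b \sum_l
    u 0 a * v 0 i * w 0 b * z 0 l * (L a i b l) (io q).
Proof.
move=> Dq; rewrite /Riem mxE.
transitivity (\sum_l \sum_k \sum_a \sum_i \sum_b u 0 a * v 0 i * w 0 b * z 0 l *
   ((curvature_mx d Shalf G Gi a i b k) (io q) * (G k l) (io q))).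
  apply: eq_bigr => l _; rewrite mxE mulr_suml; apply: eq_bigr => k _.
  rewrite (rep_Rm u v w k Dq) S_sum !mulr_suml; apply: eq_bigr => a _.
  rewrite S_sum !mulr_suml; apply: eq_bigr => i _; rewrite S_sum !mulr_suml; apply: eq_bigr => b _.
  rewrite !SM !ScstE // -(gG k l Dq) [z^T _ _]mxE.
  by move: (sval_of _ _) (gm q k l) (u 0 a) (v 0 i) (w 0 b) (z 0 l) => *; ring.
transitivity (\sum_l \sum_a \sum_i \sum_b u 0 a * v 0 i * w 0 b * z 0 l * (L a i b l) (io q)).
  apply: eq_bigr => l _; rewrite exchange_big; apply: eq_bigr => a _ /=.
  rewrite exchange_big; apply: eq_bigr => i _ /=; rewrite exchange_big; apply: eq_bigr => b _ /=.
  rewrite -mulr_sumr LE mxE S_sum; congr (_ * _); by apply: eq_bigr => k _; rewrite SM.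
rewrite exchange_big; apply: eq_bigr => a _ /=.
rewrite exchange_big; apply: eq_bigr => i _ /=.
by rewrite exchange_big.
Qed.

Lemma rep_Riem_comp i j k l : rep (Riem_comp D0 gm i j k l) (L i j k l).
Proof.
move=> q Dq; rewrite /Riem_comp RiemE //.
under eq_bigr do under eq_bigr do under eq_bigr do under eq_bigr do rewrite -!mulrA.
under eq_bigr do under eq_bigr do under eq_bigr do rewrite -!mulr_sumr sum_basis.
under eq_bigr do under eq_bigr do rewrite -!mulr_sumr sum_basis.
under eq_bigr do rewrite -!mulr_sumr sum_basis.
by rewrite sum_basis.
Qed.

Lemma rep_Ric_comp i j : rep (Ric_comp D0 gm i j) (RicG i j).
Proof.
rewrite RicE; apply: rep_sum => k; apply: rep_sum => l; apply: repM.
  exact: rep_ginv.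
exact: rep_Riem_comp.
Qed.

Lemma rep_scal : rep (scal D0 gm) ScalG.
Proof.
apply: rep_sum => i; apply: rep_sum => j; apply: repM; [exact: rep_ginv|exact: rep_Ric_comp].
Qed.

Lemma rep_covRic k i j : rep (covD D0 gm (@Ric_tensor _ _ D0 gm) [:: k; i; j]) (cov2 k RicG i j).
Proof.
rewrite cov2E -addrA -opprD.
apply: repB; first by apply: rep_partial; exact: rep_Ric_comp.
apply: (rep_ext0 (f1 := fun q => \sum_l christoffel D0 gm l k i q * Ric_comp D0 gm l j q +
   \sum_l christoffel D0 gm l k j q * Ric_comp D0 gm i l q)).
  by move=> q; rewrite !big_ord_recl big_ord0 /= addr0.
by apply: repD; apply: rep_sum => a; apply: repM;
  [exact: rep_christoffel | exact: rep_Ric_comp | exact: rep_christoffel | exact: rep_Ric_comp].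
Qed.

Lemma rep_covcovRic k l i j :
  rep (covD D0 gm (covD D0 gm (@Ric_tensor _ _ D0 gm)) [:: k; l; i; j]) (cc k l RicG i j).
Proof.
rewrite ccE -!addrA -!opprD.
apply: repB; first by apply: rep_partial; exact: rep_covRic.
set T := covD D0 gm _.
apply: (rep_ext0 (f1 := fun q => \sum_a christoffel D0 gm a k i q * T [:: l; a; j] q +
   (\sum_a christoffel D0 gm a k j q * T [:: l; i; a] q +
    \sum_a christoffel D0 gm a k l q * T [:: a; i; j] q))).
  by move=> q; rewrite !big_ord_recl big_ord0 /= addr0 [RHS]addrC -addrA.
apply: repD; [|apply: repD]; apply: rep_sum => a; apply: repM;
  by [exact: rep_christoffel | exact: rep_covRic].
Qed.

Lemma rep_dscal j : rep (covD D0 gm (@scal_tensor _ _ D0 gm) [:: j]) (d j ScalG).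
Proof.
apply: (rep_ext0 (f1 := partial D0 j (scal D0 gm))).
  by move=> q; rewrite /= big_ord0 subr0.
by apply: rep_partial; exact: rep_scal.
Qed.

Lemma rep_hess i j :
  rep (covD D0 gm (covD D0 gm (@scal_tensor _ _ D0 gm)) [:: i; j]) (hess ScalG i j).
Proof.
rewrite hessE; apply: repB; first by apply: rep_partial; exact: rep_dscal.
set T := covD D0 gm _.
apply: (rep_ext0 (f1 := fun q => \sum_a christoffel D0 gm a i j q * T [:: a] q)).
  by move=> q; rewrite big_ord_recl big_ord0 /= addr0.
apply: rep_sum => a; apply: repM; [exact: rep_christoffel | exact: rep_dscal].
Qed.

Lemma rep_harnackP i j k : rep (harnackP D0 gm i j k) (cov2 i RicG j k - cov2 j RicG i k).
Proof. by apply: repB; exact: rep_covRic. Qed.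

Lemma rep_Ric_up k l : rep (Ric_up D0 gm k l) (Ric_upper d Shalf G Gi k l).
Proof.
have -> : Ric_upper d Shalf G Gi k l = \sum_a \sum_b Gi k a * Gi l b * RicG a b.
  rewrite /Ric_upper mxE exchange_big; apply: eq_bigr => b _.
  rewrite mxE mulr_suml; apply: eq_bigr => a _; rewrite (GiT l); ring.
apply: rep_sum => a; apply: rep_sum => b.
by apply: repM; [apply: repM; exact: rep_ginv|exact: rep_Ric_comp].
Qed.

Lemma rep_harnackM (t : R) i j : rep (harnackM D0 gm t i j)
  (lap_Ric d Shalf G Gi i j - Shalf * hess ScalG i j + (Rm_Ric d Shalf G Gi i j + Rm_Ric d Shalf
    G Gi i j)
   - Ric_square d Shalf G Gi i j + Scst D (2 * t)^-1 * RicG i j).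
Proof.
apply: repD; last by apply: repM; [exact: rep_cst|exact: rep_Ric_comp].
apply: repB; last first.
  have -> : Ric_square d Shalf G Gi i j = \sum_k \sum_l Gi k l * RicG i k * RicG j l.
    rewrite /Ric_square mxE exchange_big; apply: eq_bigr => l _.
    rewrite mxE mulr_suml; apply: eq_bigr => k _; rewrite (Ric_sym dd dC Shalf_dbl GT GiK j l);
      ring.
  apply: rep_sum => k; apply: rep_sum => l.
  by apply: repM; [apply: repM; [exact: rep_ginv|exact: rep_Ric_comp]|exact: rep_Ric_comp].
apply: repD; last first.
  apply: (rep_ext0 (f1 := fun q => (\sum_k \sum_l Riem_comp D0 gm i k j l q * Ric_up D0 gm k l q)
     + (\sum_k \sum_l Riem_comp D0 gm i k j l q * Ric_up D0 gm k l q))).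
    by move=> q; rewrite mulrDl !mul1r.
  have h : rep (fun q => \sum_k \sum_l Riem_comp D0 gm i k j l q * Ric_up D0 gm k l q)
     (Rm_Ric d Shalf G Gi i j).
    rewrite mxE; apply: rep_sum => k; apply: rep_sum => l.
    by apply: repM; [exact: rep_Riem_comp | exact: rep_Ric_up].
  exact: repD.
apply: repB; last by apply: repM; [exact: rep_cst | exact: rep_hess].
rewrite mxE; apply: rep_sum => k; apply: rep_sum => l; apply: repM; first exact: rep_ginv.
exact: rep_covcovRic.
Qed.
End Transfer.

(** * Block-diagonal metrics *)

Section Indices.
Variables n N : nat.
Local Notation I := 'I_(n + N + 1).
Implicit Types (i j : 'I_n) (b : 'I_N).

Lemma sum_tilde (V : nmodType) (f : I -> V) :
  \sum_a f a = \sum_i f (idxM N i) + \sum_b f (idxH n b) + f (idx0 n N).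
Proof.
rewrite big_split_ord big_split_ord /= big_ord1; congr (_ + f _).
Qed.

Variant idx_spec : I -> Type :=
  | IdxM i : idx_spec (idxM N i)
  | IdxH b : idx_spec (idxH n b)
  | Idx0 : idx_spec (idx0 n N).

Lemma idxP (a : I) : idx_spec a.
Proof.
rewrite -(@splitK (n + N) 1 a); case: (@fintype.split (n + N) 1 a) => [b|b] /=.
  rewrite -(@splitK n N b); case: (@fintype.split n N b) => [i|i] /=; by constructor.
by rewrite (ord1 b); constructor.
Qed.

Lemma idxM_eq i j : (idxM N i == idxM N j) = (i == j).
Proof. by rewrite /idxM !eq_lshift. Qed.
Lemma idxH_eq (a b : 'I_N) : (idxH n a == idxH n b) = (a == b).
Proof. by rewrite /idxH eq_lshift eq_rshift. Qed.
Lemma idxMH i b : (idxM N i == idxH n b) = false.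
Proof. by rewrite /idxM /idxH eq_lshift eq_lrshift. Qed.
Lemma idxHM i b : (idxH n b == idxM N i) = false.
Proof. by rewrite eq_sym idxMH. Qed.
Lemma idxM0 i : (idxM N i == idx0 n N) = false.
Proof. by rewrite /idxM /idx0 eq_lrshift. Qed.
Lemma idx0M i : (idx0 n N == idxM N i) = false.
Proof. by rewrite eq_sym idxM0. Qed.
Lemma idxH0 b : (idxH n b == idx0 n N) = false.
Proof. by rewrite /idxH /idx0 eq_lrshift. Qed.
Lemma idx0H b : (idx0 n N == idxH n b) = false.
Proof. by rewrite eq_sym idxH0. Qed.
Definition idx_eqE := (idxM_eq, idxH_eq, idxMH, idxHM, idxM0, idx0M, idxH0, idx0H, eqxx).
End Indices.

(** The middle block is scalar because the coordinates of the ball are conformal. *)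
Definition block3 (F : nzRingType) n N (A : 'M[F]_n) (x y : F) : 'M[F]_(n + N + 1) :=
  block_mx (block_mx A 0 0 x%:M) 0 0 y%:M.

Section Block3.
Variables (F : nzRingType) (n N : nat) (A : 'M[F]_n) (x y : F).
Local Notation B := (block3 N A x y).
Lemma block3MM i j : B (idxM N i) (idxM N j) = A i j.
Proof. by rewrite /B block_mxEul block_mxEul. Qed.
Lemma block3MH i b : B (idxM N i) (idxH n b) = 0.
Proof. by rewrite /B block_mxEul block_mxEur mxE. Qed.
Lemma block3HM i b : B (idxH n b) (idxM N i) = 0.
Proof. by rewrite /B block_mxEul block_mxEdl mxE. Qed.
Lemma block3HH a b : B (idxH n a) (idxH n b) = x *+ (a == b).
Proof. by rewrite /B block_mxEul block_mxEdr mxE. Qed.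
Lemma block3M0 i : B (idxM N i) (idx0 n N) = 0.
Proof. by rewrite /B block_mxEur mxE. Qed.
Lemma block3H0 b : B (idxH n b) (idx0 n N) = 0.
Proof. by rewrite /B block_mxEur mxE. Qed.
Lemma block30M i : B (idx0 n N) (idxM N i) = 0.
Proof. by rewrite /B block_mxEdl mxE. Qed.
Lemma block30H b : B (idx0 n N) (idxH n b) = 0.
Proof. by rewrite /B block_mxEdl mxE. Qed.
Lemma block300 : B (idx0 n N) (idx0 n N) = y.
Proof. by rewrite /B block_mxEdr mxE. Qed.
Definition block3E := (block3MM, block3MH, block3HM, block3HH, block3M0, block3H0,
  block30M, block30H, block300).
End Block3.

Lemma block3_mul (F : comNzRingType) n N (A A' : 'M[F]_n) (x y x' y' : F) :
  block3 N A x y *m block3 N A' x' y' = block3 N (A *m A') (x * x') (y * y').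
Proof.
rewrite /block3 !mulmx_block !(mulmx0, mul0mx, addr0, add0r) !scalar_mxM.
by [].
Qed.

Lemma block3_tr (F : comNzRingType) n N (A : 'M[F]_n) (x y : F) :
  (block3 N A x y)^T = block3 N A^T x y.
Proof. by rewrite /block3 !tr_block_mx !trmx0 !tr_scalar_mx. Qed.

Lemma block3_1 (F : comNzRingType) n N : block3 N (1%:M : 'M[F]_n) 1 1 = 1%:M.
Proof. by rewrite /block3 -!scalar_mx_block. Qed.

(** * Curvature of the product metric *)

(** The identities of the metric [gb + tau * lam * |dy|^2 + phi * dt^2] that its
    curvature depends on. The flow [gb] has Ricci tensor [rb] and scalar curvature
    [s], and [tau] is the time. On the ball [rho] stands for [1 / (1 - |y|^2)],
    [lam] for [8 N rho^2], [psi a] for [2 y_a rho], which is half the logarithmic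
    derivative of [lam], and [c] for [N / 2]; the field [fp_rho_lam] expresses
    that [lam * |dy|^2] has curvature [- 1 / (4 c)]. *)
Record flow_product (F : comNzRingType) (n N : nat) (d : 'I_(n + N + 1) -> F -> F)
  (half : F) (gb gbi rb : 'M[F]_n) (tau taui : F) (psi : 'I_N -> F) (rho lam lami : F)
  (c ci s phi phii : F) : Prop := FlowProduct {
  fp_der : forall a, derivation (d a);
  fp_comm : forall a b x, d a (d b x) = d b (d a x);
  fp_half : half + half = 1;
  fp_gb_tr : gb^T = gb;
  fp_gbiK : gbi *m gb = 1%:M;
  fp_rb_tr : rb^T = rb;
  fp_dH_gb : forall a i j, d (idxH n a) (gb i j) = 0;
  fp_d0_gb : forall i j, d (idx0 n N) (gb i j) = - (rb i j + rb i j);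
  fp_dM_tau : forall i, d (idxM N i) tau = 0;
  fp_dH_tau : forall a, d (idxH n a) tau = 0;
  fp_d0_tau : d (idx0 n N) tau = 1;
  fp_tauK : tau * taui = 1;
  fp_dH_psi : forall a b, d (idxH n a) (psi b) = (rho + rho) * (a == b)%:R + psi a * psi b;
  fp_dM_lam : forall i, d (idxM N i) lam = 0;
  fp_d0_lam : d (idx0 n N) lam = 0;
  fp_dH_lam : forall a, d (idxH n a) lam = (psi a + psi a) * lam;
  fp_lamK : lami * lam = 1;
  fp_psi_norm : \sum_a psi a * psi a = 4%:R * (rho * rho) - 4%:R * rho;
  fp_dc : forall a, d a c = 0;
  fp_cK : c * ci = 1;
  fp_rho_lam : 4%:R * (rho * rho) = half * half * lam * ci;
  fp_dH_s : forall a, d (idxH n a) s = 0;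
  fp_phiE : phi = s - c * taui;
  fp_phiK : phii * phi = 1
}.

Section TildeCurvature.
Variables (F : comNzRingType) (n N : nat).
Local Notation I := 'I_(n + N + 1).
Variables (d : I -> F -> F) (half : F) (gb gbi rb : 'M[F]_n) (tau taui : F).
Variables (psi : 'I_N -> F) (rho lam lami c ci s phi phii : F).
Hypothesis W : flow_product d half gb gbi rb tau taui psi rho lam lami c ci s phi phii.

Local Notation iM := (idxM N).
Local Notation iH := (@idxH n N).
Local Notation i0 := (idx0 n N).

Let dd := fp_der W. Let dC := fp_comm W. Let hh := fp_half W.
Let gbT := fp_gb_tr W. Let gbiK := fp_gbiK W. Let rbT := fp_rb_tr W.
Let dH_gb := fp_dH_gb W. Let d0_gb := fp_d0_gb W.
Let dM_tau := fp_dM_tau W. Let dH_tau := fp_dH_tau W. Let d0_tau := fp_d0_tau W.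
Let tauK := fp_tauK W. Let dH_psi := fp_dH_psi W.
Let dM_lam := fp_dM_lam W. Let d0_lam := fp_d0_lam W. Let dH_lam := fp_dH_lam W.
Let lamK := fp_lamK W. Let psi_norm := fp_psi_norm W. Let dc := fp_dc W. Let cK := fp_cK W.
Let rho_lam := fp_rho_lam W. Let dH_s := fp_dH_s W. Let phiE := fp_phiE W.
Let phiK := fp_phiK W.

Local Notation mu := (tau * lam).
Local Notation G := (block3 N gb mu phi).
Local Notation Gi := (block3 N gbi (taui * lami) phii).
Local Notation db := (fun i => d (iM i)).
Local Notation GLt := (lowered_connection d half G).
Local Notation GLb := (lowered_connection db half gb).
Local Notation Lt := (lowered_curvature d half G Gi).
Local Notation Lb := (lowered_curvature db half gb gbi).
Local Notation chris_prodt := (chris_prod d half G Gi).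

Definition kron (a b : 'I_N) : F := (a == b)%:R.

Lemma kronC a b : kron a b = kron b a. Proof. by rewrite /kron eq_sym. Qed.
Lemma sum_kron a (f : 'I_N -> F) : \sum_b kron a b * f b = f a.
Proof.
rewrite (bigD1 a) //= /kron eqxx mul1r big1 ?addr0 // => b /negPf ba.
by rewrite eq_sym ba mul0r.
Qed.

Lemma G_tr : G^T = G. Proof. by rewrite block3_tr gbT. Qed.
Lemma G_inv : Gi *m G = 1%:M.
Proof.
rewrite block3_mul gbiK phiK (_ : taui * lami * mu = 1) ?block3_1 //.
by rewrite -tauK -[RHS]mul1r -lamK; ring.
Qed.

Lemma GHH a b : G (iH a) (iH b) = mu * kron a b.
Proof. by rewrite block3E /kron mulr_natr. Qed.
Lemma GiHH a b : Gi (iH a) (iH b) = taui * lami * kron a b.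
Proof. by rewrite block3E /kron mulr_natr. Qed.

Let GE := (GHH, block3MM, block3MH, block3HM, block3M0, block3H0, block30M, block30H, block300).
Let GiE := (GiHH, block3MM, block3MH, block3HM, block3M0, block3H0, block30M, block30H, block300).

Lemma d_dl a b e : d a (kron b e) = 0.
Proof. by rewrite /kron; case: (b == e); rewrite ?(der1 (dd _)) ?(der0 (dd _)). Qed.

Lemma d_taui a : d a taui = - (taui * taui * d a tau).
Proof.
have e : d a tau * taui + tau * d a taui = 0 by rewrite -(derM (dd a)) tauK (der1 (dd a)).
have -> : d a taui = taui * (tau * d a taui) by rewrite mulrA (mulrC taui) tauK mul1r.
by move/eqP: e; rewrite addrC addr_eq0 => /eqP ->; ring.
Qed.

Lemma dM_taui i : d (iM i) taui = 0. Proof. by rewrite d_taui dM_tau; ring. Qed.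
Lemma dH_taui a : d (iH a) taui = 0. Proof. by rewrite d_taui dH_tau; ring. Qed.
Lemma d0_taui : d i0 taui = - (taui * taui). Proof. by rewrite d_taui d0_tau; ring. Qed.

Lemma d_phi a : d a phi = d a s - c * d a taui.
Proof. by rewrite phiE (derB (dd a)) (derM (dd a)) dc; ring. Qed.
Lemma dM_phi i : d (iM i) phi = d (iM i) s.
Proof. by rewrite d_phi dM_taui; ring. Qed.
Lemma dH_phi a : d (iH a) phi = 0.
Proof. by rewrite d_phi dH_taui dH_s; ring. Qed.
Lemma d0_phi : d i0 phi = d i0 s + c * (taui * taui).
Proof. by rewrite d_phi d0_taui; ring. Qed.

Lemma dM_mu i : d (iM i) mu = 0.
Proof. by rewrite (derM (dd _)) dM_tau dM_lam; ring. Qed.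
Lemma dH_mu a : d (iH a) mu = (psi a + psi a) * mu.
Proof. by rewrite (derM (dd _)) dH_tau dH_lam; ring. Qed.
Lemma d0_mu : d i0 mu = lam.
Proof. by rewrite (derM (dd _)) d0_tau d0_lam; ring. Qed.

Lemma d_mudl e a b : d e (mu * kron a b) = d e mu * kron a b.
Proof. by rewrite (derM (dd _)) d_dl; ring. Qed.

Lemma half_add x : half * (x + x) = x.
Proof. by rewrite mulrDr -mulrDl hh mul1r. Qed.

Lemma rbS i j : rb i j = rb j i. Proof. by rewrite -{1}rbT mxE. Qed.

Let dE := (dH_gb, d0_gb, dM_mu, dH_mu, d0_mu, dM_phi, dH_phi, d_mudl).

(** Listing the lowered Christoffel symbols by the type of the third index lets
    their contractions be split along the blocks of the metric. *)
Definition chris_is x y (m : 'I_n -> F) (h : 'I_N -> F) (z : F) :=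
  [/\ forall k, GLt x y (iM k) = m k, forall a, GLt x y (iH a) = h a & GLt x y i0 = z].

Definition zfun (k : nat) (_ : 'I_k) : F := 0.

Lemma chris_sym x y m h z : chris_is x y m h z -> chris_is y x m h z.
Proof. by case=> h1 h2 h3; split=> [k|a|]; rewrite (GL_sym _ _ G_tr). Qed.

Lemma chris_MM i j : chris_is (iM i) (iM j) (GLb i j) (@zfun N) (rb i j).
Proof.
split=> [k|a|]; rewrite !GLE !GE ?dE ?(der0 (dd _)) ?subr0 ?addr0 ?mulr0 //.
by rewrite add0r opprK half_add.
Qed.

Lemma chris_MH i a : chris_is (iM i) (iH a) (@zfun n) (@zfun N) 0.
Proof. by split=> [k|b|]; rewrite !GLE !GE ?dE ?(der0 (dd _)) /zfun; ring. Qed.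

Lemma chris_M0 i : chris_is (iM i) i0 (fun k => - rb i k) (@zfun N) (half * d (iM i) s).
Proof.
split=> [k|a|]; rewrite !GLE !GE ?dE ?(der0 (dd _)) /zfun; last 2 first.
- ring.
- ring.
- by rewrite add0r subr0 mulrN half_add.
Qed.

Definition fibre_chris a b e := (psi a * kron b e + psi b * kron a e - psi e * kron a b) * mu.

Lemma chris_HH a b : chris_is (iH a) (iH b) (@zfun n) (fibre_chris a b) (- (half * lam * kron a b)).
Proof.
split=> [k|e|]; rewrite !GLE !GE ?dE ?(der0 (dd _)) /zfun; last first.
- ring.
- by rewrite /fibre_chris -[RHS]half_add; congr (_ * _); ring.
- ring.
Qed.

Lemma chris_H0 a : chris_is (iH a) i0 (@zfun n) (fun b => half * lam * kron a b) 0.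
Proof. by split=> [k|b|]; rewrite !GLE !GE ?dE ?(der0 (dd _)) /zfun; ring. Qed.

Lemma chris_00 : chris_is i0 i0 (fun k => - (half * d (iM k) s)) (@zfun N) (half * d i0 phi).
Proof. by split=> [k|b|]; rewrite !GLE !GE ?dE ?(der0 (dd _)) /zfun; ring. Qed.

Definition ip (m m' : 'I_n -> F) := \sum_a \sum_b m a * gbi a b * m' b.

(** The metric is block diagonal, so the contraction is the sum of a contraction
    on M, one on the fibre and a product in the time direction. *)
Lemma chris_prod_of x y x' y' m h z m' h' z' : chris_is x y m h z -> chris_is x' y' m' h' z' ->
  chris_prodt x y x' y' = ip m m' + taui * lami * (\sum_a h a * h' a) + phii * (z * z').
Proof.
case=> e1 e2 e3 [e1' e2' e3'].
have sM k : \sum_b GLt x y (iM k) * Gi (iM k) b * GLt x' y' b = \sum_j m k * gbi k j * m' j.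
  rewrite sum_tilde GiE mulr0 mul0r addr0 e1 [X in _ + X]big1 ?addr0; last first.
    by move=> b _; rewrite GiE mulr0 mul0r.
  by apply: eq_bigr => j _; rewrite GiE e1'.
have sH k : \sum_b GLt x y (iH k) * Gi (iH k) b * GLt x' y' b = taui * lami * (h k * h' k).
  rewrite sum_tilde GiE mulr0 mul0r addr0 e2 [X in X + _]big1 ?add0r; last first.
    by move=> b _; rewrite GiE mulr0 mul0r.
  rewrite -(sum_kron k (fun a => taui * lami * (h k * h' a))); apply: eq_bigr => j _.
  by rewrite GiE e2'; ring.
have s0 : \sum_b GLt x y i0 * Gi i0 b * GLt x' y' b = phii * (z * z').
  rewrite sum_tilde !GiE e3 e3' !big1 ?add0r; last 2 first.
  - by move=> b _; rewrite GiE mulr0 mul0r.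
  - by move=> b _; rewrite GiE mulr0 mul0r.
  ring.
rewrite /chris_prod sum_tilde s0 (eq_bigr _ (fun k _ => sM k)) (eq_bigr _ (fun k _ => sH k)).
by rewrite -mulr_sumr.
Qed.

Lemma ip0l m : ip (@zfun n) m = 0.
Proof. by rewrite /ip big1 // => a _; rewrite big1 // => b _; rewrite !mul0r. Qed.
Lemma ip0r m : ip m (@zfun n) = 0.
Proof. by rewrite /ip big1 // => a _; rewrite big1 // => b _; rewrite mulr0. Qed.
Lemma hs0l h : \sum_a @zfun N a * h a = 0.
Proof. by rewrite big1 // => a _; rewrite mul0r. Qed.
Lemma hs0r h : \sum_a h a * @zfun N a = 0.
Proof. by rewrite big1 // => a _; rewrite mulr0. Qed.
Lemma hs_dl x a h : \sum_b h b * (x * kron a b) = x * h a.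
Proof. by rewrite -(sum_kron a h) mulr_sumr; apply: eq_bigr => b _; ring. Qed.
Lemma hs_dl' x a h : \sum_b x * kron a b * h b = x * h a.
Proof. by rewrite -(sum_kron a h) mulr_sumr; apply: eq_bigr => b _; ring. Qed.

Let zE := (ip0l, ip0r, hs0l, hs0r, hs_dl, hs_dl', mulr0, mul0r, addr0, add0r).

Lemma hs_fibre_chris a b e f : \sum_x fibre_chris a b x * fibre_chris e f x = mu * mu *
  (psi a * psi e * kron b f + psi a * psi f * kron b e + psi b * psi e * kron a f
   + psi b * psi f * kron a e - (psi a * psi b + psi a * psi b) * kron e f
   - (psi e * psi f + psi e * psi f) * kron a b
   + kron a b * kron e f * (4%:R * (rho * rho) - 4%:R * rho)).
Proof.
pose Y x := psi e * kron f x + psi f * kron e x - psi x * kron e f.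
have pY : \sum_x psi x * Y x = (psi e * psi f + psi e * psi f) -
    kron e f * (4%:R * (rho * rho) - 4%:R * rho).
  transitivity (psi e * (\sum_x kron f x * psi x) + psi f * (\sum_x kron e x * psi x)
     - kron e f * (\sum_x psi x * psi x)).
    rewrite !mulr_sumr -big_split -sumrB; apply: eq_bigr => x _ /=; rewrite /Y; ring.
  rewrite !sum_kron psi_norm; ring.
transitivity (mu * mu * (psi a * (\sum_x kron b x * Y x) + psi b * (\sum_x kron a x * Y x)
   - kron a b * (\sum_x psi x * Y x))).
  rewrite !mulr_sumr -big_split -sumrB mulr_sumr; apply: eq_bigr => x _ /=.
  rewrite /fibre_chris /Y; ring.
rewrite pY !sum_kron /Y (kronC f b) (kronC e b) (kronC f a) (kronC e a); ring.
Qed.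

Local Notation LtE := (L_entry dd dC hh G_tr G_inv).

(** The Gauss equation for the slices of constant time. *)
Lemma Lt_MMMM i j k l : Lt (iM i) (iM j) (iM k) (iM l) =
  Lb i j k l - phii * (rb i k * rb j l) + phii * (rb j k * rb i l).
Proof.
rewrite LtE !GE (chris_prod_of (chris_MM i k) (chris_MM j l)) (chris_prod_of (chris_MM j k)
  (chris_MM i l)) !zE.
rewrite (L_entry (fun i => dd _) (fun i j => dC _ _) hh gbT gbiK).
by rewrite /ip /chris_prod; ring.
Qed.

Local Notation Gamb := (connection db half gb gbi).
Local Notation cov2b := (cov_tensor2 db half gb gbi).
Local Notation hessb := (hessian db half gb gbi).

Lemma ip_Gam i j m : ip (GLb i j) m = \sum_a Gamb i j a * m a.
Proof.
rewrite /ip exchange_big; apply: eq_bigr => a _; rewrite GamE mxE mulr_suml.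
by apply: eq_bigr.
Qed.

Lemma ipC m m' : ip m m' = ip m' m.
Proof.
rewrite /ip exchange_big; apply: eq_bigr => a _; apply: eq_bigr => b _.
by rewrite (gi_sym gbT gbiK a b) /=; ring.
Qed.

Lemma ipNr m m' : ip m (fun a => - m' a) = - ip m m'.
Proof.
rewrite /ip -sumrN; apply: eq_bigr => a _; rewrite -sumrN; apply: eq_bigr => b _.
by rewrite mulrN.
Qed.

Lemma ipZr x m m' : ip m (fun a => x * m' a) = x * ip m m'.
Proof.
rewrite /ip mulr_sumr; apply: eq_bigr => a _; rewrite mulr_sumr; apply: eq_bigr => b _; ring.
Qed.

(** The Codazzi equation: the derivative of the second fundamental form [- rb]
    gives the first two terms, the gradient of the lapse the last one. *)
Lemma Lt_MM0M i j k : Lt (iM i) (iM j) i0 (iM k) =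
  cov2b i rb j k - cov2b j rb i k
  + half * phii * (d (iM j) s * rb i k - d (iM i) s * rb j k).
Proof.
rewrite LtE !GE !dE !(der0 (dd _)) (chris_prod_of (chris_M0 i) (chris_MM j k)) (chris_prod_of
  (chris_M0 j) (chris_MM i k)) !zE.
rewrite !(ipC _ (GLb _ _)) !ipNr !ip_Gam !cov2E.
rewrite !(derN (dd _)) !(derD (dd _)).
have -> : \sum_a Gamb i j a * rb a k = \sum_a Gamb j i a * rb a k.
  by apply: eq_bigr => a _; rewrite (Gam_sym _ _ _ gbT i).
have -> : half * (- (d (iM j) (rb i k) + d (iM j) (rb i k)) - 0 -
   - (d (iM i) (rb j k) + d (iM i) (rb j k))) = d (iM i) (rb j k) - d (iM j) (rb i k).
  by rewrite -[RHS]half_add; congr (_ * _); ring.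
by do 3![move: (\sum_a _) => ?]; ring.
Qed.

(** The second derivative of the metric in time is [- 2 dt rb], the second
    derivatives of [phi] along M are those of [s]; the Christoffel terms turn the
    latter into a Hessian. *)
Lemma Lt_M0M0 i j : Lt (iM i) i0 (iM j) i0 =
  d i0 (rb i j) - half * hessb s i j + ip (rb i) (rb j)
  + phii * (half * half * (d (iM i) s * d (iM j) s) - half * rb i j * d i0 phi).
Proof.
rewrite LtE !GE !dE !(der0 (dd _)) (chris_prod_of (chris_MM i j) chris_00) (chris_prod_of
  (chris_sym (chris_M0 j)) (chris_M0 i)) !zE.
rewrite ipNr ipZr ip_Gam hessE !(derN (dd _)) !(derD (dd _)).
rewrite ipNr [ip _ (rb i)]ipC ipNr opprK.
have -> : half * (d i0 (rb i j) + d i0 (rb i j) - d (iM i) (d (iM j) s)) =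
   d i0 (rb i j) - half * d (iM i) (d (iM j) s).
  by rewrite -[in RHS](half_add (d i0 (rb i j))); ring.
by move: (\sum_a _) (ip _ _) => u v; ring.
Qed.

Lemma dH_d_gb a x i j : d (iH a) (d x (gb i j)) = 0.
Proof. by rewrite dC dH_gb (der0 (dd _)). Qed.
Lemma d_dH_gb a x i j : d x (d (iH a) (gb i j)) = 0.
Proof. by rewrite dH_gb (der0 (dd _)). Qed.
Lemma dH_d_phi a x : d (iH a) (d x phi) = 0.
Proof. by rewrite dC dH_phi (der0 (dd _)). Qed.
Lemma d_dH_phi a x : d x (d (iH a) phi) = 0.
Proof. by rewrite dH_phi (der0 (dd _)). Qed.
Lemma d2_mudl x y a b : d x (d y (mu * kron a b)) = d x (d y mu) * kron a b.
Proof. by rewrite d_mudl (derM (dd _)) d_dl mulr0 addr0. Qed.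
Lemma dM_d_mu i x : d (iM i) (d x mu) = 0.
Proof. by rewrite dC dM_mu (der0 (dd _)). Qed.
Lemma d_dM_mu i x : d x (d (iM i) mu) = 0.
Proof. by rewrite dM_mu (der0 (dd _)). Qed.
Lemma d0_d0_mu : d i0 (d i0 mu) = 0.
Proof. by rewrite d0_mu d0_lam. Qed.
Lemma dH_d0_mu a : d (iH a) (d i0 mu) = (psi a + psi a) * lam.
Proof. by rewrite d0_mu dH_lam. Qed.
Lemma d0_dH_mu a : d i0 (d (iH a) mu) = (psi a + psi a) * lam.
Proof. by rewrite dC dH_d0_mu. Qed.
Lemma dH_dH_mu a b : d (iH a) (d (iH b) mu) =
  mu * (6%:R * (psi a * psi b) + 4%:R * rho * kron a b).
Proof.
rewrite dH_mu (derM (dd _)) (derD (dd _)) dH_psi dH_mu -/(kron a b); ring.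
Qed.

Let d2E := (dH_d_gb, d_dH_gb, dH_d_phi, d_dH_phi, d2_mudl, dM_d_mu, d_dM_mu, d0_d0_mu,
  dH_d0_mu, d0_dH_mu, dH_dH_mu).

(** The fibre metric, without the factor [tau] that it carries in the total
    metric. *)
Definition fibre_form : 'M[F]_(n + N + 1) := block3 N 0 lam 0.

(** For the warping function [f = sqrt tau] of the fibre this is [- f Hess f],
    with the time component simplified by [phi_tau]. *)
Definition base_form : 'M[F]_(n + N + 1) :=
  block_mx (block_mx ((half * phii) *: rb) 0 0 0)
    (col_mx (\col_i (half * half * phii * d (iM i) s)) 0)
    (row_mx (\row_i (half * half * phii * d (iM i) s)) 0)
    (half * half * phii * (d i0 s + s * taui))%:M.
Definition kappa := - (half * half * phii * s * tau * ci).

(** The Kulkarni-Nomizu product of the fibre metric with [base_form], plus a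
    multiple of the curvature tensor of constant curvature. *)
Definition fibre_curv a b e f :=
  kappa * (fibre_form a e * fibre_form b f - fibre_form a f * fibre_form b e)
  + fibre_form a e * base_form b f - fibre_form a f * base_form b e
  - fibre_form b e * base_form a f + fibre_form b f * base_form a e.

Lemma fibre_formHH a b : fibre_form (iH a) (iH b) = lam * kron a b.
Proof. by rewrite /fibre_form block3HH /kron mulr_natr. Qed.
Lemma fibre_formM_ i x : fibre_form (iM i) x = 0.
Proof. by case: (idxP x) => *; rewrite /fibre_form block3E ?mxE. Qed.
Lemma fibre_form_M i x : fibre_form x (iM i) = 0.
Proof. by case: (idxP x) => *; rewrite /fibre_form block3E ?mxE. Qed.
Lemma fibre_form0_ x : fibre_form i0 x = 0.
Proof. by case: (idxP x) => *; rewrite /fibre_form block3E ?mxE. Qed.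
Lemma fibre_form_0 x : fibre_form x i0 = 0.
Proof. by case: (idxP x) => *; rewrite /fibre_form block3E ?mxE. Qed.
Lemma base_formMM i j : base_form (iM i) (iM j) = half * phii * rb i j.
Proof. by rewrite /base_form !block_mxEul mxE. Qed.
Lemma base_formM0 i : base_form (iM i) i0 = half * half * phii * d (iM i) s.
Proof. by rewrite /base_form block_mxEur col_mxEu mxE. Qed.
Lemma base_form0M i : base_form i0 (iM i) = half * half * phii * d (iM i) s.
Proof. by rewrite /base_form block_mxEdl row_mxEl mxE. Qed.
Lemma base_form00 : base_form i0 i0 = half * half * phii * (d i0 s + s * taui).
Proof. by rewrite /base_form block_mxEdr mxE. Qed.
Lemma base_formH_ a x : base_form (iH a) x = 0.
Proof.
case: (idxP x) => [i|b|]; rewrite /base_form.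
- by rewrite block_mxEul block_mxEdl mxE.
- by rewrite block_mxEul block_mxEdr mxE.
- by rewrite block_mxEur col_mxEd mxE.
Qed.
Lemma base_form_H a x : base_form x (iH a) = 0.
Proof.
case: (idxP x) => [i|b|]; rewrite /base_form.
- by rewrite block_mxEul block_mxEur mxE.
- by rewrite block_mxEul block_mxEdr mxE.
- by rewrite block_mxEdl row_mxEr mxE.
Qed.
Let KE := (fibre_formHH, fibre_formM_, fibre_form_M, fibre_form0_, fibre_form_0, base_formMM,
  base_formM0, base_form0M, base_form00, base_formH_, base_form_H).

Lemma fibre_form_sym x y : fibre_form x y = fibre_form y x.
Proof. by case: (idxP x) => *; case: (idxP y) => *; rewrite !KE // kronC. Qed.
Lemma base_form_sym x y : base_form x y = base_form y x.
Proof. by case: (idxP x) => *; case: (idxP y) => *; rewrite !KE // rbS. Qed.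

Lemma fibre_curv_anti x y z w : fibre_curv x y z w = - fibre_curv y x z w.
Proof. rewrite /fibre_curv; ring. Qed.
Lemma fibre_curv_pair x y z w : fibre_curv x y z w = fibre_curv z w x y.
Proof.
rewrite /fibre_curv (fibre_form_sym z x) (fibre_form_sym w y) (fibre_form_sym z y)
  (fibre_form_sym w x).
by rewrite (base_form_sym z x) (base_form_sym w y) (base_form_sym z y) (base_form_sym w x); ring.
Qed.

(** Selects the symbols for given index types, so that the contractions in a
    curvature component need not be written out case by case. *)
Ltac chris_of x y :=
  match x with
  | idxM _ ?i => match y with
    | idxM _ ?j => constr:(chris_MM i j)
    | idxH _ ?b => constr:(chris_MH i b)
    | idx0 _ _ => constr:(chris_M0 i) end
  | idxH _ ?a => match y with
    | idxM _ ?j => constr:(chris_sym (chris_MH j a))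
    | idxH _ ?b => constr:(chris_HH a b)
    | idx0 _ _ => constr:(chris_H0 a) end
  | idx0 _ _ => match y with
    | idxM _ ?j => constr:(chris_sym (chris_M0 j))
    | idxH _ ?b => constr:(chris_sym (chris_H0 b))
    | idx0 _ _ => constr:(chris_00) end
  end.
Ltac chris_prod_simp := repeat match goal with
  | |- context [chris_prod _ _ _ _ ?x ?y ?x' ?y'] =>
    let h := chris_of x y in let h' := chris_of x' y' in rewrite (chris_prod_of h h')
  end.

(** Both terms on the left are of order one in [N]; their leading parts cancel. *)
Lemma phi_tau : phii * d i0 phi + taui = phii * (d i0 s + s * taui).
Proof.
have {1}-> : taui = phii * phi * taui by rewrite phiK mul1r.
rewrite d0_phi phiE; ring.
Qed.

(** The curvature of the fibre and the square of its second fundamental form in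
    the direction of time are of order [1 / N]; their sum is a multiple of [phii /
    N]. The trace over the [N] directions of the fibre needs this. *)
Lemma kappa_eq : - (4%:R * (rho * rho) * mu) - phii * (half * lam * (half * lam)) =
  kappa * (lam * lam).
Proof.
rewrite rho_lam /kappa.
have e : tau * ci + phii = phii * (s * tau * ci).
  have {1}-> : tau * ci = phii * phi * (tau * ci) by rewrite phiK mul1r.
  have -> : phii * phi * (tau * ci) + phii = phii * (s * tau * ci + (1 - (tau * taui) * (c * ci))).
    rewrite phiE; ring.
  by rewrite tauK cK; ring.
have -> : - (half * half * phii * s * tau * ci) * (lam * lam) =
  - (half * half * lam * lam * (phii * (s * tau * ci))) by ring.
rewrite -e; ring.
Qed.

Lemma fibre_contract1 x : taui * lami * (half * lam * (x * mu)) = half * lam * x.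
Proof.
have -> : taui * lami * (half * lam * (x * mu)) = (tau * taui) * (lami * lam) * (half * lam * x).
  ring.
by rewrite tauK lamK !mul1r.
Qed.
Lemma fibre_contract2 x : taui * lami * (half * lam * (half * lam * x)) =
  half * half * taui * lam * x.
Proof. by rewrite -[RHS]mul1r -lamK; ring. Qed.
Lemma fibre_contract3 x : taui * lami * (mu * mu * x) = mu * x.
Proof.
have -> : taui * lami * (mu * mu * x) = (tau * taui) * (lami * lam) * (mu * x) by ring.
by rewrite tauK lamK !mul1r.
Qed.

(** The second fundamental form of the fibre is its metric times a vector that is
    constant along it, so the derivatives [psi] of the conformal factor drop out. *)
Lemma Lt_H a y z w : Lt (iH a) y z w = fibre_curv (iH a) y z w.
Proof.
case: (idxP y) => [j|b|]; case: (idxP z) => [k|e|]; case: (idxP w) => [l|f|];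
  rewrite /fibre_curv !KE; rewrite LtE ?GE; rewrite ?(d2E, der0 (dd _)); chris_prod_simp;
    rewrite ?zE;
  rewrite ?(hs_fibre_chris, mulr0, subr0, sub0r, addr0, add0r, oppr0) //.
- by rewrite (rbS j k); ring.
- ring.
- ring.
- ring.
- rewrite !fibre_contract3.
  have -> : half * (mu * (6%:R * (psi b * psi e) + 4%:R * rho * kron b e) * kron a f -
   mu * (6%:R * (psi b * psi f) + 4%:R * rho * kron b f) * kron a e -
   mu * (6%:R * (psi a * psi e) + 4%:R * rho * kron a e) * kron b f +
   mu * (6%:R * (psi a * psi f) + 4%:R * rho * kron a f) * kron b e) =
   mu * (3%:R * (psi b * psi e) + 2%:R * rho * kron b e) * kron a f -
   mu * (3%:R * (psi b * psi f) + 2%:R * rho * kron b f) * kron a e -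
   mu * (3%:R * (psi a * psi e) + 2%:R * rho * kron a e) * kron b f +
   mu * (3%:R * (psi a * psi f) + 2%:R * rho * kron a f) * kron b e.
    by rewrite -[RHS]half_add; congr (_ * _); ring.
  have -> : kappa * (lam * kron a e * (lam * kron b f) - lam * kron a f * (lam * kron b e)) =
    kappa * (lam * lam) * (kron a e * kron b f - kron a f * kron b e) by ring.
  rewrite -kappa_eq (kronC e b) (kronC e a) (kronC b a); ring.
- rewrite /fibre_chris !fibre_contract1 (kronC e a) (kronC e b) (kronC b a); ring.
- rewrite /fibre_chris !fibre_contract1 (kronC f a) (kronC f b) (kronC b a); ring.
- by rewrite (kronC b a); ring.
- ring.
- ring.
- rewrite /fibre_chris !fibre_contract1 (kronC f e); ring.
- rewrite fibre_contract2 (kronC e a).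
  have -> : lam * kron a e * (half * half * phii * (d i0 s + s * taui)) =
    lam * kron a e * (half * half) * (phii * (d i0 s + s * taui)) by ring.
  rewrite -phi_tau; ring.
- rewrite fibre_contract2.
  have -> : lam * kron a f * (half * half * phii * (d i0 s + s * taui)) =
    lam * kron a f * (half * half) * (phii * (d i0 s + s * taui)) by ring.
  rewrite -phi_tau; ring.
Qed.

Definition isHb (a : I) : bool := [exists b, a == iH b].

Lemma isHb_H b : isHb (iH b). Proof. by apply/existsP; exists b. Qed.
Lemma isHb_M i : isHb (iM i) = false.
Proof. by apply/existsP => -[b]; rewrite idxMH. Qed.
Lemma isHb_0 : isHb i0 = false.
Proof. by apply/existsP => -[b]; rewrite idx0H. Qed.

(** The symmetries of the curvature move the fibre index to the front. *)
Lemma Lt_fibre x y z w : [|| isHb x, isHb y, isHb z | isHb w] -> Lt x y z w = fibre_curv x y z w.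
Proof.
case/or4P => /existsP[b /eqP->].
- exact: Lt_H.
- by rewrite L_antiE Lt_H fibre_curv_anti opprK.
- by rewrite (L_pair dd dC hh G_tr G_inv) Lt_H -fibre_curv_pair.
- by rewrite (L_pair dd dC hh G_tr G_inv) L_antiE Lt_H fibre_curv_anti opprK -fibre_curv_pair.
Qed.

(** * Ricci tensor of the product metric *)

Local Notation Rt := (ricci_mx d half G Gi).

Lemma RtE x y : Rt x y = \sum_k \sum_l gbi k l * Lt x (iM k) y (iM l)
  + taui * lami * (\sum_a Lt x (iH a) y (iH a)) + phii * Lt x i0 y i0.
Proof.
rewrite RicE sum_tilde; congr (_ + _ + _).
- apply: eq_bigr => k _; rewrite sum_tilde GiE mul0r addr0 [X in _ + X]big1 ?addr0 => [|b _].
    by apply: eq_bigr => l _; rewrite GiE.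
  by rewrite GiE mul0r.
- rewrite mulr_sumr; apply: eq_bigr => a _; rewrite sum_tilde GiE mul0r addr0.
  rewrite [X in X + _]big1 ?add0r => [|b _]; last by rewrite GiE mul0r.
  rewrite -(sum_kron a (fun b => taui * lami * Lt x (iH a) y (iH b))).
  by apply: eq_bigr => b _; rewrite GiE; ring.
- rewrite sum_tilde GiE !big1 ?add0r // => b _; by rewrite GiE mul0r.
Qed.

(** On [x] and [y] the form [fibre_form] vanishes, so only products with
    [base_form x y] contribute, equally for each of the [N] directions. *)
Lemma fibre_trace x y : ~~ isHb x -> ~~ isHb y ->
  taui * lami * (\sum_a Lt x (iH a) y (iH a)) = N%:R * taui * base_form x y.
Proof.
move=> hx hy.
have -> : \sum_a Lt x (iH a) y (iH a) = \sum_(a < N) lam * base_form x y.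
  apply: eq_bigr => a _; rewrite Lt_fibre ?isHb_H ?orbT // /fibre_curv.
  have dd1 : kron a a = 1 by rewrite /kron eqxx.
  by case: (idxP x) hx => [i|b|]; rewrite ?isHb_H // => _;
     case: (idxP y) hy => [j|b|]; rewrite ?isHb_H // => _;
     rewrite !KE dd1; ring.
rewrite sumr_const card_ord -[(lam * _) *+ N]mulr_natl.
have -> : taui * lami * (N%:R * (lam * base_form x y)) = lami * lam * (N%:R * taui * base_form x
  y) by ring.
by rewrite lamK mul1r.
Qed.

Lemma Rt_MM i j : Rt (iM i) (iM j) = \sum_k \sum_l gbi k l * Lt (iM i) (iM k) (iM j) (iM l)
  + N%:R * taui * (half * phii * rb i j) + phii * Lt (iM i) i0 (iM j) i0.
Proof. by rewrite RtE fibre_trace ?isHb_M // base_formMM. Qed.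

Lemma Rt_M0 i : Rt (iM i) i0 = \sum_k \sum_l gbi k l * Lt (iM i) (iM k) i0 (iM l)
  + N%:R * taui * (half * half * phii * d (iM i) s).
Proof.
rewrite RtE fibre_trace ?isHb_M ?isHb_0 // base_formM0 (L_anti2 dd dC hh G_tr G_inv).
have -> : Lt (iM i) i0 i0 i0 = 0.
  have e := L_anti2 dd dC hh G_tr G_inv (iM i) i0 i0 i0.
  by rewrite -[LHS]half_add {2}e subrr mulr0.
by rewrite oppr0 mulr0 addr0.
Qed.

Lemma Rt_00 : Rt i0 i0 = \sum_k \sum_l gbi k l * Lt i0 (iM k) i0 (iM l)
  + N%:R * taui * (half * half * phii * (d i0 s + s * taui)).
Proof.
rewrite RtE fibre_trace ?isHb_0 // base_form00.
have -> : Lt i0 i0 i0 i0 = 0.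
  have e := L_anti2 dd dC hh G_tr G_inv i0 i0 i0 i0.
  by rewrite -[LHS]half_add {2}e subrr mulr0.
by rewrite mulr0 addr0.
Qed.

Lemma Rt_H_ a x : Rt (iH a) x = fibre_form (iH a) x *
  (\sum_k \sum_l gbi k l * base_form (iM k) (iM l) + phii * base_form i0 i0
   + taui * kappa * (N%:R - 1)).
Proof.
rewrite RtE.
have -> : \sum_k \sum_l gbi k l * Lt (iH a) (iM k) x (iM l) =
   fibre_form (iH a) x * \sum_k \sum_l gbi k l * base_form (iM k) (iM l).
  rewrite mulr_sumr; apply: eq_bigr => k _; rewrite mulr_sumr; apply: eq_bigr => l _.
  by rewrite Lt_H /fibre_curv !KE; ring.
have -> : \sum_b Lt (iH a) (iH b) x (iH b) = kappa * lam * (N%:R - 1) * fibre_form (iH a) x.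
  have -> : \sum_b Lt (iH a) (iH b) x (iH b) = \sum_(b < N) kappa * lam * fibre_form (iH a) x
     - kappa * lam * \sum_b kron a b * fibre_form (iH b) x.
    rewrite mulr_sumr -sumrB; apply: eq_bigr => b _.
    rewrite Lt_H /fibre_curv !KE; have -> : kron b b = 1 by rewrite /kron eqxx.
    ring.
  by rewrite sum_kron sumr_const card_ord -[(_ * fibre_form _ _) *+ N]mulr_natl; ring.
rewrite Lt_H /fibre_curv !KE.
have -> : taui * lami * (kappa * lam * (N%:R - 1) * fibre_form (iH a) x) =
   lami * lam * (taui * (kappa * (N%:R - 1) * fibre_form (iH a) x)) by ring.
rewrite lamK; ring.
Qed.
End TildeCurvature.

(** * Pullback of functions and the coordinates of the product *)

Section CoordMaps.
Context {R : realType}.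

Lemma coord_map_cvg (m k : nat) (f : 'rV[R]_m -> 'rV[R]_k) (s : 'I_k -> 'I_m) p :
  (forall r j, f r 0 j = r 0 (s j)) -> f r @[r --> p] --> f p.
Proof.
move=> fE V /nbhs_ballP[e e0 he]; apply/nbhs_ballP; exists e => // r pr.
by apply: he; split=> // i j; rewrite (ord1 i) !fE; case: pr => _; apply.
Qed.
End CoordMaps.

(** Functions on space-time are pulled back to the product along the projection
    [pr]; [ax] gives the coordinate of the target that a coordinate direction
    projects to, if any. *)
Section Pullback.
Context {R : realType} {m m' : nat}.
Variables (D' : set 'rV[R]_m') (D : set 'rV[R]_m).
Variables (pr : 'rV[R]_m' -> 'rV[R]_m) (ax : 'I_m' -> option 'I_m).
Hypothesis lD' : lower_open D'.
Hypothesis pr_cont : forall p, pr r @[r --> p] --> pr p.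
Hypothesis pr_dom : forall p, D' p -> D (pr p).
Hypothesis pr_some : forall a b, ax a = Some b ->
  forall (h : R) p, pr (h *: basis_vec a + p) = h *: basis_vec b + pr p.
Hypothesis pr_none : forall a, ax a = None ->
  forall (h : R) p, pr (h *: basis_vec a + p) = pr p.
Hypothesis pr_loc : forall a b p, ax a = Some b -> D' p ->
  \forall h \near (0 : R), D' (h *: basis_vec a + p) <-> D (h *: basis_vec b + pr p).
Implicit Types (f : 'rV[R]_m -> R).

Lemma pull_is_partial a b f p l : ax a = Some b -> D' p ->
  is_partial D b f (pr p) l -> is_partial D' a (f \o pr) p l.
Proof.
move=> ab Dp fl; rewrite /is_partial.
have -> : diff_quot a (f \o pr) p = diff_quot b f (pr p).
  by apply/funext => h; rewrite /diff_quot /= (pr_some ab).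
suff -> : admissible D' a p = admissible D b (pr p) by exact: fl.
have n0 := nbhs_dnbhs (pr_loc ab Dp).
by apply/seteqP; split=> V; rewrite /admissible /within /= => HV;
  apply: filterS2 HV n0 => h h1 h2 h3; apply: h1; apply/h2.
Qed.

Lemma pull_is_partial0 a f p : ax a = None -> is_partial D' a (f \o pr) p 0.
Proof.
move=> aN; have C : (fun=> 0 : R) @ admissible D' a p --> (0 : R).
  by have F := admissible_filter D' a p; exact: cvg_cst.
rewrite /is_partial (_ : diff_quot a (f \o pr) p = fun=> 0) //.
by apply/funext => h; rewrite /diff_quot /= pr_none // subrr mulr0.
Qed.

Lemma pull_cont f : {within D, continuous f} -> {within D', continuous (f \o pr)}.
Proof.
move=> /within_contP fc; apply/within_contP => p Dp V HV.
have nV : \forall r \near p, D (pr r) -> V (f (pr r)).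
  exact: pr_cont (fc _ (pr_dom Dp) _ HV).
rewrite /= /within /=; apply: filterS nV => r h1 h2; apply: h1; exact: pr_dom.
Qed.

Lemma pull_Ck k f : Ck D k f -> Ck D' k (f \o pr).
Proof.
elim: k f => [|k IH] f cf; first by split=> //; exact: pull_cont (Ck_cont cf).
have Hc := pull_cont (Ck_cont cf).
apply: (@Ck_step _ _ _ _ _ (fun a => if ax a is Some b then partial D b f \o pr else fun=> 0)) =>
  //.
  move=> a p Dp; case E : (ax a) => [b|]; last exact: pull_is_partial0.
  exact: pull_is_partial E Dp (Ck_is_partial cf (pr_dom Dp)).
move=> a; case: (ax a) => [b|]; last exact: Ck_cst.
by apply: IH; exact: Ck_partial.
Qed.

Lemma pull_smooth f : smooth_on D f -> smooth_on D' (f \o pr).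
Proof. by move=> /smooth_Ck cf; apply/smooth_Ck => k; exact: pull_Ck. Qed.
End Pullback.

Section TildeCoordinates.
Context {R : realType} {n N : nat}.
Implicit Types (p r : 'rV[R]_(n + N + 1)) (x : 'rV[R]_n) (y : 'rV[R]_N) (t h : R).

Lemma tspaceE p i : tspace p 0 i = p 0 (idxM N i).
Proof. by rewrite /tspace !mxE. Qed.
Lemma thypE p a : thyp p 0 a = p 0 (idxH n a).
Proof. by rewrite /thyp !mxE. Qed.
Lemma ttimeE p : ttime p = p 0 (idx0 n N).
Proof. by rewrite /ttime !mxE. Qed.

Lemma tpointM x y t i : tpoint x y t 0 (idxM N i) = x 0 i.
Proof. by rewrite /tpoint row_mxEl row_mxEl. Qed.
Lemma tpointH x y t a : tpoint x y t 0 (idxH n a) = y 0 a.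
Proof. by rewrite /tpoint row_mxEl row_mxEr. Qed.
Lemma tpoint0 x y t : tpoint x y t 0 (idx0 n N) = t.
Proof. by rewrite /tpoint row_mxEr mxE. Qed.

Lemma rV_tilde_eq p r : tspace p = tspace r -> thyp p = thyp r -> ttime p = ttime r -> p = r.
Proof.
move=> /rowP h1 /rowP h2; rewrite !ttimeE => h3; apply/rowP => a.
by case: (idxP a) => [i|b|] //; [have := h1 i; rewrite !tspaceE | have := h2 b; rewrite !thypE].
Qed.

Lemma tspace_tpoint x y t : tspace (tpoint x y t) = x.
Proof. by apply/rowP => i; rewrite tspaceE tpointM. Qed.
Lemma thyp_tpoint x y t : thyp (tpoint x y t) = y.
Proof. by apply/rowP => i; rewrite thypE tpointH. Qed.
Lemma ttime_tpoint x y t : ttime (tpoint x y t) = t.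
Proof. by rewrite ttimeE tpoint0. Qed.
Lemma tpoint_eta p : tpoint (tspace p) (thyp p) (ttime p) = p.
Proof. by apply: rV_tilde_eq; rewrite ?tspace_tpoint ?thyp_tpoint ?ttime_tpoint. Qed.

Lemma shiftE (m : nat) (a b : 'I_m) h (p : 'rV[R]_m) :
  (h *: basis_vec a + p) 0 b = h * (a == b)%:R + p 0 b.
Proof. by rewrite mxE mxE basis_vecE. Qed.

Lemma tspace_M i h p : tspace (h *: basis_vec (idxM N i) + p) = h *: basis_vec i + tspace p.
Proof. by apply/rowP => j; rewrite tspaceE !shiftE idxM_eq tspaceE. Qed.
Lemma tspace_H a h p : tspace (h *: basis_vec (idxH n a) + p) = tspace p.
Proof. by apply/rowP => j; rewrite !tspaceE !shiftE idxHM mulr0 add0r. Qed.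
Lemma tspace_0 h p : tspace (h *: basis_vec (idx0 n N) + p) = tspace p.
Proof. by apply/rowP => j; rewrite !tspaceE !shiftE idx0M mulr0 add0r. Qed.
Lemma thyp_M i h p : thyp (h *: basis_vec (idxM N i) + p) = thyp p.
Proof. by apply/rowP => j; rewrite !thypE !shiftE idxMH mulr0 add0r. Qed.
Lemma thyp_0 h p : thyp (h *: basis_vec (idx0 n N) + p) = thyp p.
Proof. by apply/rowP => j; rewrite !thypE !shiftE idx0H mulr0 add0r. Qed.
Lemma ttime_M i h p : ttime (h *: basis_vec (idxM N i) + p) = ttime p.
Proof. by rewrite !ttimeE !shiftE idxM0 mulr0 add0r. Qed.
Lemma ttime_H a h p : ttime (h *: basis_vec (idxH n a) + p) = ttime p.
Proof. by rewrite !ttimeE !shiftE idxH0 mulr0 add0r. Qed.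
Lemma ttime_0 h p : ttime (h *: basis_vec (idx0 n N) + p) = h + ttime p.
Proof. by rewrite !ttimeE !shiftE eqxx mulr1. Qed.

Lemma tspace_cvg p : tspace r @[r --> p] --> tspace p.
Proof. by apply: coord_map_cvg; exact: tspaceE. Qed.
Lemma ttime_cvg p : ttime r @[r --> p] --> ttime p.
Proof.
rewrite (_ : @ttime R n N = fun r => r 0 (idx0 n N)); first exact: coord_continuous.
by apply/funext => r; exact: ttimeE.
Qed.

(** The components of the flow are smooth functions on U x ]0, T], with
    coordinates [n + 1]; on the product they are read through this projection. *)
Definition forgetH p : 'rV[R]_(n + 1) := row_mx (tspace p) (const_mx (ttime p)).
Definition axis (a : 'I_(n + N + 1)) : option 'I_(n + 1) :=
  match fintype.split a with
  | inl b => if fintype.split b is inl i then Some (lshift 1 i) else None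
  | inr _ => Some (rshift n ord0)
  end.
Lemma axisM i : axis (idxM N i) = Some (lshift 1 i).
Proof. by rewrite /axis (unsplitK (inl _)) (unsplitK (inl _)). Qed.
Lemma axisH a : axis (idxH n a) = None.
Proof. by rewrite /axis (unsplitK (inl _)) (unsplitK (inr _)). Qed.
Lemma axis0 : axis (idx0 n N) = Some (rshift n ord0).
Proof. by rewrite /axis (unsplitK (inr _)). Qed.

Lemma forgetH_cvg p : forgetH r @[r --> p] --> forgetH p.
Proof.
pose s (j : 'I_(n + 1)) : 'I_(n + N + 1) :=
  match fintype.split j with inl i => idxM N i | inr _ => idx0 n N end.
apply: (@coord_map_cvg _ _ _ _ s) => r j; rewrite /s -{1}(@splitK n 1 j).
case: (@fintype.split n 1 j) => i /=; first by rewrite row_mxEl tspaceE.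
by rewrite row_mxEr mxE ttimeE.
Qed.

Lemma forgetH_lsub p : lsubmx (forgetH p) = tspace p. Proof. exact: row_mxKl. Qed.
Lemma forgetH_rsub p : rsubmx (forgetH p) 0 0 = ttime p.
Proof. by rewrite row_mxKr mxE. Qed.

Lemma forgetH_none a : axis a = None -> forall h p, forgetH (h *: basis_vec a + p) = forgetH p.
Proof.
case: (idxP a) => [i|b|]; rewrite ?axisM ?axis0 // => _ h p.
by rewrite /forgetH tspace_H ttime_H.
Qed.

Lemma forgetH_some a b : axis a = Some b ->
  forall h p, forgetH (h *: basis_vec a + p) = h *: basis_vec b + forgetH p.
Proof.
case: (idxP a) => [i|e|]; rewrite ?axisM ?axis0 ?axisH // => -[<-] h p; apply/rowP => j;
  rewrite shiftE -(@splitK n 1 j); case: (@fintype.split n 1 j) => k /=.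
- by rewrite !row_mxEl tspace_M shiftE (inj_eq (@lshift_inj _ _)).
- by rewrite !row_mxEr !mxE ttime_M eq_lrshift mulr0 add0r.
- by rewrite !row_mxEl tspace_0 eq_rlshift mulr0 add0r.
- by rewrite !row_mxEr !mxE ttime_0 eq_rshift (ord1 k) eqxx mulr1.
Qed.
End TildeCoordinates.

(** * Multilinear forms and matrices of smooth functions *)

Lemma pos_def_unit (R : realType) (m : nat) (G : 'M[R]_m) : pos_def G -> G \in unitmx.
Proof.
move=> pG; rewrite -row_free_unit -kermx_eq0; apply/rowV0P => v /sub_kermxP vG.
apply/eqP; apply: contraT => v0; have := pG v v0.
by rewrite vG mul0mx mxE ltxx.
Qed.

Section Multilinear.
Context {R : realType} {m : nat}.
Implicit Types (u v w z : 'rV[R]_m) (A B : 'I_m -> 'I_m -> R).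
Definition bil u w A : R := \sum_a \sum_b u 0 a * w 0 b * A a b.
Definition quadrilinear u v w z (K : 'I_m -> 'I_m -> 'I_m -> 'I_m -> R) : R :=
  \sum_a \sum_i \sum_b \sum_l u 0 a * v 0 i * w 0 b * z 0 l * K a i b l.

Lemma quad_ext u v w z K K' :
  (forall a i b l, u 0 a * v 0 i * w 0 b * z 0 l * K a i b l =
                   u 0 a * v 0 i * w 0 b * z 0 l * K' a i b l) ->
  quadrilinear u v w z K = quadrilinear u v w z K'.
Proof.
by move=> KK; apply: eq_bigr => a _; apply: eq_bigr => i _; apply: eq_bigr => b _;
  apply: eq_bigr => l _.
Qed.

Lemma quadD u v w z K K' : quadrilinear u v w z (fun a i b l => K a i b l + K' a i b l) =
  quadrilinear u v w z K + quadrilinear u v w z K'.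
Proof.
rewrite /quadrilinear -big_split; apply: eq_bigr => a _ /=; rewrite -big_split.
apply: eq_bigr => i _ /=; rewrite -big_split; apply: eq_bigr => b _ /=; rewrite -big_split.
by apply: eq_bigr => l _ /=; rewrite mulrDr.
Qed.

Lemma quadZ u v w z x K : quadrilinear u v w z (fun a i b l => x * K a i b l) =
  x * quadrilinear u v w z K.
Proof.
rewrite /quadrilinear mulr_sumr; apply: eq_bigr => a _ /=; rewrite mulr_sumr.
apply: eq_bigr => i _ /=; rewrite mulr_sumr; apply: eq_bigr => b _ /=; rewrite mulr_sumr.
by apply: eq_bigr => l _ /=; rewrite mulrCA.
Qed.

Lemma quad_prod1 u v w z A B : quadrilinear u v w z (fun a i b l => A a b * B i l) =
  bil u w A * bil v z B.
Proof.
rewrite /bil mulr_suml; apply: eq_bigr => a _; rewrite exchange_big mulr_suml.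
apply: eq_bigr => b _ /=; rewrite mulr_sumr; apply: eq_bigr => i _ /=.
by rewrite mulr_sumr; apply: eq_bigr => l _; ring.
Qed.

Lemma bil_swap u w A : bil u w A = bil w u (fun b a => A a b).
Proof. by rewrite /bil exchange_big; apply: eq_bigr => b _; apply: eq_bigr => a _; ring. Qed.

Lemma quad_swap u v w z K : quadrilinear u v w z K =
  quadrilinear u v z w (fun a i l b => K a i b l).
Proof.
apply: eq_bigr => a _; apply: eq_bigr => i _; rewrite exchange_big.
by apply: eq_bigr => l _; apply: eq_bigr => b _; ring.
Qed.

Lemma quad_prod2 u v w z A B : quadrilinear u v w z (fun a i b l => A a l * B i b) =
  bil u z A * bil v w B.
Proof. by rewrite quad_swap quad_prod1. Qed.

Lemma bil_basis a b A : bil (basis_vec a) (basis_vec b) A = A a b.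
Proof.
rewrite /bil; under eq_bigr do under eq_bigr do rewrite -mulrA.
under eq_bigr do rewrite -mulr_sumr sum_basis.
by rewrite sum_basis.
Qed.
End Multilinear.

Lemma S_prod (R : realType) (m : nat) (D : domain R m) (I : Type) (r : seq I) (P : pred I)
  (F : I -> smooth_fun D) p : dset D p ->
  (\prod_(i <- r | P i) F i) p = \prod_(i <- r | P i) F i p.
Proof.
move=> Dp; elim: r => [|i r IH]; first by rewrite !big_nil S1.
by rewrite !big_cons; case: (P i) => //; rewrite SM IH.
Qed.

Lemma S_det (R : realType) (m k : nat) (D : domain R m) (G : 'M[smooth_fun D]_k) p :
  dset D p -> (\det G) p = \det (\matrix_(i, j) G i j p).
Proof.
move=> Dp; rewrite /determinant S_sum; apply: eq_bigr => s _.
rewrite SM S_prod //; congr (_ * _); last by apply: eq_bigr => i _; rewrite mxE.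
by case: (perm.odd_perm s); rewrite ?expr1 ?expr0 ?SN S1.
Qed.

(** * Bounds on the flow at one time *)

(** The time derivative of the scalar curvature along the flow ([s0_val]), written
    with quantities of the fixed time [t] so that the bounds refer to one time. *)
Definition dt_scal (R : realType) (n : nat) (D : set 'rV[R]_n) (G : 'rV[R]_n -> 'M[R]_n)
    (t : R) (q : 'rV[R]_n) : R :=
  2 * \sum_k \sum_l ginv G q k l *
    (harnackM D G t k l q - (2 * t)^-1 * Ric_comp D G k l q).

Section FlowBound.
Context {R : realType} {n : nat}.
Variables (D : set 'rV[R]_n) (G : 'rV[R]_n -> 'M[R]_n) (t : R) (q : 'rV[R]_n).
Local Notation r i j := (Ric_comp D G i j q).
Local Notation gi i j := (ginv G q i j).
Local Notation sR := (scal D G q).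
Local Notation Ds i := (partial D i (scal D G) q).

(** The coefficient of [1 / phi] in the component [i 0 j 0]. *)
Definition harnack_corr i j : R :=
  4^-1 * Ds i * Ds j - 2^-1 * r i j * (dt_scal D G t q + sR / t).

(** The list collects what multiplies [1 / phi] in the components of the curvature
    and of the Ricci tensor. *)
Definition flow_bound (B : R) : Prop :=
  [/\ forall i j k l, `|r j k * r i l - r i k * r j l| <= B,
      forall i j k, `|2^-1 * (Ds j * r i k - Ds i * r j k)| <= B,
      forall i j, `|harnack_corr i j| <= B,
      forall i j, `|(\sum_k \sum_l gi k l * (r k j * r i l)) + harnackM D G t i j q| <= B &
      [/\ forall i, `|2^-1 * \sum_k \sum_l gi k l * (Ds k * r i l)| <= B,
      `|4^-1 * \sum_k \sum_l gi k l * (Ds k * Ds l)| <= B,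
      forall i j, `|2^-1 * r i j| <= B,
      forall i, `|4^-1 * Ds i| <= B &
      [/\ `|4^-1 * (dt_scal D G t q + sR / t)| <= B, `|2^-1 * sR| <= B &
      `|2^-1 * (sR * t)| <= B]]].

Lemma fin_bound (I : finType) (f : I -> R) : exists B, 0 <= B /\ forall i, `|f i| <= B.
Proof.
exists (\sum_i `|f i|); split; first by apply: sumr_ge0 => i _.
by move=> i; rewrite (bigD1 i) //= lerDl sumr_ge0.
Qed.

Lemma flow_bound_ex : exists B, flow_bound B.
Proof.
have [b1 [p1 h1]] := fin_bound (fun x : 'I_n * 'I_n * ('I_n * 'I_n) =>
  r x.1.2 x.2.1 * r x.1.1 x.2.2 - r x.1.1 x.2.1 * r x.1.2 x.2.2).
have [b2 [p2 h2]] := fin_bound (fun x : 'I_n * 'I_n * 'I_n =>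
  2^-1 * (Ds x.1.2 * r x.1.1 x.2 - Ds x.1.1 * r x.1.2 x.2)).
have [b3 [p3 h3]] := fin_bound (fun x : 'I_n * 'I_n => harnack_corr x.1 x.2).
have [b4 [p4 h4]] := fin_bound (fun x : 'I_n * 'I_n =>
  (\sum_k \sum_l gi k l * (r k x.2 * r x.1 l)) + harnackM D G t x.1 x.2 q).
have [b5 [p5 h5]] := fin_bound (fun i : 'I_n => 2^-1 * \sum_k \sum_l gi k l * (Ds k * r i l)).
have [b6 [p6 h6]] := fin_bound (fun x : 'I_n * 'I_n => 2^-1 * r x.1 x.2).
have [b7 [p7 h7]] := fin_bound (fun i : 'I_n => 4^-1 * Ds i).
pose c1 := `|4^-1 * \sum_k \sum_l gi k l * (Ds k * Ds l)|.
pose c2 := `|4^-1 * (dt_scal D G t q + sR / t)|.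
pose c3 := `|2^-1 * sR|.
pose c4 := `|2^-1 * (sR * t)|.
have q1 : 0 <= c1 by exact: normr_ge0.
have q2 : 0 <= c2 by exact: normr_ge0.
have q3 : 0 <= c3 by exact: normr_ge0.
have q4 : 0 <= c4 by exact: normr_ge0.
pose B := b1 + b2 + b3 + b4 + b5 + b6 + b7 + c1 + c2 + c3 + c4.
have [l1 l2 l3 [l4 l5 l6 l7]] : [/\ b1 <= B, b2 <= B, b3 <= B &
    [/\ b4 <= B, b5 <= B, b6 <= B & b7 <= B]] by rewrite /B; do ![split]; lra.
have [m1 m2 m3 m4] : [/\ c1 <= B, c2 <= B, c3 <= B & c4 <= B] by rewrite /B; split; lra.
exists B; split; last split; last split.
- by move=> i j k l; apply: le_trans l1; exact: h1 (i, j, (k, l)).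
- by move=> i j k; apply: le_trans l2; exact: h2 (i, j, k).
- by move=> i j; apply: le_trans l3; exact: h3 (i, j).
- by move=> i j; apply: le_trans l4; exact: h4 (i, j).
- by move=> i; apply: le_trans l5; exact: h5.
- exact: m1.
- by move=> i j; apply: le_trans l6; exact: h6 (i, j).
- by move=> i; apply: le_trans l7; exact: h7.
- exact: m2.
- exact: m3.
- exact: m4.
Qed.
End FlowBound.

(** * The product metric over the ring of smooth functions *)

(** The domain [D] is a subset of the product that is a neighbourhood of each of
    its points in it. It is used twice: for the whole product, where [phi] is
    found to be smooth, and for the part on which [phi] is negative, where the
    metric is invertible. *)
Section TildeRing.
Context {R : realType} {n : nat} {M : topologicalType}.
Variables (A : set (chart R n M)) (T : R) (g : chart R n M -> R -> 'rV[R]_n -> 'M[R]_n).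
Hypotheses (hA : smooth_manifold A) (hg : smooth_metric_family A T g) (hflow : ricci_flow A T g).
Variables (c : chart R n M) (hc : A c) (N : nat).
Variable D : domain R (n + N + 1).
Hypothesis Dsub : forall p, dset D p -> tilde_dom T c p.
Hypothesis Dloc : forall p, dset D p -> \forall r \near p, tilde_dom T c r -> dset D r.
Local Notation S := (smooth_fun D).
Let lD : lower_open (dset D) := @domain_lower_open _ _ D.

Lemma Dloc_shift a p : dset D p -> \forall h \near (0 : R),
  tilde_dom T c (h *: basis_vec a + p) -> dset D (h *: basis_vec a + p).
Proof. by move=> Dp; exact: translate_cvg (Dloc Dp). Qed.

Lemma D_spacetime p : dset D p -> spacetime_dom T c (forgetH p).
Proof. by move=> /Dsub[h1 _ h3]; rewrite /spacetime_dom /= forgetH_lsub forgetH_rsub. Qed.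

Lemma D_forget_loc a b p : axis a = Some b -> dset D p -> \forall h \near (0 : R),
  dset D (h *: basis_vec a + p) <-> spacetime_dom T c (h *: basis_vec b + forgetH p).
Proof.
move=> ab Dp; apply: filterS (Dloc_shift a Dp) => h hD.
rewrite -(forgetH_some ab); split; first exact: D_spacetime.
rewrite /spacetime_dom /= forgetH_lsub forgetH_rsub => -[h1 h2]; apply: hD; split=> //.
have [_ hb _] := Dsub Dp.
suff -> : thyp (h *: basis_vec a + p) = thyp p by [].
case: (idxP a) ab => [i|e|]; first by rewrite thyp_M.
  by rewrite axisH.
by rewrite thyp_0.
Qed.

Lemma pull_spacetime F : smooth_on (spacetime_dom T c) F -> smooth_on (dset D) (F \o forgetH).
Proof.
apply: (pull_smooth (ax := axis)) => //.
- exact: forgetH_cvg.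
- exact: D_spacetime.
- by move=> a b ab h p; exact: forgetH_some.
- by move=> a an h p; exact: forgetH_none.
- exact: D_forget_loc.
Qed.

Lemma g_smooth i j : smooth_on (dset D) (fun p => g c (ttime p) (tspace p) i j).
Proof.
have [_ h _] := hg; apply: smooth_ext (pull_spacetime (h c i j hc)) => p _.
by rewrite /on_spacetime /= forgetH_lsub forgetH_rsub.
Qed.

Lemma g_props p : dset D p -> (g c (ttime p) (tspace p))^T = g c (ttime p) (tspace p) /\
  pos_def (g c (ttime p) (tspace p)).
Proof. by move=> /Dsub[h1 _ h3]; have [h _ _] := hg; exact: h. Qed.

Definition gS : 'M[S]_n := \matrix_(i, j) mkS (g_smooth i j).

Lemma gSE p i j : dset D p -> gS i j p = g c (ttime p) (tspace p) i j.
Proof. by move=> Dp; rewrite mxE mkSE. Qed.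

Lemma gS_tr : gS^T = gS.
Proof.
apply/matrixP => i j; rewrite mxE; apply: S_eq => p Dp; rewrite !gSE //.
by have [e _] := g_props Dp; rewrite -{1}e mxE.
Qed.

Lemma det_gS p : dset D p -> (\det gS) p != 0.
Proof.
move=> Dp; rewrite S_det // (_ : \matrix_(i, j) _ = g c (ttime p) (tspace p)); last first.
  by apply/matrixP => i j; rewrite mxE gSE.
by have [_ /pos_def_unit] := g_props Dp; rewrite unitmxE unitfE.
Qed.

(** The adjugate formula, as inverting the determinant is all that is needed to
    invert a matrix over the ring. *)
Definition giS : 'M[S]_n := sval (S_inv det_gS) *: \adj gS.

Lemma giS_mul : giS *m gS = 1%:M.
Proof.
rewrite /giS -scalemxAl mul_adj_mx; case: (S_inv det_gS) => v /= dv.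
by rewrite scale_scalar_mx mulrC dv.
Qed.

Local Notation db := (fun i => @Spart R _ D (idxM N i)).
Local Notation RicS := (ricci_mx db (Shalf D) gS giS).
Local Notation ScalS := (metric_trace giS RicS).
Let dd a : derivation (@Spart R _ D a) := Spart_derivation D a.
Let dC a b x : Spart a (Spart b x) = Spart b (Spart a x) := @Spart_comm R _ D a b x.
Let hh : Shalf D + Shalf D = 1 := Shalf_dbl D.

Section Slice.
Variables (y : 'rV[R]_N) (t : R).
Let io (q : 'rV[R]_n) : 'rV[R]_(n + N + 1) := tpoint q y t.

Lemma io_basis i (h : R) (q : 'rV[R]_n) :
  io (h *: basis_vec i + q) = h *: basis_vec (idxM N i) + io q.
Proof.
by apply: rV_tilde_eq; rewrite ?tspace_M ?thyp_M ?ttime_M /io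
  ?tspace_tpoint ?thyp_tpoint ?ttime_tpoint.
Qed.

Lemma io_dom i (q : 'rV[R]_n) : dset D (io q) -> \forall h \near (0 : R),
  chart_img c (h *: basis_vec i + q) <-> dset D (h *: basis_vec (idxM N i) + io q).
Proof.
move=> Dq; apply: filterS (Dloc_shift (idxM N i) Dq) => h hD.
have [_ h2 h3] := Dsub Dq; rewrite -io_basis in hD *.
split=> [h1|]; last by move=> /Dsub[]; rewrite /io tspace_tpoint.
apply: hD; split; rewrite /io ?tspace_tpoint ?thyp_tpoint ?ttime_tpoint //.
  by move: h2; rewrite /io thyp_tpoint.
by move: h3; rewrite /io ttime_tpoint.
Qed.

Lemma io_g i j : rep io (fun q => g c t q i j) (gS i j).
Proof. by move=> q Dq; rewrite gSE // /io tspace_tpoint ttime_tpoint. Qed.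
End Slice.

(** The slice through [p] at time [ttime p] carries the metric of the flow at that
    time. *)
Lemma RicS_val p i j : dset D p ->
  RicS i j p = Ric_comp (chart_img c) (g c (ttime p)) i j (tspace p).
Proof.
move=> Dp; rewrite (rep_Ric_comp (@io_basis (thyp p) (ttime p)) (@io_dom (thyp p) (ttime p))
  (@io_g (thyp p) (ttime p)) gS_tr giS_mul) tpoint_eta //.
Qed.

Lemma ScalS_val p : dset D p ->
  ScalS p = scal (chart_img c) (g c (ttime p)) (tspace p).
Proof.
move=> Dp; rewrite (rep_scal (@io_basis (thyp p) (ttime p)) (@io_dom (thyp p) (ttime p))
  (@io_g (thyp p) (ttime p)) gS_tr giS_mul) tpoint_eta //.
Qed.

Lemma dH_forget a (u : S) : (forall p r, dset D p -> dset D r -> forgetH p = forgetH r -> u p = u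
  r) ->
  Spart (idxH n a) u = 0.
Proof.
move=> hu; apply: S_eq => p Dp; rewrite S0; apply: Spart_unique => //.
have C0 : (fun=> 0 : R) @ admissible (dset D) (idxH n a) p --> (0 : R).
  by have F := admissible_filter (dset D) (idxH n a) p; exact: cvg_cst.
apply: cvg_trans C0; apply: near_eq_cvg.
have F := admissible_filter (dset D) (idxH n a) p.
apply: filterS (near_admissible (dset D) (idxH n a) p) => h [_ Dh].
by rewrite /diff_quot (hu _ p Dh Dp) ?subrr ?mulr0 // forgetH_none // axisH.
Qed.

Lemma forgetH_eq (p r : 'rV[R]_(n + N + 1)) : forgetH p = forgetH r ->
  tspace p = tspace r /\ ttime p = ttime r.
Proof.
move=> e; split; first by rewrite -(forgetH_lsub p) e forgetH_lsub.
by rewrite -(forgetH_rsub p) e forgetH_rsub.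
Qed.

Lemma dH_gS a i j : Spart (idxH n a) (gS i j) = 0.
Proof.
by apply: dH_forget => p r Dp Dr /forgetH_eq[e1 e2]; rewrite !gSE // e1 e2.
Qed.

Lemma dH_ScalS a : Spart (idxH n a) ScalS = 0.
Proof.
by apply: dH_forget => p r Dp Dr /forgetH_eq[e1 e2]; rewrite !ScalS_val // e1 e2.
Qed.

Lemma RicS_tr : RicS^T = RicS.
Proof. exact: (Ric_tr (fun i => dd _) (fun i j x => dC _ _ x) hh gS_tr giS_mul). Qed.

(** The equation of the flow, which refers to functions on U x ]0, T], pulled back
    to the product. *)
Lemma d0_gS i j : Spart (idx0 n N) (gS i j) = - (RicS i j + RicS i j).
Proof.
apply: S_eq => p Dp; rewrite SN SD RicS_val //; apply: Spart_unique => //.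
have [h1 h2 h3] := Dsub Dp.
have [hp1 hp2] := hflow i j hc h3 h1.
have := has_partialP hp1; rewrite hp2 => hp.
have := pull_is_partial (ax := axis) (D' := dset D) (pr := forgetH) forgetH_some
  D_forget_loc (@axis0 n N) Dp hp.
have -> : - 2 * Ric_comp (chart_img c) (g c (ttime p)) i j (tspace p) =
  - (Ric_comp (chart_img c) (g c (ttime p)) i j (tspace p) +
     Ric_comp (chart_img c) (g c (ttime p)) i j (tspace p)) by ring.
apply: is_partial_ext => // q Dq.
by rewrite gSE //= /on_spacetime forgetH_lsub forgetH_rsub.
Qed.

Lemma Scst0 : Scst D 0 = 0. Proof. by apply: S_eq => p Dp; rewrite ScstE // S0. Qed.
Lemma Scst1 : Scst D 1 = 1. Proof. by apply: S_eq => p Dp; rewrite ScstE // S1. Qed.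

Definition tauS : S := Scoord D (idx0 n N).
Lemma tauS_val p : dset D p -> tauS p = ttime p.
Proof. by move=> Dp; rewrite ScoordE // ttimeE. Qed.
Lemma tauS_neq0 p : dset D p -> tauS p != 0.
Proof. by move=> Dp; have [_ _ /andP[h _]] := Dsub Dp; rewrite tauS_val // gt_eqF. Qed.
Definition tauiS : S := sval (S_inv tauS_neq0).
Lemma tauS_mul : tauS * tauiS = 1.
Proof. by rewrite /tauiS; case: (S_inv _). Qed.
Lemma tauiS_val p : dset D p -> tauiS p = (ttime p)^-1.
Proof.
move=> Dp; have e : ttime p * tauiS p = 1 by rewrite -tauS_val // -SM tauS_mul S1.
have t0 : ttime p != 0 by rewrite -tauS_val // tauS_neq0.
by apply: (mulfI t0); rewrite e divff.
Qed.

Lemma dM_tauS i : Spart (idxM N i) tauS = 0.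
Proof. by rewrite Spart_coord idxM0 Scst0. Qed.
Lemma dH_tauS a : Spart (idxH n a) tauS = 0.
Proof. by rewrite Spart_coord idxH0 Scst0. Qed.
Lemma d0_tauS : Spart (idx0 n N) tauS = 1.
Proof. by rewrite Spart_coord eqxx Scst1. Qed.

Definition yS (a : 'I_N) : S := Scoord D (idxH n a).
Definition sigS : S := 1 - \sum_a yS a * yS a.
Lemma sigS_val p : dset D p -> sigS p = 1 - sqnorm (thyp p).
Proof.
move=> Dp; rewrite SD SN S1 // S_sum; congr (_ - _); apply: eq_bigr => a _.
by rewrite SM ScoordE // -thypE expr2.
Qed.
Lemma sigS_neq0 p : dset D p -> sigS p != 0.
Proof.
by move=> Dp; have [_ h _] := Dsub Dp; rewrite sigS_val // gt_eqF // subr_gt0.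
Qed.
Definition rhoS : S := sval (S_inv sigS_neq0).
Lemma sigS_mul : sigS * rhoS = 1. Proof. by rewrite /rhoS; case: (S_inv _). Qed.
Lemma rhoS_val p : dset D p -> rhoS p = (1 - sqnorm (thyp p))^-1.
Proof.
move=> Dp; have e : (1 - sqnorm (thyp p)) * rhoS p = 1 by rewrite -sigS_val // -SM sigS_mul S1.
have t0 : 1 - sqnorm (thyp p) != 0 by rewrite -sigS_val // sigS_neq0.
by apply: (mulfI t0); rewrite e divff.
Qed.

Definition psiS a : S := (yS a + yS a) * rhoS.

Lemma d_rhoS a : Spart a rhoS = - (rhoS * rhoS * Spart a sigS).
Proof.
have e : Spart a sigS * rhoS + sigS * Spart a rhoS = 0.
  by rewrite -SpartM sigS_mul (der1 (dd a)).
have -> : Spart a rhoS = rhoS * (sigS * Spart a rhoS).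
  by rewrite mulrA (mulrC rhoS) sigS_mul mul1r.
by move/eqP: e; rewrite addrC addr_eq0 => /eqP ->; ring.
Qed.

Lemma d_sigS a : Spart a sigS = - (\sum_b (yS b + yS b) * Spart a (yS b)).
Proof.
rewrite (derB (dd a)) (der1 (dd a)) (der_sum (dd a)) sub0r; congr (- _).
by apply: eq_bigr => b _; rewrite SpartM; ring.
Qed.

Lemma dM_y i a : Spart (idxM N i) (yS a) = 0.
Proof. by rewrite Spart_coord idxMH Scst0. Qed.
Lemma d0_y a : Spart (idx0 n N) (yS a) = 0.
Proof. by rewrite Spart_coord idx0H Scst0. Qed.
Lemma dH_y a b : Spart (idxH n a) (yS b) = (a == b)%:R.
Proof. by rewrite Spart_coord idxH_eq; case: (a == b); rewrite ?Scst0 ?Scst1. Qed.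

Lemma dM_rho i : Spart (idxM N i) rhoS = 0.
Proof.
rewrite d_rhoS d_sigS big1 ?oppr0 ?mulr0 ?oppr0 // => b _.
by rewrite dM_y mulr0.
Qed.
Lemma d0_rho : Spart (idx0 n N) rhoS = 0.
Proof.
rewrite d_rhoS d_sigS big1 ?oppr0 ?mulr0 ?oppr0 // => b _.
by rewrite d0_y mulr0.
Qed.
Lemma dH_rho a : Spart (idxH n a) rhoS = psiS a * rhoS.
Proof.
rewrite d_rhoS d_sigS (bigD1 a) //= dH_y eqxx mulr1 big1 ?addr0 => [|b ba].
  by rewrite /psiS; ring.
by rewrite dH_y eq_sym (negPf ba) mulr0.
Qed.

Lemma dH_psiS a b : Spart (idxH n a) (psiS b) =
  (rhoS + rhoS) * (a == b)%:R + psiS a * psiS b.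
Proof. by rewrite {1}/psiS !(SpartM, SpartD) dH_y dH_rho /psiS; ring. Qed.

Hypothesis N_gt0 : (0 < N)%N.

Definition lamS : S := Scst D (8 * N%:R) * (rhoS * rhoS).
Definition lamiS : S := Scst D (8 * N%:R)^-1 * (sigS * sigS).
Lemma ScstM (x y : R) : Scst D x * Scst D y = Scst D (x * y).
Proof. by apply: S_eq => p Dp; rewrite SM !ScstE. Qed.
Lemma N_neq0 : (N%:R : R) != 0. Proof. by rewrite pnatr_eq0 -lt0n. Qed.
Lemma lamS_mul : lamiS * lamS = 1.
Proof.
have -> : lamiS * lamS = Scst D (8 * N%:R)^-1 * Scst D (8 * N%:R) * (sigS * rhoS) * (sigS * rhoS).
  by rewrite /lamS /lamiS; ring.
by rewrite sigS_mul ScstM mulVf ?Scst1 ?mul1r // mulf_neq0 // ?N_neq0 // pnatr_eq0.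
Qed.
Lemma dM_lamS i : Spart (idxM N i) lamS = 0.
Proof. by rewrite /lamS !SpartM Spart_cst dM_rho; ring. Qed.
Lemma d0_lamS : Spart (idx0 n N) lamS = 0.
Proof. by rewrite /lamS !SpartM Spart_cst d0_rho; ring. Qed.
Lemma dH_lamS a : Spart (idxH n a) lamS = (psiS a + psiS a) * lamS.
Proof. by rewrite /lamS !SpartM Spart_cst dH_rho; ring. Qed.
Lemma lamS_val p : dset D p -> lamS p = 2 * N%:R * (4 / (1 - sqnorm (thyp p)) ^+ 2).
Proof.
move=> Dp; rewrite !SM rhoS_val // ScstE //.
by have := sigS_neq0 Dp; rewrite sigS_val // => h; field.
Qed.

Lemma psiS_norm : \sum_a psiS a * psiS a = 4%:R * (rhoS * rhoS) - 4%:R * rhoS.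
Proof.
have -> : \sum_a psiS a * psiS a = 4%:R * (rhoS * rhoS) * (\sum_a yS a * yS a).
  by rewrite mulr_sumr; apply: eq_bigr => a _; rewrite /psiS; ring.
have -> : \sum_a yS a * yS a = 1 - sigS by rewrite /sigS; ring.
have -> : 4%:R * (rhoS * rhoS) * (1 - sigS) =
  4%:R * (rhoS * rhoS) - 4%:R * rhoS * (sigS * rhoS) by ring.
by rewrite sigS_mul mulr1.
Qed.

Definition cS : S := Scst D (N%:R / 2).
Definition ciS : S := Scst D (2 / N%:R).
Lemma cS_mul : cS * ciS = 1.
Proof.
by rewrite ScstM -Scst1; congr (Scst D _); field; rewrite N_neq0.
Qed.
Lemma rho_lamS : 4%:R * (rhoS * rhoS) = Shalf D * Shalf D * lamS * ciS.
Proof.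
rewrite /Shalf /lamS /ciS.
have -> : Scst D 2^-1 * Scst D 2^-1 * (Scst D (8 * N%:R) * (rhoS * rhoS)) * Scst D (2 / N%:R) =
   Scst D 2^-1 * Scst D 2^-1 * Scst D (8 * N%:R) * Scst D (2 / N%:R) * (rhoS * rhoS) by ring.
rewrite !ScstM; congr (_ * _); apply: S_eq => p Dp; rewrite ScstE //.
have -> : (2^-1 * 2^-1 * (8 * N%:R) * (2 / N%:R) : R) = 4%:R by field; rewrite N_neq0.
by rewrite !mulrS mulr0n addr0 !SD S1 // mulr0n addr0.
Qed.

Definition phiS : S := ScalS - cS * tauiS.
Lemma phiS_val p : dset D p -> phiS p =
  scal (chart_img c) (g c (ttime p)) (tspace p) - N%:R / (2 * ttime p).
Proof.
move=> Dp; rewrite SD SN SM ScalS_val // tauiS_val // ScstE //; congr (_ - _).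
by have := tauS_neq0 Dp; rewrite tauS_val // => h; field.
Qed.

Lemma S_nat k p : dset D p -> (k%:R : S) p = k%:R.
Proof. by move=> Dp; elim: k => [|k IH]; rewrite ?S0 // !mulrS SD S1 // IH. Qed.

Hypothesis phi_neq0 : forall p, dset D p -> phiS p != 0.
Definition phiiS : S := sval (S_inv phi_neq0).
Lemma phiiS_mul : phiiS * phiS = 1.
Proof. by rewrite mulrC /phiiS; case: (S_inv _). Qed.

Lemma flow_product_S : flow_product (@Spart R _ D) (Shalf D) gS giS RicS tauS tauiS psiS
  rhoS lamS lamiS cS ciS ScalS phiS phiiS.
Proof.
split=> //.
- exact: gS_tr.
- exact: giS_mul.
- exact: RicS_tr.
- exact: dH_gS.
- exact: d0_gS.
- exact: dM_tauS.
- exact: dH_tauS.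
- exact: d0_tauS.
- exact: tauS_mul.
- exact: dH_psiS.
- exact: dM_lamS.
- exact: d0_lamS.
- exact: dH_lamS.
- exact: lamS_mul.
- exact: psiS_norm.
- by move=> a; exact: Spart_cst.
- exact: cS_mul.
- exact: rho_lamS.
- exact: dH_ScalS.
- exact: phiiS_mul.
Qed.

Local Notation Gt := (block3 N gS (tauS * lamS) phiS).
Local Notation Gti := (block3 N giS (tauiS * lamiS) phiiS).
Local Notation Lt := (lowered_curvature (@Spart R _ D) (Shalf D) Gt Gti).
Local Notation Rt := (ricci_mx (@Spart R _ D) (Shalf D) Gt Gti).
Let W := flow_product_S.

Lemma tilde_gE p : tilde_g g c p = block3 N (g c (ttime p) (tspace p))
  (ttime p * (2 * N%:R * (4 / (1 - sqnorm (thyp p)) ^+ 2)))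
  (scal (chart_img c) (g c (ttime p)) (tspace p) - N%:R / (2 * ttime p)).
Proof. by rewrite /tilde_g /block3 /hyp_metric scale_scalar_mx. Qed.

Lemma rep_tilde a b : rep (fun p => p) (fun p => tilde_g g c p a b) (Gt a b).
Proof.
move=> p Dp; rewrite tilde_gE.
case: (idxP a) => *; case: (idxP b) => *; rewrite !block3E ?S0 ?gSE ?phiS_val //.
case: eqP => _; rewrite ?mulr0n ?S0 // !mulr1n SM lamS_val // tauS_val //.
Qed.

Lemma tid_basis a (h : R) (p : 'rV[R]_(n + N + 1)) :
  (fun p => p) (h *: basis_vec a + p) = h *: basis_vec a + p.
Proof. by []. Qed.

Lemma tid_dom a (p : 'rV[R]_(n + N + 1)) : dset D p -> \forall h \near (0 : R),
  tilde_dom T c (h *: basis_vec a + p) <-> dset D (h *: basis_vec a + p).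
Proof.
move=> Dp; apply: filterS (Dloc_shift a Dp) => h hD.
by split=> // /Dsub.
Qed.

Local Notation tdom := (@tilde_dom R n M T c N).
Local Notation tg := (@tilde_g R n M g c N).

Lemma Riem_tilde p (u v w z : 'rV[R]_(n + N + 1)) : dset D p -> Riem tdom tg p u v w z =
  quadrilinear u v w z (fun a i b l => Lt a i b l p).
Proof.
move=> Dp.
exact: (RiemE (ka := fun a => a) tid_basis tid_dom rep_tilde (G_tr W) (G_inv W) u v w z Dp).
Qed.

Lemma Ric_tilde p (u v : 'rV[R]_(n + N + 1)) : dset D p -> Ric tdom tg p u v =
  bil u v (fun a b => Rt a b p).
Proof.
move=> Dp; rewrite /Ric.
transitivity (\sum_k \sum_l \sum_a \sum_b
   u 0 a * v 0 b * (Gti k l p * Lt a k b l p)).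
  apply: eq_bigr => k _; apply: eq_bigr => l _.
  rewrite ((rep_ginv rep_tilde (G_inv W) k l) p Dp) Riem_tilde // mulr_sumr.
  apply: eq_bigr => a _; rewrite exchange_big mulr_sumr; apply: eq_bigr => b _ /=.
  have -> : \sum_i \sum_j u 0 a * (basis_vec k : 'rV_ _) 0 i * v 0 b *
      (basis_vec l : 'rV_ _) 0 j * Lt a i b j p =
    bil (basis_vec k) (basis_vec l) (fun i j => u 0 a * v 0 b * Lt a i b j p).
    by apply: eq_bigr => i _; apply: eq_bigr => j _; ring.
  by rewrite bil_basis mulrCA.
rewrite (exchange4 (fun k l a b => u 0 a * v 0 b * (Gti k l p * Lt a k b l p))).
apply: eq_bigr => a _; apply: eq_bigr => b _; rewrite RicE S_sum mulr_sumr.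
apply: eq_bigr => k _; rewrite S_sum mulr_sumr; apply: eq_bigr => l _.
by rewrite SM.
Qed.

(** * Components in an adapted frame *)

Section Frame.
Variables (y : 'rV[R]_N) (e : 'M[R]_N).
Hypothesis he : hyp_orthonormal y e.
Local Notation fr a := (@tilde_frame R n N e a).

Lemma frM i x : fr (idxM N i) 0 x = (idxM N i == x)%:R.
Proof.
rewrite mxE; case: (idxP x) => [j|b|]; rewrite idx_eqE.
- by rewrite block_mxEul block_mxEul mxE.
- by rewrite block_mxEul block_mxEur mxE.
- by rewrite block_mxEur mxE.
Qed.
Lemma fr0 x : fr (idx0 n N) 0 x = (idx0 n N == x)%:R.
Proof.
rewrite mxE; case: (idxP x) => [j|b|]; rewrite idx_eqE.
- by rewrite block_mxEdl mxE.
- by rewrite block_mxEdl mxE.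
- by rewrite block_mxEdr mxE.
Qed.
Lemma frHM a i : fr (idxH n a) 0 (idxM N i) = 0.
Proof. by rewrite mxE block_mxEul block_mxEdl mxE. Qed.
Lemma frHH a b : fr (idxH n a) 0 (idxH n b) = e a b.
Proof. by rewrite mxE block_mxEul block_mxEdr. Qed.
Lemma frH0 a : fr (idxH n a) 0 (idx0 n N) = 0.
Proof. by rewrite mxE block_mxEur mxE. Qed.

Lemma fr_base a : ~~ isHb a -> fr a = basis_vec a.
Proof.
by case: (idxP a) => [i|b|]; rewrite ?isHb_H // => _; apply/rowP => x;
  rewrite basis_vecE ?frM ?fr0.
Qed.

Lemma fr_sumH a (f : 'I_(n + N + 1) -> R) :
  \sum_x fr (idxH n a) 0 x * f x = \sum_b e a b * f (idxH n b).
Proof.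
rewrite sum_tilde frH0 mul0r addr0 big1 ?add0r => [|i _]; last by rewrite frHM mul0r.
by apply: eq_bigr => b _; rewrite frHH.
Qed.

Lemma fr_supp a x : isHb a -> ~~ isHb x -> fr a 0 x = 0.
Proof.
case: (idxP a) => [i|b|]; rewrite ?isHb_M ?isHb_0 // => _.
by case: (idxP x) => [i|d|]; rewrite ?isHb_H // ?frHM ?frH0.
Qed.

Definition dH (a b : 'I_(n + N + 1)) : R := (isHb a && (a == b))%:R.

Lemma bil_ext (u v : 'rV[R]_(n + N + 1)) B B' :
  (forall a b, u 0 a * v 0 b * B a b = u 0 a * v 0 b * B' a b) -> bil u v B = bil u v B'.
Proof. by move=> h; apply: eq_bigr => a _; apply: eq_bigr => b _. Qed.

Lemma bil0 (u v : 'rV[R]_(n + N + 1)) B :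
  (forall a b, u 0 a * v 0 b * B a b = 0) -> bil u v B = 0.
Proof. by move=> h; rewrite /bil big1 // => a _; rewrite big1 // => b _. Qed.

(** The frame is orthonormal for the hyperbolic metric, so [fibre_form] becomes
    the identity matrix on it, whatever the point and the basis are. *)
Lemma bil_fibre_form p a b : dset D p -> thyp p = y ->
  bil (fr a) (fr b) (fun x z => fibre_form n N lamS x z p) = dH a b.
Proof.
move=> Dp py; rewrite /dH.
case: (boolP (isHb a)) => [ha|na] /=; last first.
  apply: bil0 => x z; rewrite (fr_base na) basis_vecE; case: eqP => [<-|_]; last by rewrite !mul0r.
  by case: (idxP a) na => [i|d|]; rewrite ?isHb_H // => _;
    rewrite ?fibre_formM_ ?fibre_form0_ S0 mulr0.
case: (boolP (isHb b)) => [hb|nb]; last first.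
  rewrite bil0 => [|x z].
    by case: eqP => // ab; rewrite ab (negPf nb) in ha.
  rewrite (fr_base nb) basis_vecE; case: eqP => [<-|_]; last by rewrite mulr0 mul0r.
  by case: (idxP b) nb => [i|d|]; rewrite ?isHb_H // => _;
    rewrite ?fibre_form_M ?fibre_form_0 S0 mulr0.
case: (idxP a) ha => [i|a'|]; rewrite ?isHb_M ?isHb_0 // => _.
case: (idxP b) hb => [i|b'|]; rewrite ?isHb_M ?isHb_0 // => _.
rewrite idx_eqE.
have := he; rewrite /hyp_orthonormal => /matrixP/(_ a' b').
rewrite [RHS]mxE => <-.
rewrite mul_mx_scalar -scalemxAl mxE mxE /bil.
under eq_bigr do under eq_bigr do rewrite -mulrA.
under eq_bigr do rewrite -mulr_sumr.
rewrite fr_sumH mulr_sumr; apply: eq_bigr => d _.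
rewrite fr_sumH (bigD1 d) //= big1 ?addr0 => [|f fd].
  rewrite fibre_formHH SM /kron eqxx S1 // lamS_val // py mxE; ring.
by rewrite fibre_formHH SM /kron eq_sym (negPf fd) S0 !mulr0.
Qed.

Lemma bil_base_form p a b : bil (fr a) (fr b)
    (fun x z => base_form (@Spart R _ D) (Shalf D) RicS tauiS ScalS phiiS x z p) =
  base_form (@Spart R _ D) (Shalf D) RicS tauiS ScalS phiiS a b p.
Proof.
case: (boolP (isHb a)) => [ha|na].
  case: (idxP a) ha => [i|a'|]; rewrite ?isHb_M ?isHb_0 // => _; rewrite base_formH_ S0.
  apply: bil0 => x z; case: (boolP (isHb x)) => [/existsP[d /eqP->]|nx].
    by rewrite base_formH_ S0 mulr0.
  by rewrite (fr_supp (isHb_H _ _) nx) !mul0r.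
case: (boolP (isHb b)) => [hb|nb].
  case: (idxP b) hb => [i|b'|]; rewrite ?isHb_M ?isHb_0 // => _; rewrite base_form_H S0.
  apply: bil0 => x z; case: (boolP (isHb z)) => [/existsP[d /eqP->]|nz].
    by rewrite base_form_H S0 mulr0.
  by rewrite (fr_supp (isHb_H _ _) nz) mulr0 mul0r.
by rewrite !fr_base // bil_basis.
Qed.

Section FrameComponents.
Variable p : 'rV[R]_(n + N + 1).
Hypotheses (Dp : dset D p) (py : thyp p = y).
Local Notation SS a b := (base_form (@Spart R _ D) (Shalf D) RicS tauiS ScalS phiiS a b p).
Local Notation kp := (kappa (Shalf D) tauS ciS ScalS phiiS p).

Lemma tRm_base a b d f : ~~ isHb a -> ~~ isHb b -> ~~ isHb d -> ~~ isHb f ->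
  tilde_Riem T g c e p a b d f = Lt a b d f p.
Proof.
move=> ha hb hd hf; rewrite /tilde_Riem Riem_tilde // !fr_base //.
transitivity (bil (basis_vec a) (basis_vec b) (fun x i =>
   bil (basis_vec d) (basis_vec f) (fun z w => Lt x i z w p))).
  apply: eq_bigr => x _; apply: eq_bigr => i _; rewrite /bil mulr_sumr.
  apply: eq_bigr => z _; rewrite mulr_sumr; apply: eq_bigr => w _; ring.
by rewrite !bil_basis.
Qed.

(** If one of the four vectors is tangent to the fibre, only coefficients with a
    fibre index are involved, so the closed form applies term by term. *)
Lemma tRm_H a b d f : [|| isHb a, isHb b, isHb d | isHb f] ->
  tilde_Riem T g c e p a b d f =
  kp * (dH a d * dH b f - dH a f * dH b d)
  + dH a d * SS b f - dH a f * SS b d - dH b d * SS a f + dH b f * SS a d.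
Proof.
move=> hH; rewrite /tilde_Riem Riem_tilde //.
transitivity (quadrilinear (fr a) (fr b) (fr d) (fr f) (fun x i z w =>
  (kp * (fibre_form n N lamS x z p * fibre_form n N lamS i w p) + (- kp) * (fibre_form n N lamS x
    w p * fibre_form n N lamS i z p))
  + ((fibre_form n N lamS x z p * SS i w + (-1) * (fibre_form n N lamS x w p * SS i z)) +
     ((-1) * (SS x w * fibre_form n N lamS i z p) + SS x z * fibre_form n N lamS i w p)))).
  apply: quad_ext => x i z w.
  case: (boolP [|| isHb x, isHb i, isHb z | isHb w]) => [hx|].
    rewrite (Lt_fibre W hx) /fibre_curv; congr (_ * _).
    move: (kappa _ _ _ _ _) => k; rewrite !(SD, SN, SM).
    have ringE (u h1 h2 h3 h4 s1 s2 s3 s4 : R) :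
      u * (h1 * h2 - h3 * h4) + h1 * s1 - h3 * s2 - h4 * s3 + h2 * s4 =
      u * (h1 * h2) + - u * (h3 * h4) + (h1 * s1 + -1 * (h3 * s2) + (-1 * (s3 * h4) + s4 * h2)).
      by ring.
    exact: ringE.
  rewrite !negb_or => /and4P[nx ni nz nw].
  suff -> : fr a 0 x * fr b 0 i * fr d 0 z * fr f 0 w = 0 by rewrite !mul0r.
  by case/or4P: hH => h; rewrite (fr_supp h) ?mul0r ?mulr0 ?mul0r.
rewrite !quadD !quadZ.
rewrite (quad_prod1 _ _ _ _ (fun x z => fibre_form n N lamS x z p) (fun i w => fibre_form n N
  lamS i w p)).
rewrite (quad_prod2 _ _ _ _ (fun x w => fibre_form n N lamS x w p) (fun i z => fibre_form n N
  lamS i z p)).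
rewrite (quad_prod1 _ _ _ _ (fun x z => fibre_form n N lamS x z p) (fun i w => SS i w)).
rewrite (quad_prod2 _ _ _ _ (fun x w => fibre_form n N lamS x w p) (fun i z => SS i z)).
rewrite (quad_prod2 _ _ _ _ (fun x w => SS x w) (fun i z => fibre_form n N lamS i z p)).
rewrite (quad_prod1 _ _ _ _ (fun x z => SS x z) (fun i w => fibre_form n N lamS i w p)).
rewrite !bil_fibre_form // !bil_base_form.
have ringE (u h1 h2 h3 h4 s1 s2 s3 s4 : R) :
  u * (h1 * h2) + - u * (h3 * h4) + (h1 * s1 + -1 * (h3 * s2) + (-1 * (s3 * h4) + s4 * h2)) =
  u * (h1 * h2 - h3 * h4) + h1 * s1 - h3 * s2 - h4 * s3 + h2 * s4 by ring.
exact: ringE.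
Qed.

Lemma tRic_base a b : ~~ isHb a -> ~~ isHb b -> tilde_Ric T g c e p a b = Rt a b p.
Proof. by move=> ha hb; rewrite /tilde_Ric Ric_tilde // !fr_base // bil_basis. Qed.

End FrameComponents.
End Frame.

(** * Values at a point of the product *)

Section AtPoint.
Variables (q : 'rV[R]_n) (y : 'rV[R]_N) (t : R).
Local Notation p := (tpoint q y t).
Hypothesis Dp : dset D p.
Local Notation X := (chart_img c).
Local Notation gt := (g c t).
Local Notation r i j := (Ric_comp X gt i j q).
Local Notation gi i j := (ginv gt q i j).
Local Notation sR := (scal X gt q).
Local Notation Ds i := (partial X i (scal X gt) q).
Local Notation Hm i j := (harnackM X gt t i j q).
Local Notation s0 := (dt_scal X gt t q).
Let F : R := phiiS p.

Lemma t_gt0 : 0 < t.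
Proof. by have [_ _ ] := Dsub Dp; rewrite ttime_tpoint => /andP[]. Qed.
Let tn0 : t != 0. Proof. by rewrite gt_eqF // t_gt0. Qed.

Lemma phi_val : phiS p = sR - N%:R / (2 * t).
Proof. by rewrite phiS_val // ttime_tpoint tspace_tpoint. Qed.

Lemma F_phi : F * (sR - N%:R / (2 * t)) = 1.
Proof. by rewrite -phi_val -SM phiiS_mul S1. Qed.

(** This is [F * phi = 1] rearranged. On the left, 1 stands for the contribution
    of M to a component of the Ricci tensor, the other term for that of the fibre. *)
Lemma F_trace : 1 + N%:R / (2 * t) * F = F * sR.
Proof. by rewrite -[X in X + _]F_phi; ring. Qed.

Let rb := @io_basis y t.
Let rd := @io_dom y t.
Let rg := @io_g y t.

Let at_q (f : 'rV[R]_n -> R) (G : S) : rep (fun q => tpoint q y t) f G -> f q = G p.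
Proof. by move=> h; exact: h. Qed.

Lemma r_val i j : RicS i j p = r i j.
Proof. by rewrite RicS_val // ttime_tpoint tspace_tpoint. Qed.
Lemma s_val : ScalS p = sR.
Proof. by rewrite ScalS_val // ttime_tpoint tspace_tpoint. Qed.
Lemma ti_val : tauiS p = t^-1.
Proof. by rewrite tauiS_val // ttime_tpoint. Qed.
Lemma t_val : tauS p = t.
Proof. by rewrite tauS_val // ttime_tpoint. Qed.
Lemma gi_val i j : giS i j p = gi i j.
Proof. exact: esym (at_q (rep_ginv rg giS_mul i j)). Qed.
Lemma Ds_val i : Spart (idxM N i) ScalS p = Ds i.
Proof.
exact: esym (at_q (rep_partial rb rd i (rep_scal rb rd rg gS_tr giS_mul))).
Qed.
Lemma half_val : Shalf D p = 2^-1.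
Proof. by rewrite ScstE. Qed.

Let dbd i : derivation (db i) := dd (idxM N i).
Let dbC i j x : db i (db j x) = db j (db i x) := dC (idxM N i) (idxM N j) x.
Local Notation hessS := (hessian db (Shalf D) gS giS).
Local Notation Ric_squareS := (Ric_square db (Shalf D) gS giS).

(** Hamilton's matrix M without its last term, by the evolution equation of the
    Ricci tensor ([MS_val]). *)
Definition MS i j : S := Spart (idx0 n N) (RicS i j) - Shalf D * hessS ScalS i j + Ric_squareS i j.

Lemma MS_val i j : MS i j p = Hm i j - (2 * t)^-1 * r i j.
Proof.
rewrite (at_q (rep_harnackM rb rd rg gS_tr giS_mul t i j)).
rewrite -r_val -[X in _ - X * _](ScstE _ Dp) -SM -SN -SD; congr (sval_of _ _).
rewrite /MS (dt_Ric dbd dbC hh gS_tr giS_mul (dd _) (fun i => dC _ _) d0_gS); ring.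
Qed.

Lemma s0_val : Spart (idx0 n N) ScalS p = s0.
Proof.
have := traced_evolution dbd dbC hh gS_tr giS_mul (dd _) (fun i => dC _ _) d0_gS.
move=> /(congr1 (fun u : S => u p)); rewrite SM half_val /dt_scal => e.
have -> : Spart (idx0 n N) ScalS p = 2 * (2^-1 * Spart (idx0 n N) ScalS p).
  by rewrite mulrA mulfV ?mul1r // pnatr_eq0.
rewrite -e S_sum; congr (_ * _); apply: eq_bigr => k _; rewrite S_sum.
by apply: eq_bigr => l _; rewrite SM gi_val -MS_val mxE.
Qed.

Lemma sum_lin (a b e : 'I_n -> 'I_n -> R) (x u : R) :
  \sum_k \sum_l (a k l + x * (b k l - u * e k l)) =
  \sum_k \sum_l a k l + x * (\sum_k \sum_l b k l - u * \sum_k \sum_l e k l).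
Proof.
rewrite mulr_sumr -sumrB mulr_sumr -big_split; apply: eq_bigr => k _ /=.
by rewrite mulr_sumr -sumrB mulr_sumr -big_split.
Qed.

Lemma tM_val : \sum_k \sum_l gi k l * (Hm k l - (2 * t)^-1 * r k l) = 2^-1 * s0.
Proof. by rewrite /dt_scal mulrA mulVf ?mul1r // pnatr_eq0. Qed.

Lemma val_MMMM i j k l : Lt (idxM N i) (idxM N j) (idxM N k) (idxM N l) p =
  Riem_comp X gt i j k l q + F * (r j k * r i l - r i k * r j l).
Proof.
rewrite (Lt_MMMM W) !SD SN !SM !r_val (at_q (rep_Riem_comp rb rd rg gS_tr giS_mul i j k l)).
rewrite -/F; move: (sval_of _ _) (Ric_comp _ _ _ _ _) (Ric_comp _ _ _ _ _)
  (Ric_comp _ _ _ _ _) (Ric_comp _ _ _ _ _) => *; ring.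
Qed.

Lemma val_MM0M i j k : Lt (idxM N i) (idxM N j) (idx0 n N) (idxM N k) p =
  harnackP X gt i j k q + F * (2^-1 * (Ds j * r i k - Ds i * r j k)).
Proof.
rewrite (Lt_MM0M W) SD (at_q (rep_harnackP rb rd rg gS_tr giS_mul i j k)); congr (_ + _).
rewrite !SM SD SN !SM !r_val !Ds_val half_val -/F.
by move: (Ric_comp _ _ _ _ _) (Ric_comp _ _ _ _ _) (partial _ _ _ _) (partial _ _ _ _) => *; ring.
Qed.

Local Notation Xc i j := (harnack_corr X gt t q i j).

Lemma dphi_val : Spart (idx0 n N) phiS p = s0 + N%:R / 2 * (t^-1 * t^-1).
Proof. by rewrite (d0_phi W) SD !SM s0_val ti_val ScstE. Qed.

Lemma ip_val i j : ip giS (RicS i) (RicS j) = Ric_squareS i j.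
Proof.
rewrite /ip /Ric_square mxE exchange_big; apply: eq_bigr => b _.
rewrite mxE mulr_suml; apply: eq_bigr => a _.
by rewrite (Ric_sym dbd dbC hh gS_tr giS_mul j b).
Qed.

(** The term [R_ij / (2 t)] of M arises from the part of [dt phi] that is
    proportional to [N]. *)
Lemma val_M0M0 i j : Lt (idxM N i) (idx0 n N) (idxM N j) (idx0 n N) p =
  Hm i j + F * Xc i j.
Proof.
rewrite (Lt_M0M0 W) ip_val -/(MS i j) SD MS_val [(phiiS * _) p]SM -/F.
have -> : (Shalf D * Shalf D * (Spart (idxM N i) ScalS * Spart (idxM N j) ScalS)
    - Shalf D * RicS i j * Spart (idx0 n N) phiS) p =
    2^-1 * 2^-1 * (Ds i * Ds j) - 2^-1 * r i j * (s0 + N%:R / 2 * (t^-1 * t^-1)).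
  by rewrite SD SN 5!SM half_val (Ds_val i) (Ds_val j) r_val dphi_val.
rewrite /harnack_corr.
have e : (2 * t)^-1 = F * (2^-1 * (sR / t - N%:R / 2 * (t^-1 * t^-1))).
  rewrite -[LHS]mul1r -[X in X * _ = _]F_phi -[LHS]mulrA; congr (_ * _).
  by move: sR tn0 => s tn; field.
rewrite e.
by move: (harnackM _ _ _ _ _ _) (Ric_comp _ _ _ _ _) (partial _ _ _ _) (partial _ _ _ _)
  (scal _ _ _) (dt_scal _ _ _ _) F (t^-1) => H r0 a b u v w ti; field.
Qed.

Definition Sv (a b : 'I_(n + N + 1)) : R := base_form (@Spart R _ D) (Shalf D) RicS tauiS ScalS
  phiiS a b p.

Lemma kappa_val : kappa (Shalf D) tauS ciS ScalS phiiS p = - (F * (sR * t / (2 * N%:R))).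
Proof.
rewrite SN !SM half_val s_val t_val ScstE // -/F.
by move: (scal _ _ _) F => u v; field; rewrite N_neq0.
Qed.

Lemma Sv_MM i j : Sv (idxM N i) (idxM N j) = F * (2^-1 * r i j).
Proof. by rewrite /Sv base_formMM !SM half_val r_val mulrCA mulrA -/F. Qed.
Lemma Sv_M0 i : Sv (idxM N i) (idx0 n N) = F * (4^-1 * Ds i).
Proof.
rewrite /Sv base_formM0 !SM half_val Ds_val -/F.
by move: (partial _ _ _ _) F => u v; field.
Qed.
Lemma Sv_0M i : Sv (idx0 n N) (idxM N i) = F * (4^-1 * Ds i).
Proof.
rewrite /Sv base_form0M !SM half_val Ds_val -/F.
by move: (partial _ _ _ _) F => u v; field.
Qed.
Lemma Sv_00 : Sv (idx0 n N) (idx0 n N) = F * (4^-1 * (s0 + sR / t)).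
Proof.
rewrite /Sv base_form00 !SM SD SM half_val s0_val s_val ti_val -/F.
by move: (dt_scal _ _ _ _) (scal _ _ _ / t) F => u v w; field.
Qed.

(** The trace of the Gauss equation gives [R_ij] and the fibre [N / (2 t) * F *
    R_ij], whose sum is [F * s * R_ij]; everything else is a multiple of [F] from
    the start. *)
Lemma val_Rt_MM i j : Rt (idxM N i) (idxM N j) p =
  F * ((\sum_k \sum_l gi k l * (r k j * r i l)) + Hm i j + F * Xc i j).
Proof.
rewrite (Rt_MM W) !SD S_sum !SM half_val r_val ti_val val_M0M0 -/F.
rewrite S_nat //.
have -> : \sum_k (\sum_l giS k l * Lt (idxM N i) (idxM N k) (idxM N j) (idxM N l)) p =
  r i j + F * ((\sum_k \sum_l gi k l * (r k j * r i l)) - r i j * sR).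
  transitivity (\sum_k \sum_l (gi k l * Riem_comp X gt i k j l q +
     F * (gi k l * (r k j * r i l) - r i j * (gi k l * r k l)))).
    apply: eq_bigr => k _; rewrite S_sum; apply: eq_bigr => l _.
    by rewrite SM gi_val val_MMMM; move: (Riem_comp _ _ _ _ _ _ _) (ginv _ _ _ _)
      (Ric_comp _ _ _ _ _) (Ric_comp _ _ _ _ _) (Ric_comp _ _ _ _ _) (Ric_comp _ _ _ _ _) => *;
        ring.
  exact: (sum_lin (fun k l => gi k l * Riem_comp X gt i k j l q)
    (fun k l => gi k l * (r k j * r i l)) (fun k l => gi k l * r k l)).
have -> : r i j + F * (\sum_k \sum_l gi k l * (r k j * r i l) - r i j * sR) +
   N%:R / t * (2^-1 * F * r i j) + F * (Hm i j + F * Xc i j) =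
  r i j * (1 + N%:R / (2 * t) * F) - F * (r i j * sR) +
   F * (\sum_k \sum_l gi k l * (r k j * r i l) + Hm i j + F * Xc i j).
  by move: (\sum_k _) (harnack_corr _ _ _ _ i j) (harnackM _ _ _ _ _ _) (Ric_comp _ _ _ _ _)
    (scal _ _ _) F tn0 =>
    a b u v w z tn; field.
rewrite F_trace.
by move: (\sum_k _) (harnack_corr _ _ _ _ i j) (harnackM _ _ _ _ _ _) (Ric_comp _ _ _ _ _) (scal
  _ _ _) F => *; ring.
Qed.

Lemma trP_val i : \sum_k \sum_l gi k l * harnackP X gt i k l q = 2^-1 * Ds i.
Proof.
have := ctr_cov dbd hh gS_tr giS_mul i RicS.
have := contracted_bianchi dbd dbC hh gS_tr giS_mul i.
set cov := cov_tensor2 _ _ _ _ => /(congr1 (fun u : S => u p)); rewrite SM half_val Ds_val => e1.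
move=> /(congr1 (fun u : S => u p)); rewrite Ds_val => e2.
have P k l : harnackP X gt i k l q = cov i RicS k l p - cov k RicS i l p.
  by rewrite (at_q (rep_harnackP rb rd rg gS_tr giS_mul i k l)) SD SN.
transitivity (\sum_k \sum_l (gi k l * cov i RicS k l p + (-1) * (gi k l * cov k RicS i l p - 0 *
  0))).
  by apply: eq_bigr => k _; apply: eq_bigr => l _; rewrite P; ring.
rewrite (sum_lin (fun k l => gi k l * cov i RicS k l p)
   (fun k l => gi k l * cov k RicS i l p) (fun _ _ => 0)) mul0r subr0.
have -> : \sum_k \sum_l gi k l * cov i RicS k l p = Ds i.
  rewrite -e2 S_sum; apply: eq_bigr => k _; rewrite S_sum; apply: eq_bigr => l _.
  by rewrite SM gi_val.
have -> : \sum_k \sum_l gi k l * cov k RicS i l p = 2^-1 * Ds i.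
  rewrite -e1 S_sum; apply: eq_bigr => k _; rewrite S_sum; apply: eq_bigr => l _.
  by rewrite SM gi_val.
by move: (partial _ _ _ _) => u; field.
Qed.

(** As for [val_Rt_MM], with half the gradient of the scalar curvature as the
    trace of P. *)
Lemma val_Rt_M0 i : Rt (idxM N i) (idx0 n N) p =
  F * (2^-1 * \sum_k \sum_l gi k l * (Ds k * r i l)).
Proof.
rewrite (Rt_M0 W) SD S_sum !SM half_val Ds_val ti_val S_nat // -/F.
have -> : \sum_k (\sum_l giS k l * Lt (idxM N i) (idxM N k) (idx0 n N) (idxM N l)) p =
  2^-1 * Ds i + F * 2^-1 * ((\sum_k \sum_l gi k l * (Ds k * r i l)) - Ds i * sR).
  transitivity (\sum_k \sum_l (gi k l * harnackP X gt i k l q +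
     F * 2^-1 * (gi k l * (Ds k * r i l) - Ds i * (gi k l * r k l)))).
    apply: eq_bigr => k _; rewrite S_sum; apply: eq_bigr => l _.
    rewrite SM gi_val val_MM0M; move: (harnackP _ _ _ _ _ _) (ginv _ _ _ _)
      (Ric_comp _ _ _ _ _) (Ric_comp _ _ _ _ _) (partial _ _ _ _) (partial _ _ _ _) => *; ring.
  rewrite -trP_val.
  exact: (sum_lin (fun k l => gi k l * harnackP X gt i k l q)
    (fun k l => gi k l * (Ds k * r i l)) (fun k l => gi k l * r k l)).
have -> : 2^-1 * Ds i + F * 2^-1 * (\sum_k \sum_l gi k l * (Ds k * r i l) - Ds i * sR) +
   N%:R / t * (2^-1 * 2^-1 * F * Ds i) =
  2^-1 * (Ds i * (1 + N%:R / (2 * t) * F)) - 2^-1 * (F * sR * Ds i) +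
   F * (2^-1 * \sum_k \sum_l gi k l * (Ds k * r i l)).
  by move: (\sum_k _) (partial _ _ _ _) (scal _ _ _) F tn0 => a u v w tn; field.
rewrite F_trace.
by move: (\sum_k _) (partial _ _ _ _) (scal _ _ _) F => *; ring.
Qed.

(** As for [val_Rt_MM]; the trace of M is half of [dt s + s / t]. *)
Lemma val_Rt_00 : Rt (idx0 n N) (idx0 n N) p =
  F * (4^-1 * \sum_k \sum_l gi k l * (Ds k * Ds l)).
Proof.
rewrite (Rt_00 W) SD S_sum.
rewrite !SM SD SM half_val s0_val s_val ti_val S_nat // -/F.
have -> : \sum_k (\sum_l giS k l * Lt (idx0 n N) (idxM N k) (idx0 n N) (idxM N l)) p =
  2^-1 * s0 + F * 4^-1 * ((\sum_k \sum_l gi k l * (Ds k * Ds l)) - 2 * (s0 + sR / t) * sR) +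
  (2 * t)^-1 * sR.
  transitivity (\sum_k \sum_l (gi k l * (Hm k l - (2 * t)^-1 * r k l) +
     F * 4^-1 * (gi k l * (Ds k * Ds l) - 2 * (s0 + sR / t) * (gi k l * r k l))) +
     \sum_k \sum_l (2 * t)^-1 * (gi k l * r k l)).
    rewrite -big_split; apply: eq_bigr => k _ /=; rewrite S_sum -big_split; apply: eq_bigr => l _.
    rewrite SM gi_val (L_flip (@Spart_derivation _ _ D) dC hh (G_tr W) (G_inv W)) val_M0M0
      /harnack_corr [RHS]/=.
    move: (harnackM _ _ _ _ _ _) (ginv _ _ _ _) (Ric_comp _ _ _ _ _) (partial _ _ _ _)
      (partial _ _ _ _) (s0 + sR / t) F ((2 * t)^-1) => *; field=> //.
  have -> : \sum_k \sum_l (2 * t)^-1 * (gi k l * r k l) = (2 * t)^-1 * sR.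
    rewrite mulr_sumr; apply: eq_bigr => k _; by rewrite mulr_sumr.
  by rewrite (sum_lin (fun k l => gi k l * (Hm k l - (2 * t)^-1 * r k l))
    (fun k l => gi k l * (Ds k * Ds l)) (fun k l => gi k l * r k l)) tM_val.
have -> : 2^-1 * s0 + F * 4^-1 * (\sum_k \sum_l gi k l * (Ds k * Ds l)
     - 2 * (s0 + sR / t) * sR) + (2 * t)^-1 * sR +
   N%:R / t * (2^-1 * 2^-1 * F * (s0 + sR / t)) =
  2^-1 * ((s0 + sR / t) * (1 + N%:R / (2 * t) * F)) - 2^-1 * (F * sR * (s0 + sR / t)) +
   F * (4^-1 * \sum_k \sum_l gi k l * (Ds k * Ds l)).
  by move: (\sum_k _) (dt_scal _ _ _ _) (scal _ _ _) F tn0 => a u v w tn; field.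
rewrite F_trace.
by move: (\sum_k _) (dt_scal _ _ _ _) (scal _ _ _) F => *; ring.
Qed.

Definition Rt_coef : R := sR / (2 * N%:R) + F * (4^-1 * (s0 + sR / t)).

(** Every contribution carries the factor [F]; what remains of those of M and of
    the fibre, [s / 2] and [- s (N - 1) / (2 N)], nearly cancels. *)
Lemma val_Rt_H_ a x : Rt (idxH n a) x p = fibre_form n N lamS (idxH n a) x p * (F * Rt_coef).
Proof.
rewrite (Rt_H_ W) SM; congr (_ * _).
rewrite 2!SD [(phiiS * _) p]SM [(tauiS * _ * _) p]SM [(tauiS * _) p]SM -/F kappa_val ti_val.
rewrite SD SN S1 // S_nat // -/(Sv _ _) Sv_00.
have -> : (\sum_k \sum_l giS k l * base_form (@Spart R _ D) (Shalf D) RicS tauiS ScalS phiiS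
    (idxM N k) (idxM N l)) p = F * (2^-1 * sR).
  rewrite S_sum mulr_sumr mulr_sumr; apply: eq_bigr => k _.
  rewrite S_sum mulr_sumr mulr_sumr; apply: eq_bigr => l _.
  by rewrite SM gi_val -/(Sv _ _) Sv_MM; move: (ginv _ _ _ _) (Ric_comp _ _ _ _ _) => *; ring.
rewrite /Rt_coef; move: (dt_scal _ _ _ _) (scal _ _ _) F tn0 N_neq0 => u v w tn Nn; field.
by rewrite tn Nn.
Qed.

(** * Estimates *)

Variables (e : 'M[R]_N) (B : R).
Hypotheses (he : hyp_orthonormal y e) (hB : flow_bound X gt t q B) (F1 : `|F| <= 1).
Local Notation small u := (`|u| <= `|F| * (6 * B)).

Let B_ge0 : 0 <= B.
Proof. by case: hB => _ _ _ _ [_ _ _ _ [_ h _]]; exact: le_trans h. Qed.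

Lemma smallF (v : R) : `|v| <= 6 * B -> small (F * v).
Proof. by move=> hv; rewrite normrM ler_wpM2l. Qed.

Lemma le_6B (x : R) : x <= B -> x <= 6 * B.
Proof. by move: B_ge0 => b0; lra. Qed.

Lemma small_base a b : ~~ isHb a -> ~~ isHb b -> small (Rt a b p).
Proof.
case: hB => _ _ h3 h4 [h5 h6 _ _ _].
case: (idxP a) => [i|a'|]; rewrite ?isHb_H // => _; case: (idxP b) => [j|b'|];
  rewrite ?isHb_H // => _.
- rewrite val_Rt_MM; apply: smallF; apply: le_trans (ler_normD _ _) _; rewrite normrM.
  have hx : `|F| * `|Xc i j| <= B.
    by apply: le_trans (h3 i j); rewrite ler_piMl.
  by move: (h4 i j) hx B_ge0 => u1 u2 u3; lra.
- by rewrite val_Rt_M0; apply: smallF; apply: le_6B; exact: h5.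
- rewrite (Ric_sym (@Spart_derivation _ _ D) dC hh (G_tr W) (G_inv W)) val_Rt_M0.
  by apply: smallF; apply: le_6B; exact: h5.
- by rewrite val_Rt_00; apply: smallF; apply: le_6B; exact: h6.
Qed.

Lemma le_divN (u : R) : `|u / (2 * N%:R)| <= `|2^-1 * u|.
Proof.
rewrite (_ : u / (2 * N%:R) = N%:R^-1 * (2^-1 * u)); last by field; rewrite N_neq0.
rewrite normrM ler_piMl // ger0_norm ?invr_ge0 ?ler0n // invf_le1 ?ltr0n // ler1n //.
Qed.

Lemma Rt_coef_bound : `|Rt_coef| <= 6 * B.
Proof.
case: hB => _ _ _ _ [_ _ _ _ [h9 h10 _]].
apply: le_trans (ler_normD _ _) _; rewrite [X in _ + X <= _]normrM.
have hN : `|sR / (2 * N%:R)| <= B.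
  exact: le_trans (le_divN sR) h10.
have hx : `|F| * `|4^-1 * (s0 + sR / t)| <= B.
  by apply: le_trans h9; rewrite ler_piMl.
by move: hN hx B_ge0 => u1 u2 u3; lra.
Qed.

Lemma dH_01 a b : (0 : R) <= dH a b <= 1.
Proof. by rewrite /dH ler0n lern1 leq_b1. Qed.

Lemma small_tRic a b : small (tilde_Ric T g c e p a b).
Proof.
have Rsym x z : Rt x z = Rt z x.
  exact: (Ric_sym (@Spart_derivation _ _ D) dC hh (G_tr W) (G_inv W)).
have py : thyp p = y by rewrite thyp_tpoint.
have caseH a' b' : isHb a' -> small (bil (tilde_frame e a') (tilde_frame e b') (fun x z => Rt x z
  p)).
  move=> ha; rewrite (bil_ext (B' := fun x z => F * Rt_coef * fibre_form n N lamS x z p));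
    last first.
    move=> x z; case: (boolP (isHb x)) => [/existsP[d /eqP->]|nx].
      by rewrite val_Rt_H_ [_ * (F * _)]mulrC.
    by rewrite (fr_supp _ ha nx) !mul0r.
  have -> : bil (tilde_frame e a') (tilde_frame e b') (fun x z => F * Rt_coef * fibre_form n N
    lamS x z p)
    = F * (Rt_coef * dH a' b').
    rewrite -(bil_fibre_form he a' b' Dp py) mulrA /bil mulr_sumr; apply: eq_bigr => x _.
    by rewrite mulr_sumr; apply: eq_bigr => z _; rewrite mulrCA.
  apply: smallF; rewrite normrM; apply: le_trans Rt_coef_bound.
  by have /andP[d0 d1] := dH_01 a' b'; rewrite ler_piMr // ger0_norm.
case: (boolP (isHb a)) => ha; first by rewrite /tilde_Ric Ric_tilde //; exact: caseH.
case: (boolP (isHb b)) => hb.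
  rewrite /tilde_Ric Ric_tilde // bil_swap (bil_ext (B' := fun x z => Rt x z p));
    first exact: caseH.
  by move=> x z; rewrite (Rsym z x).
by rewrite tRic_base //; exact: small_base.
Qed.

Lemma Sv_bound a b : exists v, Sv a b = F * v /\ `|v| <= B.
Proof.
case: hB => _ _ _ _ [_ _ h7 h8 [h9 _ _]].
case: (idxP a) => [i|a'|].
- case: (idxP b) => [j|b'|].
  + by exists (2^-1 * r i j); rewrite Sv_MM; split=> //; exact: h7.
  + by exists 0; rewrite /Sv base_form_H S0 mulr0 normr0.
  + by exists (4^-1 * Ds i); rewrite Sv_M0; split=> //; exact: h8.
- by exists 0; rewrite /Sv base_formH_ S0 mulr0 normr0.
- case: (idxP b) => [j|b'|].
  + by exists (4^-1 * Ds j); rewrite Sv_0M; split=> //; exact: h8.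
  + by exists 0; rewrite /Sv base_form_H S0 mulr0 normr0.
  + by exists (4^-1 * (s0 + sR / t)); rewrite Sv_00.
Qed.

Lemma small_tRm_H a b d f : [|| isHb a, isHb b, isHb d | isHb f] ->
  small (tilde_Riem T g c e p a b d f).
Proof.
move=> hH; have py : thyp p = y by rewrite thyp_tpoint.
rewrite (tRm_H he Dp py hH) -!/(Sv _ _) kappa_val.
have [v1 [-> b1]] := Sv_bound b f; have [v2 [-> b2]] := Sv_bound b d.
have [v3 [-> b3]] := Sv_bound a f; have [v4 [-> b4]] := Sv_bound a d.
have hk : `|sR * t / (2 * N%:R)| <= B.
  case: hB => _ _ _ _ [_ _ _ _ [_ _ h11]].
  exact: le_trans (le_divN (sR * t)) h11.
move: hk; set k0 := sR * t / (2 * N%:R) => hk.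
have -> : - (F * k0) * (dH a d * dH b f - dH a f * dH b d) + dH a d * (F * v1)
   - dH a f * (F * v2) - dH b d * (F * v3) + dH b f * (F * v4) =
   F * (- k0 * (dH a d * dH b f) + k0 * (dH a f * dH b d) + dH a d * v1 - dH a f * v2
    - dH b d * v3 + dH b f * v4).
  by clear hk; move: (dH a d) (dH a f) (dH b d) (dH b f) k0 F => *; ring.
apply: smallF.
have mb (x v : R) : 0 <= x <= 1 -> `|v| <= B -> `|x * v| <= B.
  move=> /andP[x0 x1] hv; rewrite normrM ger0_norm //.
  by apply: le_trans hv; rewrite ler_piMl.
have dd2 (x z : R) : 0 <= x <= 1 -> 0 <= z <= 1 -> 0 <= x * z <= 1.
  by move=> /andP[x0 x1] /andP[z0 z1]; rewrite mulr_ge0 //= mulr_ile1.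
have m1 := mb _ _ (dd2 _ _ (dH_01 a d) (dH_01 b f)) hk.
have m2 := mb _ _ (dd2 _ _ (dH_01 a f) (dH_01 b d)) hk.
have m3 := mb _ _ (dH_01 a d) b1; have m4 := mb _ _ (dH_01 a f) b2.
have m5 := mb _ _ (dH_01 b d) b3; have m6 := mb _ _ (dH_01 b f) b4.
rewrite mulNr ![k0 * _]mulrC.
move: m1 m2 m3 m4 m5 m6; rewrite !ler_norml.
move: (_ * k0) (_ * k0) (_ * v1) (_ * v2) (_ * v3) (_ * v4) => w1 w2 w3 w4 w5 w6.
move=> /andP[? ?] /andP[? ?] /andP[? ?] /andP[? ?] /andP[? ?] /andP[? ?].
by apply/andP; split; lra.
Qed.

Lemma small_tRm_MMMM i j k l : small
  (tilde_Riem T g c e p (idxM N i) (idxM N j) (idxM N k) (idxM N l) - Riem_comp X gt i j k l q).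
Proof.
rewrite tRm_base ?isHb_M // val_MMMM addrC addKr; apply: smallF; apply: le_6B.
by case: hB => h _ _ _ _; exact: h.
Qed.

Lemma small_tRm_MM0M i j k : small
  (tilde_Riem T g c e p (idxM N i) (idxM N j) (idx0 n N) (idxM N k) - harnackP X gt i j k q).
Proof.
rewrite tRm_base ?isHb_M ?isHb_0 // val_MM0M addrC addKr; apply: smallF; apply: le_6B.
by case: hB => _ h _ _ _; exact: h.
Qed.

Lemma small_tRm_M0M0 i j : small
  (tilde_Riem T g c e p (idxM N i) (idx0 n N) (idxM N j) (idx0 n N) - harnackM X gt t i j q).
Proof.
rewrite tRm_base ?isHb_M ?isHb_0 // val_M0M0 addrC addKr; apply: smallF; apply: le_6B.
by case: hB => _ _ h _ _; exact: h.
Qed.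
End AtPoint.
End TildeRing.

(** * Signature and domain of the product metric *)

Section LorentzianBlock.
Context {R : realType} {n N : nat}.
Variables (A : 'M[R]_n) (x y : R).
Hypotheses (AT : A^T = A) (Apos : pos_def A) (x_gt0 : 0 < x) (y_lt0 : y < 0).

Lemma block3_form (a a' : 'rV[R]_n) (b b' : 'rV[R]_N) (z z' : 'rV[R]_1) :
  (row_mx (row_mx a b) z *m block3 N A x y *m (row_mx (row_mx a' b') z')^T) 0 0 =
  (a *m A *m a'^T) 0 0 + x * (b *m b'^T) 0 0 + y * (z 0 0 * z' 0 0).
Proof.
rewrite /block3 !mul_row_block !(mulmx0, addr0, add0r) !tr_row_mx !mul_row_col !mul_mx_scalar.
rewrite -!scalemxAl [LHS]mxE [X in X + _]mxE; congr (_ + _ + _); first by rewrite mxE.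
by rewrite mxE; congr (_ * _); rewrite mxE big_ord1 mxE.
Qed.

Lemma sumsq_gt0 (b : 'rV[R]_N) : b != 0 -> 0 < (b *m b^T) 0 0.
Proof.
move=> b0; rewrite mxE; under eq_bigr do rewrite mxE -expr2.
rewrite lt0r sumr_ge0 ?andbT => [|i _]; last exact: sqr_ge0.
apply: contra b0; rewrite psumr_eq0 => [/allP h|i _]; last exact: sqr_ge0.
apply/eqP/rowP => i; rewrite mxE; apply/eqP.
by have := h i (mem_index_enum i); rewrite sqrf_eq0.
Qed.

(** The time direction is negative, and its orthogonal complement consists of the
    vectors without time component. *)
Lemma block3_lorentzian : lorentzian (block3 N A x y).
Proof.
split; first 1 last.
- by rewrite block3_tr AT.
- exists (row_mx (row_mx 0 0) 1%:M : 'rV[R]_(n + N + 1)).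
  have form (z : 'rV[R]_(n + N + 1)) : (row_mx (row_mx 0 0) 1%:M *m block3 N A x y *m z^T) 0 0 =
    y * z 0 (idx0 n N).
    by rewrite -[z]hsubmxK -[lsubmx z]hsubmxK row_mxEr block3_form !mul0mx
      ![(0 : matrix _ _ _) _ _]mxE mulr0 !add0r [1%:M _ _]mxE eqxx mul1r.
  split=> [|w w0]; first by rewrite form row_mxEr mxE mulr1.
  rewrite form => /eqP; rewrite mulf_eq0 lt_eqF //= => /eqP wt.
  rewrite -[w]hsubmxK -[lsubmx w]hsubmxK block3_form.
  set a := lsubmx (lsubmx w); set b := rsubmx (lsubmx w).
  have z0 : rsubmx w 0 0 = 0 by rewrite mxE.
  rewrite z0 !mulr0 addr0.
  have bge0 : 0 <= x * (b *m b^T) 0 0.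
    have [->|/sumsq_gt0/ltW h] := eqVneq b 0; first by rewrite mul0mx mxE mulr0.
    by rewrite mulr_ge0 // ltW.
  have [a0|/Apos h] := eqVneq a 0; last by rewrite ltr_wpDr.
  suff b0 : b != 0 by rewrite a0 !mul0mx mxE add0r mulr_gt0 // sumsq_gt0.
  apply: contra w0 => /eqP b0; apply/eqP.
  rewrite -[w]hsubmxK -[lsubmx w]hsubmxK -/a -/b a0 b0.
  by rewrite (_ : rsubmx w = 0) ?row_mx0 //; apply/rowP => i; rewrite ord1 z0 mxE.
- have : block3 N A x y *m block3 N (invmx A) x^-1 y^-1 = 1%:M.
    have x0 : x != 0 by rewrite gt_eqF.
    have y0 : y != 0 by rewrite lt_eqF.
    by rewrite block3_mul mulmxV ?pos_def_unit // !divff // block3_1.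
  by move/mulmx1_unit => [].
Qed.
End LorentzianBlock.

Section Spacetime.
Context {R : realType} {n : nat} {M : topologicalType}.
Variables (A : set (chart R n M)) (T : R) (g : chart R n M -> R -> 'rV[R]_n -> 'M[R]_n).
Hypotheses (hA : smooth_manifold A) (hg : smooth_metric_family A T g) (hflow : ricci_flow A T g).
Variables (c : chart R n M) (hc : A c) (N : nat).

Lemma sqnorm_thyp_cvg (p : 'rV[R]_(n + N + 1)) :
  sqnorm (thyp r) @[r --> p] --> sqnorm (thyp p).
Proof.
rewrite /sqnorm; have FF : Filter (nbhs p) by exact: nbhs_filter.
apply: (@cvg_big _ _ _ _ _ _ _ (nbhs p)) => [|a _]; first exact: add_continuous.
rewrite (_ : (fun r : 'rV[R]_(n + N + 1) => _) = (fun r => r 0 (idxH n a) * r 0 (idxH n a))).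
  by rewrite thypE expr2; apply: cvgM; exact: coord_continuous.
by apply/funext => r; rewrite thypE expr2.
Qed.

Lemma tilde_dom_lower_open : lower_open (@tilde_dom R n M T c N).
Proof.
move=> p [h1 h2 /andP[h3 h4]].
have [_ /(_ c hc)[_ oc _ _ _] _ _ _] := hA.
have n1 : \forall r \near p, chart_img c (tspace r).
  exact: tspace_cvg (open_nbhs_nbhs (conj oc h1)).
have n2 : \forall r \near p, sqnorm (thyp r) < 1.
  exact: sqnorm_thyp_cvg (lt_nbhsl h2).
have n3 : \forall r \near p, 0 < ttime r.
  exact: ttime_cvg (lt_nbhsr h3).
apply: filterS3 n1 n2 n3 => r r1 r2 r3 le_r; split=> //.
by rewrite r3 /=; apply: le_trans h4; rewrite !ttimeE le_r.
Qed.

Local Notation phi p :=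
  (scal (chart_img c) (g c (ttime p)) (tspace p) - N%:R / (2 * ttime p)).

(** The part of the product on which the metric is Lorentzian. *)
Definition tilde_dom_neg : set 'rV[R]_(n + N + 1) :=
  [set p | tilde_dom T c p /\ phi p < 0].

(** On the whole product [phi] belongs to the ring of smooth functions, so it is
    continuous. *)
Lemma phi_neg_near p : tilde_dom_neg p ->
  \forall r \near p, tilde_dom T c r -> phi r < 0.
Proof.
move=> [Dp np].
pose D3 := Domain tilde_dom_lower_open (ex_intro _ p Dp).
have D3sub q : dset D3 q -> tilde_dom T c q by [].
have D3loc q : dset D3 q -> \forall r \near q, tilde_dom T c r -> dset D3 r.
  by move=> _; apply: filterE.
have := smooth_continuous (S_smooth (phiS hg hc D3sub D3loc)).
move=> /within_contP/(_ p Dp); rewrite phiS_val // => h.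
have : \forall r \near within (dset D3) (nbhs p), phiS hg hc D3sub D3loc r < 0.
  exact: h _ (lt_nbhsl np).
rewrite near_withinE; apply: filterS => r hr Dr.
by have := hr Dr; rewrite phiS_val.
Qed.

Lemma tilde_dom_neg_lower_open : lower_open tilde_dom_neg.
Proof.
move=> p Dp; have Dp' : tilde_dom T c p by case: Dp.
apply: filterS2 (tilde_dom_lower_open Dp') (phi_neg_near Dp) => r r1 r2 le_r.
by split; [exact: r1 | exact/r2/r1].
Qed.

Lemma tilde_dom_neg_local p : tilde_dom_neg p ->
  \forall r \near p, tilde_dom T c r -> tilde_dom_neg r.
Proof. by move=> /phi_neg_near; apply: filterS => r hr Dr; split=> //; exact: hr. Qed.
End Spacetime.

(** For such [N] the scalar curvature is at most half of [N / (2 t)] in absolute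
    value. *)
Lemma inv_time_coef_bound (R : realType) (s t : R) (N : nat) : 0 < t ->
  4 * t * `|s| <= N%:R -> 4 * t <= N%:R ->
  let phi := s - N%:R / (2 * t) in
  phi < 0 /\ forall F, F * phi = 1 -> `|F| <= 4 * t / N%:R /\ 4 * t / N%:R <= 1.
Proof.
move=> t0 h1 h2 phi.
have N0 : 0 < N%:R :> R by apply: lt_le_trans h2; lra.
have hphi : phi <= - (N%:R / (4 * t)).
  have : `|s| <= N%:R / (4 * t) by rewrite ler_pdivlMr ?mulr_gt0 // mulrC.
  rewrite ler_norml => /andP[_ hs]; rewrite /phi.
  have -> : N%:R / (2 * t) = N%:R / (4 * t) + N%:R / (4 * t) by field; rewrite gt_eqF.
  by lra.
have pos : 0 < N%:R / (4 * t) by rewrite divr_gt0 ?mulr_gt0.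
split; first by lra.
move=> F Fphi; split; last by rewrite ler_pdivrMr // mul1r.
have : `|F| * `|phi| = 1 by rewrite -normrM Fphi normr1.
have phi0 : phi < 0 by lra.
rewrite (ltr0_norm phi0) => e.
rewrite ler_pdivlMr //.
have : `|F| * (N%:R / (4 * t)) <= 1.
  by rewrite -[leRHS]e ler_wpM2l //; lra.
by rewrite mulrA ler_pdivrMr ?mulr_gt0 // mul1r.
Qed.

Lemma isHP (n N : nat) (a : 'I_(n + N + 1)) : isH a -> isHb a.
Proof. by move=> [b ->]; exact: isHb_H. Qed.

Theorem theorem1p2 (R : realType) (n : nat) (M : topologicalType)
    (A : set (chart R n M)) (hA : smooth_manifold A)
    (T : R) (hT : 0 < T)
    (g : chart R n M -> R -> 'rV[R]_n -> 'M[R]_n)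
    (hg : smooth_metric_family A T g)
    (hflow : ricci_flow A T g)
    (hcomplete : forall t : R, 0 < t <= T ->
       complete_metric A (fun c => g c t))
    (hbounded : bounded_curvature A T g)
    (x : M) (t : R) (ht : 0 < t <= T)
    (c : chart R n M) (hc : A c) (hx : chart_dom c x) :
  exists (C' : R) (N0 : nat), forall N : nat, (N0 <= N)%N ->
    forall (y : 'rV[R]_N) (e : 'M[R]_N),
      hyp_ball y -> hyp_orthonormal y e ->
      let q := chart_map c x in
      let D := chart_img c in
      let p := tpoint q y t in
      let tRic := tilde_Ric T g c e p in
      let tRm := tilde_Riem T g c e p in
      let O1N (u : R) := `|u| <= C' / N%:R in
      [/\ lorentzian (tilde_g g c p),
          (forall a b, O1N (tRic a b)) &
          [/\ (forall i j k l,
                 O1N (tRm (idxM N i) (idxM N j) (idxM N k) (idxM N l)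
                      - Riem_comp D (g c t) i j k l q)),
              (forall i j k,
                 O1N (tRm (idxM N i) (idxM N j) (idx0 n N) (idxM N k)
                      - harnackP D (g c t) i j k q)),
              (forall i j,
                 O1N (tRm (idxM N i) (idx0 n N) (idxM N j) (idx0 n N)
                      - harnackM D (g c t) t i j q)) &
              (forall a b d f,
                 isH a \/ isH b \/ isH d \/ isH f -> O1N (tRm a b d f))]].
Proof.
have /andP[t0 _] := ht.
pose q := chart_map c x; pose s := scal (chart_img c) (g c t) q.
have Xq : chart_img c q by exists x.
have [B hB] := flow_bound_ex (chart_img c) (g c t) t q.
(* [6 B] from the components, at most six terms each, times [4 t] from [1 / phi] *)
exists (24 * t * B).
exists (maxn 1 (maxn (Num.truncn (4 * t * `|s|)).+1 (Num.truncn (4 * t)).+1)).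
move=> N; rewrite !geq_max => /and3P[N_gt0 N1 N2] y e hy he /=.
have le_trunc (u : R) : ((Num.truncn u).+1 <= N)%N -> u <= N%:R.
  move=> h; have : u < (Num.truncn u).+1%:R by rewrite truncnS_gt.
  by move/ltW/le_trans; apply; rewrite ler_nat.
have [phi0 hF] := inv_time_coef_bound t0 (le_trunc _ N1) (le_trunc _ N2).
have Dp : tilde_dom_neg T g c (tpoint q y t).
  by split; rewrite ?tspace_tpoint ?ttime_tpoint //; split;
    rewrite ?tspace_tpoint ?thyp_tpoint ?ttime_tpoint.
pose D := Domain (tilde_dom_neg_lower_open hA hg hc (N:=N)) (ex_intro _ _ Dp).
have Dsub p : dset D p -> tilde_dom T c p by case.
have Dloc p : dset D p -> \forall r \near p, tilde_dom T c r -> dset D r.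
  by move=> Dq; exact: (tilde_dom_neg_local hA hg hc).
have phi_neq0 p : dset D p -> phiS hg hc Dsub Dloc p != 0.
  by move=> Dq; rewrite phiS_val // lt_eqF //; case: Dq.
have [Fle Fle1] := hF _ (F_phi phi_neq0 (Dp : dset D (tpoint q y t))).
have F1 := le_trans Fle Fle1.
have B0 : 0 <= B by case: hB => _ _ _ _ [_ _ _ _ [_ h _]]; exact: le_trans h.
have close u : `|u| <= `|phiiS phi_neq0 (tpoint q y t)| * (6 * B) -> `|u| <= 24 * t * B / N%:R.
  move=> h; apply: le_trans h _.
  have -> : 24 * t * B / N%:R = 4 * t / N%:R * (6 * B).
    by field; rewrite pnatr_eq0 -lt0n.
  by rewrite ler_wpM2r // mulr_ge0.
split.
- have [gT gpos] : (g c t q)^T = g c t q /\ pos_def (g c t q) by have [h _ _] := hg; exact: h.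
  rewrite tilde_gE tspace_tpoint thyp_tpoint ttime_tpoint.
  apply: block3_lorentzian => //; rewrite !mulr_gt0 ?ltr0n ?invr_gt0 //.
  by rewrite exprn_gt0 // subr_gt0.
- by move=> a b; apply: close; exact: (small_tRic hflow N_gt0 (Dp : dset D _) he hB F1).
- split=> [i j k l|i j k|i j|a b d f hH]; apply: close.
  + exact: (small_tRm_MMMM hflow N_gt0).
  + exact: (small_tRm_MM0M hflow N_gt0).
  + exact: (small_tRm_M0M0 hflow N_gt0).
  + apply: (small_tRm_H hflow N_gt0) => //.
    by case: hH => [/isHP->|[/isHP->|[/isHP->|/isHP->]]]; rewrite ?orbT.
Qed.
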